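(* Let $S$ be a subsemigroup of $I_n$ generated by a set of maps all of rank $r$, for some $1<r\le n$. If $S$ is an inverse semigroup then $$\mathrm{rank}(S)\le\binom{n}{r}\max\left(2,\left\lfloor\frac{r}{2}\right\rfloor\right).$$
   Context: $I_n$ is the symmetric inverse semigroup on $\{1,\dots,n\}$, i.e. the semigroup of all partial injective maps of $\{1,\dots,n\}$ to itself under composition of partial maps. The rank of a map $\alpha\in I_n$ is $|\mathrm{im}\,\alpha|$. For a finite semigroup $S$, $\mathrm{rank}(S)$ is the least number of elements needed to generate $S$ as a semigroup. *)

(* Defs.v *)
From HB Require Import structures.
From mathcomp Require Import all_boot.

Set Implicit Arguments.
Unset Strict Implicit.
Unset Printing Implicit Defensive.

Local Open Scope group_scope.

(* The underlying set {1, ..., n} is represented by 'I_n = {0, ..., n-1}, and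
   a partial map by a total map to option 'I_n, None meaning undefined. *)
Definition pinjective (n : nat) (f : {ffun 'I_n -> option 'I_n}) : bool :=
  [forall x, forall y, (f x != None) && (f x == f y) ==> (x == y)].

Record sym_inv (n : nat) : predArgType := SymInv {
  pmap_of :> {ffun 'I_n -> option 'I_n};
  _ : pinjective pmap_of
}.

HB.instance Definition _ n := [isSub for @pmap_of n].
HB.instance Definition _ n := [Finite of sym_inv n by <:].

Lemma pinjectiveP n (f : {ffun 'I_n -> option 'I_n}) :
  reflect (forall x y z, f x = Some z -> f y = Some z -> x = y) (pinjective f).
Proof.
apply: (iffP forallP) => [H x y z fx fy | H x].
  by have /forallP/(_ y) := H x; rewrite fx fy eqxx /= => /eqP.
apply/forallP => y; apply/implyP => /andP[].
case fx: (f x) => [z|] // _ /eqP fy.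
by apply/eqP; apply: (H x y z).
Qed.

(* Maps are composed from left to right: x (f g) = (x f) g. *)
Definition pcomp (n : nat) (f g : {ffun 'I_n -> option 'I_n}) :
  {ffun 'I_n -> option 'I_n} := [ffun x => obind g (f x)].

Lemma pcomp_pinjective n (f g : sym_inv n) : pinjective (pcomp f g).
Proof.
apply/pinjectiveP => x y z; rewrite !ffunE.
case fx: (f x) => [u|] //= gu; case fy: (f y) => [v|] //= gv.
have /pinjectiveP g_inj := valP g; have /pinjectiveP f_inj := valP f.
by move: fy; rewrite -(g_inj _ _ _ gu gv); apply: f_inj.
Qed.

Definition sym_inv_mul n (f g : sym_inv n) : sym_inv n :=
  SymInv (pcomp_pinjective f g).

Lemma sym_inv_mulA n : associative (@sym_inv_mul n).
Proof.
move=> f g h; apply/val_inj/ffunP => x /=; rewrite !ffunE /=.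
by case: (f x) => [y|] //=; rewrite ffunE.
Qed.

HB.instance Definition _ n := hasMul.Build (sym_inv n) (@sym_inv_mul n).
HB.instance Definition _ n :=
  Magma_isSemigroup.Build (sym_inv n) (@sym_inv_mulA n).

Definition pim (n : nat) (f : sym_inv n) : {set 'I_n} :=
  [set y | [exists x, f x == Some y]].

Definition map_rank (n : nat) (f : sym_inv n) : nat := #|pim f|.

Definition subsemigroup (n : nat) (S : {set sym_inv n}) : bool :=
  [forall x in S, forall y in S, x * y \in S].

Definition sg_gen (n : nat) (A : {set sym_inv n}) : {set sym_inv n} :=
  \bigcap_(B : {set sym_inv n} | subsemigroup B && (A \subset B)) B.

Definition inverse_semigroup (n : nat) (S : {set sym_inv n}) : Prop :=
  subsemigroup S /\
  forall x, x \in S ->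
    exists! y, [/\ y \in S, x * y * x = x & y * x * y = y].

(* Meaningful for S a subsemigroup: then S generates itself, so the default
   point S of the minimisation is admissible (see sg_rankP). *)
Definition sg_rank (n : nat) (S : {set sym_inv n}) : nat :=
  #|[arg min_(A < S | sg_gen A == S) #|A|]|.

Lemma subsemigroupP n (S : {set sym_inv n}) :
  reflect (mulg_closed S) (subsemigroup S).
Proof.
apply: (iffP forall_inP) => [H x y Sx Sy | H x Sx].
  by have /forall_inP := H x Sx; apply.
by apply/forall_inP => y; apply: H.
Qed.

Lemma sg_gen_subsemigroup n (A : {set sym_inv n}) : subsemigroup (sg_gen A).
Proof.
apply/subsemigroupP => x y /bigcapP Ax /bigcapP Ay; apply/bigcapP => B AB.
have /andP[/subsemigroupP B_closed _] := AB.
by apply: B_closed; [apply: Ax | apply: Ay].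
Qed.

Lemma sub_sg_gen n (A : {set sym_inv n}) : A \subset sg_gen A.
Proof. by apply/bigcapsP => B /andP[]. Qed.

Lemma sg_gen_min n (A B : {set sym_inv n}) :
  subsemigroup B -> A \subset B -> sg_gen A \subset B.
Proof. by move=> cB sAB; apply: bigcap_inf; rewrite cB. Qed.

Lemma sg_gen_id n (S : {set sym_inv n}) : subsemigroup S -> sg_gen S = S.
Proof. by move=> cS; apply/eqP; rewrite eqEsubset sub_sg_gen sg_gen_min. Qed.

Lemma sg_rankP n (S : {set sym_inv n}) : subsemigroup S ->
  (exists2 A, sg_gen A = S & #|A| = sg_rank S) /\
  (forall A, sg_gen A = S -> sg_rank S <= #|A|).
Proof.
move=> cS; rewrite /sg_rank.
case: arg_minnP => [|A /eqP gA A_min]; first by rewrite sg_gen_id.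
by split=> [|B gB]; [exists A | apply: A_min; rewrite gB].
Qed.

(* Main.v *)
(* The rank r elements of S are the arrows of a groupoid whose objects are r-subsets of {1, ..., n}.
   In each component choose a base object; it suffices to generate the loop group there and to join
   every other object to it by an arrow and its inverse. The loop group acts on r points, so the
   bound follows from the theorem of McIver and Neumann: a group acting on n points is generated,
   modulo the kernel, by two elements if n = 3 and by floor(n/2) elements otherwise.

   The latter is proved without classification, by induction on n. Intransitive groups are split
   along an invariant subset. For transitive G, take a maximal subgroup H containing a point
   stabilizer.
   - If H is the point stabilizer (G primitive), then G is generated by H and one element, which is
     enough when n is even. For n odd one element must be saved. If a proper subset D has no Jordan
     subset, then the pointwise stabilizer of its complement needs only (|D| - 1)/2 elements, while a
     small Jordan set forces G to be very highly transitive. A doubly transitive group is generated by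
     one element together with a proper subgroup of H containing a two-point stabilizer, unless the
     latter is trivial.
   - Otherwise there is a system of k blocks of size b = n/k; lifting generators of the action on the
     blocks and generating the kernel block by block gives the bound for b odd and k <> 3. For b even
     a minimal block B on which the pointwise stabilizer of the complement acts transitively lets one
     replace b by b - 1 in all blocks but one. The case k = 3 is treated separately. *)

Require Import Defs.
From mathcomp Require Import all_boot all_fingroup all_solvable.
From mathcomp Require Import zify.

Set Implicit Arguments.
Unset Strict Implicit.
Unset Printing Implicit Defensive.

Import GroupScope.

(** The recurring obstacle is degree 3, where one generator more than [n./2] is needed: bounds for
    pieces no longer add up as soon as a piece has 3 points. This is why sets of 3, 4 or 5 points
    and systems of three blocks are treated apart. Odd degrees moreover leave no slack for the
    element that completes a maximal subgroup to [G]. Everything is counted relative to elements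
    already available, so that one element can serve twice: as a generator of a quotient and,
    through conjugation, in producing parts of the kernel. For semigroups the exception disappears,
    since [mn 3 = 2] is absorbed by the 2 in the maximum. That 2 is the price of an arrow and its
    inverse, and the binomial coefficient bounds the number of objects. Loops are kept as
    permutations of the whole set, so that the kernel consists of permutations restricting to the
    identity. *)

Ltac nlia := clear; lia.

(** * Generation relative to elements already available *)

Section RelativeGeneration.
Variable gT : finGroupType.
Implicit Types (A B N : {set gT}) (G H K L M : {group gT}).

(** [K] is any set, not necessarily inside [G]: elements of an overgroup that are already available,
    for instance for conjugating, may be put into it. *)
Definition dgen k (G K : {set gT}) : bool :=
  [exists A : {set gT}, [&& A \subset G, #|A| <= k & G \subset <<A :|: K>>]].

Lemma dgenP k (G K : {set gT}) :
  reflect (exists A : {set gT}, [/\ A \subset G, #|A| <= k & G \subset <<A :|: K>>])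
          (dgen k G K).
Proof.
apply: (iffP existsP) => [[A /and3P[? ? ?]]|[A [? ? ?]]]; exists A => //.
by apply/and3P.
Qed.

Lemma dgenI A (G K : {set gT}) : A \subset G -> G \subset <<A :|: K>> -> dgen #|A| G K.
Proof. by move=> sAG gAK; apply/dgenP; exists A. Qed.

Lemma dgen1I x (G K : {set gT}) : x \in G -> G \subset <<x |: K>> -> dgen 1 G K.
Proof. by move=> Gx gG; rewrite -(cards1 x); apply: dgenI; rewrite ?sub1set. Qed.

Lemma dgenW k l (G K : {set gT}) : k <= l -> dgen k G K -> dgen l G K.
Proof.
by move=> lekl /dgenP[A [? lA ?]]; apply/dgenP; exists A; split=> //; apply: leq_trans lekl.
Qed.

Lemma dgenS k (G K K' : {set gT}) : K \subset <<K'>> -> dgen k G K -> dgen k G K'.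
Proof.
move=> sKK' /dgenP[A [sA lA gA]]; apply/dgenP; exists A; split=> //.
apply: subset_trans gA _; rewrite gen_subG subUset sub_gen ?subsetUl //=.
by apply: subset_trans sKK' _; rewrite genS ?subsetUr.
Qed.

Lemma dgen0 (G K : {set gT}) : G \subset <<K>> -> dgen 0 G K.
Proof.
by move=> sGK; apply/dgenP; exists set0; rewrite sub0set cards0 set0U.
Qed.

(** [N] is a stock of free elements carried through both steps, so that costs add along a chain
    while conjugation by [N] stays available. *)
Lemma dgen_transN k l (N G K L : {set gT}) : K \subset G ->
  dgen k G (N :|: K) -> dgen l K (N :|: L) -> dgen (k + l) G (N :|: L).
Proof.
move=> sKG /dgenP[A [sA lA gA]] /dgenP[B [sB lB gB]].
apply/dgenP; exists (A :|: B); split.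
- by rewrite subUset sA (subset_trans sB).
- by rewrite (leq_trans (leq_card_setU _ _)) ?leq_add.
apply: subset_trans gA _; rewrite gen_subG !subUset.
apply/and3P; split.
- by rewrite sub_gen // -setUA subsetUl.
- by rewrite sub_gen // setUCA subsetUl.
by apply: subset_trans gB _; rewrite genS // -setUA subsetUr.
Qed.

Lemma dgen_trans k l (G K L : {set gT}) : K \subset G ->
  dgen k G K -> dgen l K L -> dgen (k + l) G L.
Proof.
move=> sKG dG dK; rewrite -[L]set0U; apply: (dgen_transN sKG); first by rewrite set0U.
by rewrite set0U.
Qed.

Lemma maximal_full (H G L : {group gT}) :
  maximal H G -> H \subset L -> L \subset G -> ~~ (L \subset H) -> G \subset L.
Proof.
move=> maxH sHL sLG nLH.
have /maximal_eqP[_ /(_ L sHL sLG)] : maximal_eq H G by rewrite /maximal_eq maxH orbT.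
by case=> eL; [rewrite eL subxx in nLH | rewrite eL].
Qed.

Lemma dgen_maximal k (G H : {group gT}) (K : {set gT}) :
  maximal H G -> dgen k H K -> dgen k.+1 G K.
Proof.
move=> maxH dH; have /properP[sHG [g Gg nHg]] := maxgroupp maxH.
rewrite -add1n; apply: (dgen_trans sHG) dH; apply: (dgen1I Gg).
apply: (maximal_full (L := <<g |: H>>%G) maxH) => /=.
- by rewrite sub_gen ?subsetUr.
- by rewrite gen_subG subUset sub1set Gg sHG.
by apply/subsetPn; exists g; rewrite // mem_gen ?setU11.
Qed.

(** Each added element outside the current subgroup at least doubles that subgroup. *)
Lemma dgen_log (G H : {group gT}) : H \subset G -> dgen (trunc_log 2 #|G : H|) G H.
Proof.
have [n] := ubnP #|G : H|; elim: n H => // n IHn H /ltnSE leG sHG.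
have [sGH|/subsetPn[g Gg nHg]] := boolP (G \subset H).
  by apply/(dgenW (leq0n _))/dgen0; apply: subset_trans sGH (subset_gen _).
pose L := <<g |: H>>%G; have sHL : H \subset L by rewrite sub_gen ?subsetUr.
have sLG : L \subset G by rewrite gen_subG subUset sub1set Gg.
have := Lagrange_index sLG sHL; have := indexg_gt0 G L => iL_gt0 iGH.
have iLH : 1 < #|L : H|.
  rewrite indexg_gt1; apply/subsetPn; exists g; rewrite // mem_gen ?setU11 //.
have le2 : 2 * #|G : L| <= #|G : H| by rewrite -iGH mulnC leq_mul2l iLH orbT.
have dL : dgen 1 L H by apply: (dgen1I _ (subxx _)); rewrite mem_gen ?setU11.
have ltn : #|G : L| < n by lia.
apply: dgenW (dgen_trans sLG (IHn L ltn sLG) dL).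
rewrite addn1; apply: trunc_log_max => //; rewrite expnS.
by apply: leq_trans le2; rewrite leq_mul2l trunc_logP.
Qed.

Lemma dgen_add A k (G K : {set gT}) : A \subset G -> dgen k G (A :|: K) -> dgen (#|A| + k) G K.
Proof.
move=> sAG /dgenP[B [sB lB gB]]; apply/dgenP; exists (A :|: B); split.
- by rewrite subUset sAG.
- by rewrite (leq_trans (leq_card_setU _ _)) ?leq_add2l.
by rewrite -setUA setUCA.
Qed.

End RelativeGeneration.

(* The McIver-Neumann bound for groups acting on n points. *)
Definition mn n := if n == 3 then 2 else n./2.

Lemma mn_even n : ~~ odd n -> mn n = n./2.
Proof. by rewrite /mn; case: eqP => // ->. Qed.

Lemma mn_neq3 n : n != 3 -> mn n = n./2.
Proof. by rewrite /mn => /negPf->. Qed.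

(** * Group actions, blocks and primitivity *)

Section Actions.
Variables (gT : finGroupType) (T : finType) (to : {action gT &-> T}).
Implicit Types (G H K : {group gT}) (S X Y : {set T}).

Lemma subcent_astabU (G : {set gT}) X Y : 'C_('C_G(X | to))(Y | to) = 'C_G(X :|: Y | to).
Proof. by rewrite astabU setIA. Qed.

Lemma acts_subset (G H : {set gT}) X : H \subset G -> [acts G, on X | to] -> [acts H, on X | to].
Proof. exact: subset_trans. Qed.

Lemma astab_eq1 (G : {group gT}) S x : x \in S ->
  'C_('C_G[x | to])(S :\ x | to) = 'C_G(S | to).
Proof. by move=> Sx; rewrite subcent_astabU setD1K. Qed.

Lemma acts_stab1 (G : {group gT}) S x :
  [acts G, on S | to] -> [acts 'C_G[x | to], on S :\ x | to].
Proof.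
move=> aG; apply: actsD; first exact: acts_subset (subsetIl _ _) aG.
by rewrite astabs_set1 subsetIr.
Qed.

Lemma mem_act (G : {set gT}) S g x : [acts G, on S | to] -> g \in G -> (to x g \in S) = (x \in S).
Proof. by move=> aG Gg; apply: (acts_act aG Gg). Qed.

Lemma acts_astab_out (G : {group gT}) S X : [acts G, on S | to] -> X \subset S ->
  [acts 'C_G(S :\: X | to), on X | to].
Proof.
move=> aG sXS; have {2}-> : X = S :\: (S :\: X) by rewrite setDDr setDv set0U; apply/esym/setIidPr.
apply: actsD; first exact: acts_subset (subsetIl _ _) aG.
exact: subset_trans (subsetIr _ _) (astab_sub _ _).
Qed.

Lemma atransI (G : {group gT}) S x : x \in S -> [acts G, on S | to] ->
  (forall y, y \in S -> exists2 g, g \in G & to x g = y) -> [transitive G, on S | to].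
Proof.
move=> Sx aG tG; apply/imsetP; exists x => //.
apply/eqP; rewrite eqEsubset acts_sub_orbit // Sx andbT.
by apply/subsetP => y /tG[g Gg <-]; apply: mem_orbit.
Qed.

Lemma atransE (G : {group gT}) S x y : [transitive G, on S | to] -> x \in S -> y \in S ->
  exists2 g, g \in G & to x g = y.
Proof. by move=> tG Sx Sy; have [g Gg ->] := atransP2 tG Sx Sy; exists g. Qed.

Lemma stab1_act (G : {group gT}) x g : g \in G -> 'C_G[to x g | to] = 'C_G[x | to] :^ g.
Proof. by move=> Gg; rewrite astab1_act -{1}(conjGid Gg) -conjIg. Qed.

Lemma stab_setact (G : {group gT}) X g : g \in G -> 'C_G(to^* X g | to) = 'C_G(X | to) :^ g.
Proof. by move=> Gg; rewrite astab_setact -{1}(conjGid Gg) -conjIg. Qed.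

Lemma stab_normal (G : {group gT}) S : [acts G, on S | to] -> 'C_G(S | to) <| G.
Proof. by move=> aG; apply: (normalGI aG (astab_normal _ _)). Qed.

Lemma maximal_stab (G : {group gT}) S x y : [transitive G, on S | to] -> x \in S -> y \in S ->
  maximal 'C_G[x | to] G -> maximal 'C_G[y | to] G.
Proof.
move=> tG Sx Sy; have [g Gg <-] := atransE tG Sx Sy.
by have := maximalJ 'C_G[x | to]%G G g; rewrite (conjGid Gg) /= stab1_act // => ->.
Qed.

Lemma setact_sub (G : {set gT}) S X g : [acts G, on S | to] -> g \in G ->
  (to^* X g \subset S) = (X \subset S).
Proof.
move=> aG Gg; apply/subsetP/subsetP => sX x.
  by move/(mem_setact to g)/sX; rewrite (mem_act _ aG Gg).
by case/imsetP=> y /sX Sy ->; rewrite (mem_act _ aG Gg).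
Qed.

Lemma setactP X g x : reflect (exists2 y, y \in X & x = to y g) (x \in to^* X g).
Proof. exact: imsetP. Qed.

Lemma mem_setactV X g x : (x \in to^* X g) = (to x g^-1 \in X).
Proof.
apply/imsetP/idP => [[y Xy ->]|Xx]; first by rewrite actK.
by exists (to x g^-1); rewrite ?actKV.
Qed.

Lemma astabs_setactI X g : to^* X g = X -> g \in 'N(X | to).
Proof. by move=> e; rewrite -astab1_set; apply/astab1P. Qed.

Definition block (G : {set gT}) S (B : {set T}) := [&& B != set0, B \subset S &
  [forall g in G, (to^* B g == B) || [disjoint to^* B g & B]]].

Lemma block_act (G : {set gT}) S B g x : block G S B -> g \in G -> x \in B -> to x g \in B ->
  to^* B g = B.
Proof.
case/and3P=> _ _ /forall_inP/(_ g) bB Gg Bx Bxg.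
by case/orP: (bB Gg) => [/eqP//|/pred0P/(_ (to x g))]; rewrite /= mem_setact // Bxg.
Qed.

Lemma blockI (G : {set gT}) S (B : {set T}) x : x \in B -> B \subset S ->
  (forall g y, g \in G -> y \in B -> to y g \in B -> to^* B g = B) -> block G S B.
Proof.
move=> Bx sBS bB; apply/and3P; split=> //; first by apply/set0Pn; exists x.
apply/forall_inP => g Gg; apply/norP => -[neB /pred0Pn[z /andP[/= /imsetP[y By ->] Byg]]].
by case/eqP: neB; apply: bB By Byg.
Qed.

Lemma block_mem (G : {set gT}) S B : block G S B -> exists2 x, x \in B & x \in S.
Proof.
by case/and3P=> /set0Pn[x Bx] /subsetP sBS _; exists x; rewrite ?sBS.
Qed.

Lemma block_sub (G : {set gT}) S B : block G S B -> B \subset S.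
Proof. by case/and3P. Qed.

Lemma block_partition (G : {group gT}) S B : [transitive G, on S | to] -> block G S B ->
  partition (orbit to^* G B) S.
Proof.
move=> tG bB; have [x Bx Sx] := block_mem bB; have aG := atrans_acts tG.
apply/and3P; split.
- apply/eqP/setP => y; apply/bigcupP/idP => [[X /orbitP[g Gg <-]] | Sy].
    by move: y; apply/subsetP; rewrite (setact_sub _ aG) ?(block_sub bB).
  have [g Gg <-] := atransE tG Sx Sy.
  by exists (to^* B g); rewrite ?mem_setact // mem_orbit.
- apply/trivIsetP => _ _ /orbitP[g Gg <-] /orbitP[h Gh <-]; apply: contraR => /pred0Pn[y /=].
  rewrite !mem_setactV => /andP[Bg Bh].
  have Ggh : g * h^-1 \in G by rewrite groupM ?groupV.
  have := block_act bB Ggh Bg; rewrite actM actKV => /(_ Bh) e.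
  by rewrite -{2}e -[to^* (to^* _ _) _](actM (to^*)%act) mulgKV.
apply/negP => /orbitP[g Gg] /setP/(_ (to x g)); rewrite mem_setact // inE.
by [].
Qed.

Lemma block_card (G : {group gT}) S B : [transitive G, on S | to] -> block G S B ->
  #|S| = (#|orbit to^* G B| * #|B|)%N.
Proof.
move=> tG bB; apply: card_uniform_partition (block_partition tG bB).
by move=> _ /orbitP[g Gg <-]; apply: card_setact.
Qed.

Lemma block_stab_trans (G : {group gT}) S B : [transitive G, on S | to] -> block G S B ->
  [transitive 'N_G(B | to), on B | to].
Proof.
move=> tG bB; have [x Bx Sx] := block_mem bB.
apply: (atransI Bx); first exact: subsetIr.
move=> y By; have [g Gg gy] := atransE tG Sx (subsetP (block_sub bB) _ By).
exists g => //; apply/setIP; split=> //; apply: astabs_setactI.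
by apply: (block_act bB Gg Bx); rewrite gy.
Qed.

Lemma block_trans (G : {group gT}) S B B' : block G S B -> block 'N_G(B | to) B B' ->
  block G S B'.
Proof.
move=> bB bB'; have [x Bx' Bx] := block_mem bB'.
apply: (blockI Bx'); first exact: subset_trans (block_sub bB') (block_sub bB).
move=> g y Gg By' Byg; apply: (block_act bB' _ By' Byg); apply/setIP; split=> //.
have sB := subsetP (block_sub bB'); apply: astabs_setactI.
by apply: (block_act bB Gg (sB _ By')); apply: sB.
Qed.

(** If [m * g] and [m'] send [x] to the same point, with [m] and [m'] in [M], then [m * g * m'^-1]
    stabilizes [x] and so lies in [M]; hence [g] does too and preserves the orbit. *)
Lemma block_supgroup (G M : {group gT}) S x : [acts G, on S | to] -> x \in S ->
  'C_G[x | to] \subset M -> M \subset G -> block G S (orbit to M x).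
Proof.
move=> aG Sx sCM sMG; apply: (blockI (orbit_refl to M x)).
  by rewrite acts_sub_orbit // (subset_trans sMG).
move=> g _ Gg /orbitP[m Mm <-] /orbitP[m' Mm' e].
suff Mg : g \in M.
  rewrite setact_orbit (conjGid Mg) //; apply: orbit_act => //.
have : m * g * m'^-1 \in M.
  apply: (subsetP sCM); apply/setIP; split.
    by rewrite groupM ?groupV ?(subsetP sMG m') // groupM // (subsetP sMG).
  by apply/astab1P; rewrite !actM -e actK.
by rewrite groupMr ?groupV // groupMl.
Qed.

Lemma block_normal (G V : {group gT}) S x : [acts G, on S | to] -> x \in S ->
  V <| G -> block G S (orbit to V x).
Proof.
move=> aG Sx nV; apply: (blockI (orbit_refl to V x)).
  by rewrite acts_sub_orbit // (subset_trans (normal_sub nV)).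
move=> g y Gg xy xyg; rewrite setact_orbit.
have -> : V :^ g = V by apply: normsP Gg; apply: normal_norm.
apply/orbit_eqP/orbitP.
case/orbitP: xy xyg => v Vv <- /orbitP[w Vw e].
exists (w * (v ^ g)^-1); first by rewrite groupM ?groupV ?memJ_norm ?(subsetP (normal_norm nV)).
by rewrite actM e -!actM mulgA (conjgC v) mulgK.
Qed.

(** As soon as [B] has two points, its setwise stabilizer properly contains a point stabilizer, so
    by maximality it is [G], which is transitive. *)
Lemma prim_no_block (G : {group gT}) S x B : [transitive G, on S | to] -> x \in S ->
  maximal 'C_G[x | to] G -> block G S B -> 1 < #|B| -> B = S.
Proof.
move=> tG Sx maxH bB B_gt1; have [y By Sy] := block_mem bB.
have [z Bz nyz] : exists2 z, z \in B & z != y.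
  move: B_gt1; rewrite (cardD1 y) By ltnS => /card_gt0P[z].
  by rewrite !inE => /andP[nyz Bz]; exists z.
have Sz := subsetP (block_sub bB) _ Bz.
have [g Gg gy] := atransE tG Sy Sz.
have sN : 'C_G[y | to] \subset 'N_G(B | to).
  apply/subsetP=> h /setIP[Gh /astab1P hy]; apply/setIP; split=> //; apply: astabs_setactI.
  by apply: (block_act bB Gh By); rewrite hy.
have Ng : g \in 'N_G(B | to).
  by apply/setIP; split=> //; apply: astabs_setactI; apply: (block_act bB Gg By); rewrite gy.
have := maximal_full (maximal_stab tG Sx Sy maxH) sN (subsetIl _ _).
have -> : ~~ ('N_G(B | to) \subset 'C_G[y | to]).
  apply/subsetPn; exists g => //; rewrite in_setI Gg; apply/astab1P; rewrite gy.
  by apply/eqP.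
move=> /(_ isT); rewrite subsetI => /andP[_ aB].
apply/eqP; rewrite eqEsubset (block_sub bB) /=; apply/subsetP => w Sw.
by have [h Gh <-] := atransE tG Sy Sw; rewrite (mem_act _ aB).
Qed.

End Actions.


(** * Jordan sets in primitive groups *)

Section SmallSets.
Variable T : finType.

Lemma card_le1_eq (A : {set T}) x y : #|A| <= 1 -> x \in A -> y \in A -> x = y.
Proof. by move/card_le1_eqP=> eA Ax Ay; apply: eA. Qed.

Lemma card_gt1_other (A : {set T}) x : 1 < #|A| -> exists2 y, y \in A & y != x.
Proof.
case/card_gt1P=> y [z [Ay Az neyz]]; have [<-|] := eqVneq y x; last by exists y.
by exists z; rewrite // eq_sym.
Qed.

Lemma card2_set (A : {set T}) x y : #|A| = 2 -> x \in A -> y \in A -> x != y -> A = [set x; y].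
Proof.
move=> cA Ax Ay nexy; apply/esym/eqP; rewrite eqEcard cA cards2 nexy andbT.
by rewrite subUset !sub1set Ax.
Qed.

End SmallSets.

Section JordanSets.
Variables (gT : finGroupType) (T : finType) (to : {action gT &-> T}).
Variables (G : {group gT}) (S : {set T}).
Hypothesis aG : [acts G, on S | to].
Implicit Types (D L : {set T}).

(** Jordan sets in the sense of permutation groups. Transitivity is spelled out on pairs of points,
    so the empty set qualifies. *)
Definition jordan D :=
  [forall a in D, forall b in D, [exists g in 'C_G(S :\: D | to), to a g == b]].

Lemma jordanP D : reflect (forall a b, a \in D -> b \in D ->
    exists2 g, g \in 'C_G(S :\: D | to) & to a g = b) (jordan D).
Proof.
apply: (iffP forall_inP) => [jD a b Da Db | jD a Da].
  by have /forall_inP/(_ b Db)/exists_inP[g Cg /eqP] := jD a Da; exists g.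
apply/forall_inP => b Db; apply/exists_inP.
by have [g Cg e] := jD a b Da Db; exists g => //; apply/eqP.
Qed.

Lemma jordan_trans D x : x \in D -> D \subset S ->
  [transitive 'C_G(S :\: D | to), on D | to] -> jordan D.
Proof. by move=> Dx sDS tD; apply/jordanP => a b Da Db; apply: atransE tD Da Db. Qed.

(** Both pointwise stabilizers lie in that of the complement of the union, and together they move
    every point to the common point [x]. *)
Lemma jordanU D L x : x \in D -> x \in L -> jordan D -> jordan L -> jordan (D :|: L).
Proof.
move=> Dx Lx /jordanP jD /jordanP jL.
have sD : 'C_G(S :\: D | to) \subset 'C_G(S :\: (D :|: L) | to).
  by rewrite setIS // astabS // setDS ?subsetUl.
have sL : 'C_G(S :\: L | to) \subset 'C_G(S :\: (D :|: L) | to).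
  by rewrite setIS // astabS // setDS ?subsetUr.
have to_x a : a \in D :|: L -> exists2 g, g \in 'C_G(S :\: (D :|: L) | to) & to a g = x.
  case/setUP=> [Da|La].
    by have [g Cg e] := jD a x Da Dx; exists g => //; apply: (subsetP sD).
  by have [g Cg e] := jL a x La Lx; exists g => //; apply: (subsetP sL).
apply/jordanP => a b /to_x[g Cg ga] /to_x[h Ch hb].
by exists (g * h^-1); rewrite ?groupM ?groupV // actM ga -hb actK.
Qed.

Lemma setact_setD D g : g \in G -> to^* (S :\: D) g = S :\: to^* D g.
Proof.
move=> Gg; apply/setP => x; rewrite inE !mem_setactV inE; congr (_ && _).
by rewrite (mem_act _ aG) ?groupV.
Qed.

Lemma jordan_act D g : g \in G -> jordan D -> jordan (to^* D g).
Proof.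
move=> Gg /jordanP jD; apply/jordanP => _ _ /setactP[a Da ->] /setactP[b Db ->].
have [h Ch <-] := jD a b Da Db; exists (h ^ g); last by rewrite -actCJ.
by rewrite -setact_setD // stab_setact // memJ_conjg.
Qed.

Lemma not_block B : B != set0 -> B \subset S -> ~~ block to G S B ->
  exists g y, [/\ g \in G, to^* B g != B, y \in B & to y g \in B].
Proof.
move=> nz sBS; rewrite /block nz sBS /= negb_forall_in => /exists_inP[g Gg].
rewrite negb_or => /andP[ne /pred0Pn[z /= /andP[/setactP[y By ->] Byg]]].
by exists g, y.
Qed.

Section Primitive.
Variable x0 : T.
Hypotheses (tG : [transitive G, on S | to]) (Sx0 : x0 \in S).
Hypothesis (maxG : maximal 'C_G[x0 | to] G) (oddS : odd #|S|).

Lemma two_trans z : z \in S -> jordan (S :\ z) -> forall a b x y, a \in S -> b \in S -> a != b ->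
  x \in S -> y \in S -> x != y -> exists2 g, g \in G & to a g = x /\ to b g = y.
Proof.
move=> Sz jz; have j w : w \in S -> jordan (S :\ w).
  move=> Sw; have [g Gg <-] := atransE tG Sz Sw.
  have := jordan_act Gg jz; rewrite (setact_setD _ Gg).
  by have -> : to^* [set z] g = [set to z g] by apply: imset_set1.
move=> a b x y Sa Sb neab Sx Sy nexy; have [g Gg ga] := atransE tG Sa Sx.
have Sb' : to b g \in S :\ x.
  by rewrite in_setD1 (mem_act _ aG) // Sb -ga (inj_eq (act_inj _ _)) eq_sym neab.
have Sy' : y \in S :\ x by rewrite in_setD1 eq_sym nexy.
have /jordanP/(_ (to b g) y Sb' Sy') := j x Sx.
case=> h /setIP[Gh /astabP Ch] hb; exists (g * h); first exact: groupM.
rewrite !actM ga hb; split=> //; apply: Ch; rewrite !inE Sx eqxx.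
by [].
Qed.

(** The translates of the complement [Q] of a largest Jordan set with at least two points outside
    behave as lines: two points determine one. Lines with three or more points are excluded by
    counting, on lines through a point [p] of [D], the points off the small set [D]. *)
Lemma jordan_primitive D : D \subset S -> jordan D -> 1 < #|D| -> #|D|.*2 < #|S| ->
  forall x y, x \in S -> y \in S -> x != y -> jordan (S :\: [set x; y]).
Proof.
move=> sDS jD D_gt1 ltDS.
pose P L := [&& jordan L, L \subset S, 1 < #|L| & 1 < #|S :\: L|].
have PD : P D by rewrite /P jD sDS D_gt1 cardsDS //; move: D_gt1 ltDS; nlia.
case: (@arg_maxnP _ D P (fun L => #|L|) PD) => L /and4P[jL sLS L_gt1 SL_gt1] maxL.
have cardSL := cardsDS sLS; have leLS := subset_leq_card sLS.
have no_block (B : {set T}) : B \subset S -> 1 < #|B| -> #|B| < #|S| ->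
    exists g y, [/\ g \in G, to^* B g != B, y \in B & to y g \in B].
  move=> sBS B_gt1 ltB; apply: not_block => //.
    by rewrite -card_gt0; apply: ltnW.
  apply/negP => bB; move: ltB; rewrite (prim_no_block tG Sx0 maxG bB B_gt1) ltnn.
  by [].
have sLh h : h \in G -> to^* L h \subset S by move=> Gh; rewrite (setact_sub _ aG).
have key h (M : {set T}) x : h \in G -> jordan M -> M \subset S -> x \in M -> x \in to^* L h ->
    ~~ (M \subset to^* L h) -> #|S :\: (M :|: to^* L h)| <= 1.
  move=> Gh jM sMS Mx Lx nsub; rewrite leqNgt; apply/negP => gt1.
  have /maxL : P (M :|: to^* L h).
    rewrite /P (jordanU Mx Lx jM (jordan_act Gh jL)) subUset sMS sLh //= gt1 andbT.
    apply: leq_trans L_gt1 _; rewrite -(card_setact to L h) subset_leq_card //.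
    exact: subsetUr.
  rewrite /= -(card_setact to L h) leqNgt proper_card //.
  by rewrite properE subsetUr subUset (negPf nsub).
have [g [y [Gg neL Ly Lyg]]] := no_block L sLS L_gt1 ltac:(move: cardSL leLS SL_gt1; nlia).
have nsubL h h' : h \in G -> h' \in G -> to^* L h != to^* L h' -> ~~ (to^* L h \subset to^* L h').
  move=> Gh Gh'; apply: contra => sub; rewrite eqEcard sub !card_setact.
  exact: leqnn.
have L1 : to^* L 1 = L by apply: (act1 (to^*)%act).
have ns1 h : h \in G -> to^* L h != L -> ~~ (to^* L h \subset L).
  by move=> Gh ne; have := nsubL h 1 Gh (group1 G); rewrite L1; apply.
have key1 (M : {set T}) x := key 1 M x (group1 G); rewrite L1 in key1.
(* [L] and its translate cover all but at most one point and share a point, so twice the size of [L]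
   is at least that of [S]; oddness makes this strict. Hence any two translates of [L] meet. *)
have Lbig : #|S| < #|L|.*2.
  have := key1 _ _ (jordan_act Gg jL) (sLh _ Gg) (mem_setact _ _ Ly) Lyg (ns1 g Gg neL).
  have /subset_leq_card : to^* L g :|: L \subset S by rewrite subUset sLh.
  rewrite cardsDS ?subUset ?sLh // => le1 le2.
  have := cardsUI (to^* L g) L; rewrite card_setact.
  have : 0 < #|to^* L g :&: L|.
    by apply/card_gt0P; exists (to y g); rewrite inE mem_setact.
  by move: oddS le1 le2; nlia.
have meet h h' : h \in G -> h' \in G -> exists2 x, x \in to^* L h & x \in to^* L h'.
  move=> Gh Gh'; have : 0 < #|to^* L h :&: to^* L h'|.
    have := cardsUI (to^* L h) (to^* L h'); rewrite !card_setact.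
    have /subset_leq_card : to^* L h :|: to^* L h' \subset S by rewrite subUset !sLh.
    by move: Lbig; nlia.
  by case/card_gt0P=> x /setIP[]; exists x.
pose Q := S :\: L; have sQ h x : h \in G -> x \in to^* Q h -> x \in S.
  by move=> Gh; rewrite setact_setD // inE => /andP[].
have Qh h : h \in G -> to^* Q h = S :\: to^* L h by move=> Gh; rewrite setact_setD.
(* The intersection of two distinct lines is the complement of a union of two translates of [L];
   this union is a larger Jordan set, so at most one point is left out. *)
have lines h h' x y' : h \in G -> h' \in G -> x != y' -> x \in to^* Q h -> y' \in to^* Q h ->
    x \in to^* Q h' -> y' \in to^* Q h' -> to^* Q h = to^* Q h'.
  move=> Gh Gh' nexy Qx Qy Qx' Qy'; rewrite !Qh //; have [->//|ne] := eqVneq (to^* L h) (to^* L h').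
  have [z Lz Lz'] := meet h h' Gh Gh'.
  have := key h' _ z Gh' (jordan_act Gh jL) (sLh _ Gh) Lz Lz' (nsubL _ _ Gh Gh' ne).
  move/card_le1_eq => /(_ x y') e1; case/eqP: nexy; apply: e1; move: Qx Qy Qx' Qy'.
    by rewrite !Qh // !inE => /andP[/negPf-> ->] _ /andP[/negPf->].
  by rewrite !Qh // !inE => _ /andP[/negPf-> ->] _ /andP[/negPf->].
(* [Q] is not a block either, so some other line meets it, in exactly one point; the complement of
   that point is Jordan, which gives double transitivity. *)
have [z Sz jz] : exists2 z, z \in S & jordan (S :\ z).
  have [h [u [Gh neQ Qu Quh]]] := no_block Q (subsetDl _ _) SL_gt1 ltac:(rewrite cardSL; move: leLS L_gt1; nlia).
  have neLh : to^* L h != L.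
    by apply: contra neQ => /eqP e; rewrite Qh // e.
  have [w Lw Lw'] := meet h 1 Gh (group1 G).
  rewrite L1 in Lw'; have le1 := key1 _ w (jordan_act Gh jL) (sLh _ Gh) Lw Lw' (ns1 h Gh neLh).
  have Quh' := mem_setact to h Qu; rewrite Qh // in Quh'.
  exists (to u h); first by case/setDP: Quh.
  suff -> : S :\ to u h = to^* L h :|: L.
    exact: jordanU Lw Lw' (jordan_act Gh jL) jL.
  have inz : to u h \in S :\: (to^* L h :|: L).
    by move: Quh' Quh; rewrite !inE => /andP[/negPf-> ->] /andP[/negPf->].
  apply/setP => v; rewrite !inE; case Sv: (v \in S); last first.
    rewrite andbF; apply/esym/negbTE; apply: contraFN Sv; rewrite -in_setU.
    by move: v; apply/subsetP; rewrite subUset sLh.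
  rewrite andbT; case e: (_ || _).
    by apply/eqP => ev; move: inz; rewrite !inE -ev e.
  by apply/negbTE; rewrite negbK; apply/eqP; apply: card_le1_eq le1 _ inz; rewrite !inE e.
have trans2 := two_trans Sz jz.
have [a Qa] : exists a, a \in Q by apply/card_gt0P/ltnW.
have [b Qb neba] := card_gt1_other a SL_gt1.
have [Sa Sb] : a \in S /\ b \in S by move: Qa Qb; rewrite !inE => /andP[_ ->] /andP[_ ->].
have line x y' : x \in S -> y' \in S -> x != y' ->
    exists2 h, h \in G & x \in to^* Q h /\ y' \in to^* Q h.
  move=> Sx Sy ne; have [h Gh [<- <-]] := trans2 a b x y' Sa Sb ltac:(by rewrite eq_sym) Sx Sy ne.
  by exists h => //; rewrite !mem_setact.
suff cQ : #|Q| = 2.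
  move=> x y' Sx Sy ne.
  have [h Gh [<- <-]] := trans2 a b x y' Sa Sb ltac:(by rewrite eq_sym) Sx Sy ne.
  have <- : to^* Q h = [set to a h; to b h].
    apply: card2_set; rewrite ?card_setact ?mem_setact //.
    by rewrite (inj_eq (act_inj _ _)) eq_sym.
  have -> : S :\: to^* Q h = to^* L h.
    by rewrite (Qh h Gh) setDDr setDv set0U; apply/setIidPr/sLh.
  exact: (jordan_act Gh jL).
apply/eqP; rewrite eqn_leq SL_gt1 andbT leqNgt; apply/negP => Q_gt2.
have [p Dp] : exists p, p \in D by apply/card_gt0P/ltnW.
have Sp := subsetP sDS p Dp.
have key2 h q : h \in G -> p \in to^* Q h -> q \in D -> q \in to^* L h -> #|to^* Q h :\: D| <= 1.
  move=> Gh Qp Dq Lq; have := key h D q Gh jD sDS Dq Lq; rewrite Qh // setDDl setUC; apply.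
  by apply/subsetPn; exists p => //; move: Qp; rewrite Qh // inE => /andP[].
(* If the line misses a point of [D], this is [key2]. Otherwise [D] lies inside the line, and
   another line through [p] meets [D] only in [p]; it has at least two points off [D], against
   [key2]. *)
have small h f : h \in G -> p \in to^* Q h -> f \in S :\: D -> f \in to^* Q h ->
    #|to^* Q h :\: D| <= 1.
  move=> Gh Qp Ff Qf; have [/exists_inP[q Dq Lq]|] := boolP [exists q in D, q \in to^* L h].
    exact: key2 Dq Lq.
  rewrite negb_exists_in => /forall_inP DL.
  have [f' Lf'] : exists f', f' \in to^* L h.
    by apply/card_gt0P; rewrite card_setact; apply: ltnW.
  have Sf' := subsetP (sLh _ Gh) _ Lf'.
  have nf'p : p != f' by apply: contraTneq Lf' => <-; apply: DL.
  have [h' Gh' [Qp' Qf'']] := line p f' Sp Sf' nf'p.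
  have [q Dq neqp] := card_gt1_other p D_gt1.
  have DQ q' : q' \in D -> q' \in to^* Q h.
    by move=> Dq'; rewrite Qh // inE DL // (subsetP sDS).
  have QQ q' : q' \in to^* Q h -> q' \in to^* Q h' -> q' = p.
    move=> Qq Qq'; apply: contraTeq Lf' => ne.
    have := lines h h' q' p Gh Gh' ne Qq Qp Qq' Qp'; rewrite Qh // => e.
    by move: Qf''; rewrite -e inE => /andP[].
  have Lq : q \in to^* L h'.
    apply: contraNT neqp => nLq; apply/eqP; apply: QQ; first exact: DQ.
    by rewrite Qh // inE nLq (subsetP sDS).
  have := key2 h' q Gh' Qp' Dq Lq.
  have -> : to^* Q h' :\: D = to^* Q h' :\ p.
    apply/setP => v; rewrite !in_setD in_set1; case Qv: (v \in to^* Q h'); last by rewrite !andbF.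
    rewrite !andbT; have [->|nevp] := eqVneq v p; first by rewrite Dp.
    by apply/negP => /DQ Qv'; case/eqP: nevp; apply: QQ.
  by have := cardsD1 p (to^* Q h'); rewrite Qp' card_setact; move: Q_gt2; nlia.
pose R f q := [exists h in G, [&& p \in to^* Q h, f \in to^* Q h & q \in to^* Q h]].
have RP f q : R f q -> exists2 h, h \in G & [&& p \in to^* Q h, f \in to^* Q h & q \in to^* Q h].
  by case/exists_inP=> h Gh RQ; exists h.
(* For [f] off [D] the default is not reached: [phi f] is a second point of [D] on the line through
   [p] and [f]. It determines this line, and [f] is its only point off [D]. So [phi] is injective
   there and [D] has more points than its complement, a contradiction. *)
pose phi f := odflt p [pick q in D :\ p | R f q].
have phiP f : f \in S :\: D -> phi f \in D :\ p /\ R f (phi f).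
  move=> Ff; have [Sf nDf] := setDP Ff.
  have [h Gh [Qp Qf]] := line p f Sp Sf ltac:(by apply: contraNneq nDf => <-).
  rewrite /phi; case: pickP => [q /andP[]//|none].
  have [q] : exists q, q \in (to^* Q h :&: D) :\ p.
    apply/card_gt0P; have := cardsD1 p (to^* Q h :&: D); rewrite inE Qp Dp.
    have := cardsID D (to^* Q h); rewrite card_setact; have := small h f Gh Qp Ff Qf.
    by move: Q_gt2; nlia.
  rewrite in_setD1 inE => /and3P[neqp Qq Dq]; have Rq : R f q.
    by rewrite /R; apply/exists_inP; exists h; rewrite ?Qp ?Qf.
  by have := none q; rewrite in_setD1 neqp Dq Rq.
have phi_inj : {in S :\: D &, injective phi}.
  move=> f f' Ff Ff' e.
  have [Dq /RP[h Gh /and3P[Qp Qf Qq]]] := phiP f Ff.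
  have [_ /RP[h' Gh' /and3P[Qp' Qf' Qq']]] := phiP f' Ff'.
  move: Dq; rewrite in_setD1 => /andP[neqp Dq]; rewrite -e in Qq'.
  have eQ := lines h h' _ _ Gh Gh' neqp Qq Qp Qq' Qp'.
  apply: card_le1_eq (small h f Gh Qp Ff Qf) _ _.
    by rewrite in_setD Qf; case/setDP: Ff => _ ->.
  by rewrite in_setD eQ Qf'; case/setDP: Ff' => _ ->.
have /subset_leq_card : phi @: (S :\: D) \subset D :\ p.
  by apply/subsetP => _ /imsetP[f Ff ->]; case: (phiP f Ff).
rewrite card_in_imset // cardsDS //; have := cardsD1 p D; rewrite Dp.
by have := subset_leq_card sDS; move: ltDS; nlia.
Qed.

End Primitive.
End JordanSets.

(** * Sets without Jordan subsets *)

Section NoJordan.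
Variables (gT : finGroupType) (T : finType) (to : {action gT &-> T}).
Implicit Types (G Y V : {group gT}) (S D O : {set T}).

(** The induction hypothesis. The group type stays fixed, while the type acted on varies, since the
    hypothesis is also applied to actions on blocks. *)
Definition MN_lt n := forall (T : finType) (to : {action gT &-> T}) (G : {group gT}) (S : {set T}),
  [acts G, on S | to] -> #|S| < n -> dgen (mn #|S|) G 'C_G(S | to).

Lemma normal_trans_prime Y V O : [transitive Y, on O | to] -> V <| Y -> prime #|O| ->
  ~~ (V \subset 'C(O | to)) -> [transitive V, on O | to].
Proof.
move=> tY nV pO /subsetPn[v Vv nCv]; have aY := atrans_acts tY.
have [x Ox nvx] : exists2 x, x \in O & to x v != x.
  apply/exists_inP; apply: contraR nCv; rewrite negb_exists_in => /forall_inP C.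
  by apply/astabP => x /C; rewrite negbK => /eqP.
have bO := block_normal aY Ox nV.
have sO := block_sub bO.
have /primeP[_ /(_ #|orbit to V x|)] := pO.
rewrite {1}(block_card tY bO) dvdn_mull // => /(_ isT) /orP[/eqP/card_orbit1 o1|/eqP oO].
  by move: (mem_orbit to x Vv); rewrite o1 inE (negPf nvx).
have {oO sO} <- : orbit to V x = O by apply/eqP; rewrite eqEcard sO oO leqnn.
exact: atrans_orbit.
Qed.

(** The half saved on [O] is saved on all of [S]. If three points remain off [O], their exceptional
    cost 2 is affordable because [O], having at most three points, then contributes nothing. *)
Lemma dgen_small_orbit n Y (S O : {set T}) : MN_lt n -> [acts Y, on S | to] -> O \subset S ->
  [transitive Y, on O | to] -> 1 < #|O| -> #|O| <= #|S :\: O| -> #|S :\: O| < n ->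
  dgen #|O|.-1./2 'C_Y(S :\: O | to) 'C_Y(S | to) ->
  (#|O| <= 3 -> 'C_Y(S :\: O | to) \subset 'C_Y(S | to)) ->
  dgen #|S|.-1./2 Y 'C_Y(S | to).
Proof.
move=> IH aY sOS tY O_gt1 leO ltn dV V3.
have aD : [acts Y, on S :\: O | to] by apply: actsD aY (atrans_acts tY).
have dY := IH _ _ _ _ aD ltn; have eS := cardsDS sOS; have leS := subset_leq_card sOS.
have [e3|ne3] := eqVneq #|S :\: O| 3.
  have {V3} V3 := V3 ltac:(by rewrite -e3).
  apply: (dgenW (k := 2)); first by move: O_gt1 eS e3 leS; nlia.
  rewrite e3 in dY; apply: (dgenS _ dY); exact: subset_trans V3 (subset_gen _).
apply: (dgenW _ (dgen_trans (subsetIl _ _) dY dV)); rewrite (mn_neq3 ne3).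
by move: O_gt1 eS leS; nlia.
Qed.

Lemma setDU_sub (S D : {set T}) : D \subset S -> (S :\: D) :|: D = S.
Proof.
move=> sDS; apply/setP => x; rewrite !inE; case Dx: (x \in D); last by rewrite orbF.
by rewrite (subsetP sDS).
Qed.

Lemma setDD_sub (S D O : {set T}) : O \subset D -> D \subset S -> (S :\: D) :|: (D :\: O) = S :\: O.
Proof.
move=> sOD sDS; apply/setP => x; rewrite !inE; case Dx: (x \in D); rewrite ?andbT ?andbF ?orbF /=.
  by rewrite (subsetP sDS) // andbT.
by have -> : x \in O = false by apply: contraFF Dx; apply: (subsetP sOD).
Qed.

(** The orbit has prime length 2 or 3, so the normal subgroup of elements trivial off [O], if it
    moves a point of [O], is transitive there and makes [O] a Jordan set. *)
Lemma no_jordan_small_orbit G Y (S S0 O : {set T}) x : x \in O -> O \subset S -> O \subset S0 ->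
  [acts Y, on S0 | to] -> [transitive Y, on O | to] -> 1 < #|O| <= 3 ->
  'C_Y(S0 :\: O | to) = 'C_G(S :\: O | to) -> ~~ jordan to G S O ->
  'C_G(S :\: O | to) \subset 'C_G(S | to).
Proof.
move=> Ox sOS sOS0 aY tO O13 eV; apply: contraR => nC.
apply: (jordan_trans Ox sOS); rewrite -eV.
apply: (normal_trans_prime (V := 'C_Y(S0 :\: O | to)%G) tO).
- by apply: stab_normal; apply: actsD aY (atrans_acts tO).
- by move: O13; case: #|O| => [|[|[|[|]]]].
rewrite /= eV; apply: contra nC => sC; rewrite subsetI subsetIl /=.
have -> : 'C(S | to) = 'C(S :\: O | to) :&: 'C(O | to) by rewrite -astabU setDU_sub.
by rewrite subsetI subsetIr.
Qed.

Lemma dgen_no_jordan n G (S D : {set T}) : MN_lt n -> [acts G, on S | to] -> D \subset S ->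
  0 < #|D| -> #|D| <= n ->
  (forall L : {set T}, L \subset D -> 1 < #|L| -> ~~ jordan to G S L) ->
  dgen #|D|.-1./2 'C_G(S :\: D | to) 'C_G(S | to).
Proof.
move=> IH aG; have [m] := ubnP #|D|; elim: m D => // m IHm D leDm sDS D_gt0 leDn noJ.
pose Y := 'C_G(S :\: D | to)%G.
have aY : [acts Y, on D | to] by apply: acts_astab_out.
have eYD : 'C_Y(D | to) = 'C_G(S | to) by rewrite subcent_astabU setDU_sub.
have [x0 Dx0] : exists x, x \in D by apply/card_gt0P.
case: (@arg_minnP _ x0 (mem D) (fun x => #|orbit to Y x|) Dx0) => x /= Dx minx.
set O := orbit to Y x; have Ox : x \in O by apply: orbit_refl.
have sOD : O \subset D by rewrite acts_sub_orbit.
have tO : [transitive Y, on O | to] by apply: atrans_orbit.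
have eV : 'C_Y(D :\: O | to) = 'C_G(S :\: O | to) by rewrite subcent_astabU setDD_sub.
have leOD := subset_leq_card sOD.
have [O1|neO1] := eqVneq #|O| 1%N.
  have eO := card_orbit1 O1.
  have sYU : Y \subset 'C_G(S :\: (D :\ x) | to).
    rewrite -(setDD_sub (subsetDl D [set x]) sDS) -subcent_astabU subsetI subxx astabC.
    apply/subsetP => y; rewrite !inE negb_and negbK => /andP[/orP[/eqP-> _|/negPf->//]].
    by apply/subsetP => g Yg; rewrite !inE -in_set1 -eO mem_orbit.
  have [D1|D_gt1] := leqP #|D| 1.
    apply/(dgenW (leq0n _))/dgen0; apply: subset_trans sYU _.
    have -> : D :\ x = set0.
      by apply/eqP; rewrite -cards_eq0; move: D1; rewrite (cardsD1 x D) Dx; case: #|_|.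
    by rewrite setD0 subset_gen.
  have sD' : D :\ x \subset D by apply: subsetDl.
  have cD : #|D| = #|D :\ x|.+1 by rewrite (cardsD1 x D) Dx.
  have := IHm (D :\ x) ltac:(move: leDm cD; nlia) (subset_trans sD' sDS)
    ltac:(move: D_gt1 cD; nlia) ltac:(move: leDn cD; nlia)
    (fun L sL => noJ L (subset_trans sL sD')).
  case/dgenP=> A [sA lA gA]; apply/dgenP; exists A; split.
  - apply: subset_trans sA _; rewrite /Y /= setIS // astabS // setDS //.
  - by move: lA cD; nlia.
  exact: subset_trans sYU gA.
have O_gt1 : 1 < #|O|.
  by rewrite ltn_neqAle eq_sym neO1; apply/card_gt0P; exists x.
have [/eqP eOD|nsDO] := boolP (D == O).
  have := noJ D (subxx _); rewrite {1}eOD O_gt1 (jordan_trans Dx sDS) //= => [/(_ isT)//|].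
  by rewrite {2}eOD.
have [y Dy nOy] : exists2 y, y \in D & y \notin O.
  by apply/subsetPn; apply: contra nsDO => sDO; rewrite eqEsubset sDO.
have leO : #|O| <= #|D :\: O|.
  apply: leq_trans (minx y Dy) _; apply: subset_leq_card; apply/subsetP => z yz.
  have sub : orbit to Y y \subset D by rewrite acts_sub_orbit.
  rewrite in_setD (subsetP sub z yz) andbT; apply: contra nOy => Oz.
  by apply: orbit_trans Oz; rewrite orbit_sym.
have ltO : #|D :\: O| < n by rewrite cardsDS //; move: leDn leOD O_gt1; nlia.
have sOS := subset_trans sOD sDS; have noJO : ~~ jordan to G S O by apply: noJ.
have eDO := cardsDS sOD.
rewrite -eYD; apply: (dgen_small_orbit IH aY sOD tO O_gt1 leO ltO) => [|leO3]; rewrite eV eYD.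
  apply: (IHm O _ sOS).
  - by move: leDm leO eDO O_gt1 leOD; nlia.
  - by move: O_gt1; nlia.
  - by move: leDn leOD; nlia.
  by move=> L sL; apply: noJ; apply: subset_trans sL sOD.
by apply: no_jordan_small_orbit Ox sOS sOD aY tO _ eV noJO; rewrite O_gt1.
Qed.

(** [Y] need not be a pointwise stabilizer; it suffices that its elements trivial on [S0 :\: O] are
    exactly those of [G] trivial on [S :\: O]. *)
Lemma dgen_orbit_no_jordan n G Y (S S0 O : {set T}) x : MN_lt n -> [acts G, on S | to] ->
  [acts Y, on S0 | to] -> x \in O -> O \subset S -> O \subset S0 -> [transitive Y, on O | to] ->
  1 < #|O| -> #|O| <= #|S0 :\: O| -> #|S0| <= n ->
  'C_Y(S0 :\: O | to) = 'C_G(S :\: O | to) -> 'C_Y(S0 | to) = 'C_G(S | to) ->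
  (forall L : {set T}, L \subset O -> 1 < #|L| -> ~~ jordan to G S L) ->
  dgen #|S0|.-1./2 Y 'C_G(S | to).
Proof.
move=> IH aG aY Ox sOS sOS0 tO O_gt1 leO leSn eV eC noJ.
have eDO := cardsDS sOS0; have leOS := subset_leq_card sOS0.
rewrite -eC; apply: (dgen_small_orbit IH aY sOS0 tO O_gt1 leO) => [||leO3].
- by move: leSn eDO leOS O_gt1; nlia.
- rewrite eV eC; apply: dgen_no_jordan IH aG sOS _ _ noJ; first exact: ltnW.
  by move: leSn leOS; nlia.
rewrite eV eC; apply: no_jordan_small_orbit Ox sOS sOS0 aY tO _ eV _; first by rewrite O_gt1.
exact: noJ.
Qed.

End NoJordan.

(** * Doubly transitive groups *)

Section TwoTransitive.
Variables (gT : finGroupType) (T : finType) (to : {action gT &-> T}).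
Variables (G : {group gT}) (S : {set T}).
Hypotheses (tG : [transitive G, on S | to]) (S_gt2 : 2 < #|S|).
Hypothesis (t2G : forall x, x \in S -> [transitive 'C_G[x | to], on S :\ x | to]).
Hypothesis (maxG : forall x, x \in S -> maximal 'C_G[x | to] G).

Let aG := atrans_acts tG.

Lemma two_trans2 a b x y : a \in S -> b \in S -> a != b -> x \in S -> y \in S -> x != y ->
  exists2 g, g \in G & to a g = x /\ to b g = y.
Proof.
move=> Sa Sb neab Sx Sy nexy; have [g Gg ga] := atransE tG Sa Sx.
have Sb' : to b g \in S :\ x.
  by rewrite in_setD1 (mem_act _ aG) // Sb -ga (inj_eq (act_inj _ _)) eq_sym neab.
have Sy' : y \in S :\ x by rewrite in_setD1 eq_sym nexy.
have [h /setIP[Gh /astab1P hx] hb] := atransE (t2G Sx) Sb' Sy'.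
by exists (g * h); rewrite ?groupM // !actM ga hx hb.
Qed.

Definition pair_stab z w := 'C_G([set z; w] | to).
Definition pair_closure z := <<\bigcup_(w in S :\ z) pair_stab z w>>%G.
Local Notation H z := 'C_G[z | to].
Local Notation R := pair_closure.

Lemma pair_stabP z w u : reflect [/\ u \in G, to z u = z & to w u = w] (u \in pair_stab z w).
Proof.
apply: (iffP setIP) => [[Gu /astabP Cu]|[Gu uz uw]].
  by split=> //; apply: Cu; rewrite !inE eqxx ?orbT.
by split=> //; apply/astabP => v /set2P[->|->].
Qed.

Lemma pair_stabC z w : pair_stab z w = pair_stab w z.
Proof. by rewrite /pair_stab setUC. Qed.

Lemma sub_pair_closure z w : w \in S -> w != z -> pair_stab z w \subset R z.
Proof. by move=> Sw ne; rewrite sub_gen // (bigcup_max w) // in_setD1 ne. Qed.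

Lemma pair_closure_sub z : R z \subset H z.
Proof.
rewrite gen_subG; apply/bigcupsP => w _; apply/subsetP => u /pair_stabP[Gu uz _].
by apply/setIP; split=> //; apply/astab1P.
Qed.

Lemma pair_closureJ z g r : g \in G -> r \in R z -> r ^ g \in R (to z g).
Proof.
move=> Gg; suff /subsetP sR : R z \subset R (to z g) :^ g^-1 by move/sR; rewrite mem_conjgV.
rewrite gen_subG; apply/bigcupsP => w; rewrite in_setD1 => /andP[newz Sw].
apply/subsetP => u /pair_stabP[Gu uz uw]; rewrite mem_conjgV.
apply: (subsetP (@sub_pair_closure (to z g) (to w g) _ _)).
- by rewrite (mem_act _ aG).
- by rewrite (inj_eq (act_inj _ _)).
by apply/pair_stabP; rewrite groupJ // -!actCJ uz uw.
Qed.

(** Closed sets play the role of subspaces, and [line a b] below is the subspace spanned by two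
    points. *)
Definition closed (L : {set T}) := (L \subset S) && [forall z in L, [acts R z, on L | to]].

Lemma closedP (L : {set T}) : reflect (L \subset S /\
  forall z r w, z \in L -> r \in R z -> w \in L -> to w r \in L) (closed L).
Proof.
apply: (iffP andP) => [[sLS /forall_inP cL]|[sLS cL]]; split=> //.
  by move=> z r w Lz Rr Lw; rewrite (mem_act _ (cL z Lz)).
apply/forall_inP => z Lz; apply/subsetP => r Rr; apply/astabsP => w.
apply/idP/idP => [|Lw]; last exact: cL Lz Rr Lw.
by move/(cL z r^-1 _ Lz); rewrite groupV actK => /(_ Rr).
Qed.

Lemma closed_act (L : {set T}) g : g \in G -> closed L -> closed (to^* L g).
Proof.
move=> Gg /closedP[sLS cL]; apply/closedP; split; first by rewrite (setact_sub _ aG).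
move=> _ r _ /setactP[z Lz ->] Rr /setactP[w Lw ->].
have Rr' : r ^ g^-1 \in R z.
  by rewrite -[z](actK to g); apply: pair_closureJ; rewrite ?groupV.
by rewrite actCJV mem_setact //; apply: cL Lz Rr' Lw.
Qed.

Definition line a b := \bigcap_(L : {set T} | [&& closed L, a \in L & b \in L]) L.

Lemma closed_full : closed S.
Proof.
apply/closedP; split=> // z r w Sz /(subsetP (pair_closure_sub z))/setIP[Gr _] Sw.
by rewrite (mem_act _ aG).
Qed.

Lemma line_min a b (L : {set T}) : closed L -> a \in L -> b \in L -> line a b \subset L.
Proof. by move=> cL La Lb; apply: bigcap_inf; rewrite cL La. Qed.

Lemma mem_line1 a b : a \in line a b.
Proof. by apply/bigcapP => L /and3P[]. Qed.

Lemma mem_line2 a b : b \in line a b.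
Proof. by apply/bigcapP => L /and3P[]. Qed.

Lemma line_closed a b : a \in S -> b \in S -> closed (line a b).
Proof.
move=> Sa Sb; apply/closedP; split; first exact: line_min closed_full Sa Sb.
move=> z r w /bigcapP Lz Rr /bigcapP Lw; apply/bigcapP => L LL.
by have /and3P[/closedP[_ cL] _ _] := LL; apply: cL (Lz L LL) Rr (Lw L LL).
Qed.

Lemma line_card a b c d : a \in S -> b \in S -> a != b -> c \in S -> d \in S -> c != d ->
  #|line a b| = #|line c d|.
Proof.
wlog suff le : a b c d / a \in S -> b \in S -> a != b -> c \in S -> d \in S -> c != d ->
    #|line a b| <= #|line c d|.
  by move=> *; apply/eqP; rewrite eqn_leq !le.
move=> Sa Sb neab Sc Sd necd; have [g Gg [<- <-]] := two_trans2 Sc Sd necd Sa Sb neab.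
rewrite -(card_setact to (line c d) g); apply: subset_leq_card; apply: line_min.
- by apply: closed_act => //; apply: line_closed.
- by rewrite mem_setact ?mem_line1.
by rewrite mem_setact ?mem_line2.
Qed.

(** All lines have the same size by double transitivity, so a line contained in another equals
    it. *)
Lemma line_eq a b c d : a \in S -> b \in S -> a != b -> c != d ->
  c \in line a b -> d \in line a b -> line c d = line a b.
Proof.
move=> Sa Sb neab necd Lc Ld; have cL := line_closed Sa Sb.
have sLS : line a b \subset S by case/closedP: cL.
apply/eqP; rewrite eqEcard line_min //=.
by rewrite (@line_card a b c d) // (subsetP sLS).
Qed.

(** [u] lies in the pair closures at [a] and at [b], so it keeps the image of [w] on the lines
    joining [w] to [a] and to [b]. Were [w] moved, both lines would be the one through [w] and its
    image, hence also the line through [a] and [b]. *)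
Lemma line_fix a b u w : a \in S -> b \in S -> a != b -> u \in pair_stab a b -> w \in S ->
  w \notin line a b -> to w u = w.
Proof.
move=> Sa Sb neab Pu Sw nLw.
have newa : a != w by apply: contraNneq nLw => <-; apply: mem_line1.
have newb : b != w by apply: contraNneq nLw => <-; apply: mem_line2.
have Ra : u \in R a by apply: (subsetP (sub_pair_closure Sb _)); rewrite // eq_sym.
have Rb : u \in R b by apply: (subsetP (sub_pair_closure Sa neab)); rewrite pair_stabC.
have /closedP[_ /(_ a u w (mem_line1 _ _) Ra (mem_line2 _ _)) La] := line_closed Sa Sw.
have /closedP[_ /(_ b u w (mem_line1 _ _) Rb (mem_line2 _ _)) Lb] := line_closed Sb Sw.
apply: contraNeq nLw => ne.
have ea := line_eq Sa Sw newa ne La (mem_line2 _ _).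
have eb := line_eq Sb Sw newb ne Lb (mem_line2 _ _).
have Lba : b \in line a w by rewrite -ea eb mem_line1.
by rewrite (line_eq Sa Sw newa neab (mem_line1 _ _) Lba) mem_line2.
Qed.

(** The gain over a maximal stabilizer is that [Q] is strictly smaller but still contains a
    two-point stabilizer, so that the [Q]-orbit of [y] is a proper block of the stabilizer of
    [x]. *)
Theorem two_transitive_generation x y : x \in S -> y \in S -> x != y ->
  pair_stab x y \subset 'C_G(S | to) \/
  exists Q : {group gT}, [/\ pair_stab x y \subset Q, Q \proper H x &
    exists2 g, g \in G & G \subset <<g |: Q>>].
Proof.
move=> Sx Sy nexy; have neyx : y != x by rewrite eq_sym.
have [|nC] := boolP (pair_stab x y \subset 'C_G(S | to)); first by left.
right; have maxH := maxG Sx.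
have sPR := sub_pair_closure Sy neyx.
have full g (Q : {group gT}) : g \in G -> g \notin H x -> Q \subset H x ->
    H x \subset <<g |: Q>> -> G \subset <<g |: Q>>.
  move=> Gg nHg sQH sHL; apply: (maximal_full (L := <<g |: Q>>%G) maxH sHL) => /=.
    by rewrite gen_subG subUset sub1set Gg (subset_trans sQH) ?subsetIl.
  by apply/subsetPn; exists g; rewrite // mem_gen ?setU11.
(* If the pair closure is the whole stabilizer, [Q] may be any maximal subgroup above the two-point
   stabilizer. Each two-point stabilizer at [x] is conjugated into [Q] by some [g] outside [H x];
   were every [g] bad, all of them, and so [R x], would lie in [Q]. *)
have [sHR|nsHR] := boolP (H x \subset R x).
  have ltP : pair_stab x y != H x.
    apply/eqP => e; have [z Sz nezy] : exists2 z, z \in S :\ x & z != y.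
      apply: card_gt1_other; move: S_gt2; rewrite (cardsD1 x S) Sx; nlia.
    have Sy' : y \in S :\ x by rewrite in_setD1 neyx.
    have [g Hg gy] := atransE (t2G Sx) Sy' Sz.
    have /pair_stabP[_ _ gy'] : g \in pair_stab x y by rewrite e.
    by rewrite -gy gy' eqxx in nezy.
  have sPH : 'C_G([set x; y] | to)%G \subset H x by apply: subset_trans sPR (pair_closure_sub x).
  have [/= e|[Q maxQ sPQ]] := maximal_exists sPH; first by rewrite /pair_stab e eqxx in ltP.
  have ltQ := maxgroupp maxQ; have sQH := proper_sub ltQ.
  exists Q; split=> //; apply/exists_inP; apply: contraT.
  rewrite negb_exists_in => /forall_inP bad.
  have: ~~ (R x \subset Q) by apply: contraL ltQ => sRQ; rewrite properE negb_and negbK orbC (subset_trans sHR).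
  case/negP; rewrite gen_subG; apply/bigcupsP => w; rewrite in_setD1 => /andP[newx Sw].
  have [h Gh [hy hx]] := two_trans2 Sy Sx neyx Sx Sw ltac:(by rewrite eq_sym).
  pose g := h^-1; have Gg : g \in G by rewrite groupV.
  have gx : to x g = y by rewrite -hy actK.
  have gw : to w g = x by rewrite -hx actK.
  have nHg : g \notin H x.
    by apply: contra neyx => /setIP[_ /astab1P e]; rewrite -gx e.
  apply/subsetP => u /pair_stabP[Gu ux uw].
  have Hu : u \in H x by apply/setIP; split=> //; apply/astab1P.
  have Lg : g \in <<g |: Q>> by rewrite mem_gen ?setU11.
  have Lu : u \in <<g |: Q>>.
    rewrite -(groupJr _ Lg); have : u ^ g \in Q.
      apply: (subsetP sPQ); apply/pair_stabP; rewrite groupJ //.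
      by rewrite -{1}gw -actCJ uw gw -gx -actCJ ux gx.
    by move/(subsetP (subset_trans (subsetUr [set g] Q) (subset_gen _))).
  apply: contraR (bad g Gg) => nQu; apply: full => //.
  have := maximal_full (L := (<<g |: Q>> :&: H x)%G) maxQ; rewrite /= subsetI sQH andbT.
  rewrite (subset_trans (subsetUr _ _) (subset_gen _)) subsetIr => /(_ isT isT).
  rewrite subsetI subxx andbT; apply; apply/subsetPn; exists u => //.
  by apply/setIP.
have ltR : R x \proper H x by rewrite properE pair_closure_sub.
(* When the line is proper, an element of the two-point stabilizer fixes every point off it, in
   particular some [w], and then every point off the line through [x] and [w]. The two lines share
   only [x], so everything is fixed. *)
have [eqL|neL] := eqVneq (line x y) S; last first.
  case/negP: nC; apply/subsetP => u Pu; have [Gu ux uy] := pair_stabP _ _ _ Pu.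
  have sL a b : a \in S -> b \in S -> line a b \subset S.
    by move=> Sa Sb; case/closedP: (line_closed Sa Sb).
  have [w Sw nLw] : exists2 w, w \in S & w \notin line x y.
    by apply/subsetPn; apply: contra neL => sSL; rewrite eqEsubset sL.
  have uw := line_fix Sx Sy nexy Pu Sw nLw.
  have nexw : x != w by apply: contraNneq nLw => <-; apply: mem_line1.
  apply/setIP; split=> //; apply/astabP => z Sz; have [->//|nezx] := eqVneq z x.
  have [Lz|] := boolP (z \in line x y); last exact: line_fix.
  apply: (@line_fix x w) => //; first by apply/pair_stabP.
  apply: contra nLw => Lz'; rewrite eq_sym in nezx.
  have e1 := line_eq Sx Sy nexy nezx (mem_line1 _ _) Lz.
  have e2 := line_eq Sx Sw nexw nezx (mem_line1 _ _) Lz'.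
  by rewrite -e1 e2 mem_line2.
pose E := <<\bigcup_(z in S) R z>>%G.
have sRE z : z \in S -> R z \subset E by move=> Sz; rewrite sub_gen // (bigcup_max z).
(* The pair closures at points of the orbit of [x] are conjugates of [R x] inside the generated
   group. So the orbit is closed; it contains a line, hence all of [S]. *)
have sEL g : g \in G -> g \notin H x -> E \subset <<g |: R x>>.
  move=> Gg nHg; set L := <<g |: R x>>%G.
  have sLG : L \subset G.
    rewrite gen_subG subUset sub1set Gg /=.
    exact: subset_trans (pair_closure_sub x) (subsetIl _ _).
  have nexg : x != to x g.
    by apply: contra nHg => /eqP e; apply/setIP; split=> //; apply/astab1P.
  have RL z l r : l \in L -> z = to x l -> r \in R z -> r \in L.
    move=> Ll -> Rr; rewrite -(groupJr _ (groupVr Ll)).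
    apply: (subsetP (subset_trans (subsetUr [set g] (R x)) (subset_gen _))).
    rewrite -[x](actK to l); apply: pair_closureJ => //.
    by rewrite groupV (subsetP sLG).
  have cO : closed (orbit to L x).
    apply/closedP; split; first by rewrite acts_sub_orbit // (subset_trans sLG).
    move=> z r w /orbitP[l Ll lz] Rr /orbitP[m Mm <-].
    by rewrite -actM mem_orbit // groupM // (RL z l).
  have sSO : S \subset orbit to L x.
    rewrite -eqL; have Sxg : to x g \in S by rewrite (mem_act _ aG).
    suff -> : line x y = line x (to x g).
      by rewrite line_min ?orbit_refl // mem_orbit // mem_gen ?setU11.
    by apply: esym; apply: line_eq; rewrite ?mem_line1 // eqL.
  rewrite gen_subG; apply/bigcupsP => z Sz; apply/subsetP => r.
  by have /orbitP[l Ll lz] := subsetP sSO z Sz; apply: RL Ll (esym lz).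
have sRH := pair_closure_sub x.
have [sHE|nsHE] := boolP (H x \subset E).
  exists (R x); split=> //; have /properP[_ [g Gg nHg]] := maxgroupp maxH.
  by exists g => //; apply: full => //; apply: subset_trans sHE (sEL g Gg nHg).
have ltEH : (H x :&: E)%G \subset H x by apply: subsetIl.
have [/= e|[Q maxQ]] := maximal_exists ltEH; first by rewrite -e subsetIr in nsHE.
rewrite /= => sEQ; have ltQ := maxgroupp maxQ; have sQH := proper_sub ltQ.
have sRQ : R x \subset Q by apply: subset_trans sEQ; rewrite subsetI sRH sRE.
exists Q; split=> //; first exact: subset_trans sPR sRQ.
have /properP[_ [h Hh nQh]] := ltQ.
have [e Ee nHe] : exists2 e, e \in E & e \notin H x.
  apply/subsetPn; apply: contra nC => sEH; apply/subsetP => u Pu.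
  have [Gu _ _] := pair_stabP _ _ _ Pu; apply/setIP; split=> //; apply/astabP => w Sw.
  have [g Gg gx] := atransE tG Sx Sw; have Ru := subsetP sPR u Pu.
  have : u ^ g^-1 \in H x.
    apply: (subsetP sEH); apply: (subsetP (sRE (to x g^-1) _)).
      by rewrite (mem_act _ aG) ?groupV.
    by apply: pair_closureJ; rewrite ?groupV.
  by case/setIP=> _ /astab1P ux; rewrite -gx actCJV ux.
have Ge : e \in G.
  apply: subsetP Ee; rewrite gen_subG; apply/bigcupsP => z _.
  exact: subset_trans (pair_closure_sub z) (subsetIl _ _).
have Gh : h \in G by case/setIP: Hh.
(* Being outside [H x], the product together with [Q] generates [E], hence [e], hence [h], which
   completes the maximal subgroup [Q] to [H x]. *)
have nHhe : h * e \notin H x by rewrite groupMl.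
have Ghe : h * e \in G by rewrite groupM.
exists (h * e) => //; apply: full => //.
have sEL' : E \subset <<h * e |: Q>>.
  by apply: subset_trans (sEL _ Ghe nHhe) _; rewrite genS // setUS.
have Lh : h \in <<h * e |: Q>>.
  have eh : h = h * e * e^-1 by rewrite mulgK.
  by rewrite {1}eh groupM ?groupV ?(subsetP sEL' e) // mem_gen ?setU11.
have := maximal_full (L := [group of <<h * e |: Q>> :&: H x]) maxQ; rewrite /= subsetI sQH andbT.
rewrite (subset_trans (subsetUr _ _) (subset_gen _)) subsetIr => /(_ isT isT).
rewrite subsetI subxx andbT; apply; apply/subsetPn; exists h => //.
by apply/setIP.
Qed.

End TwoTransitive.

(** Used for point stabilizers of index [m] over the kernel in degree [m + 1]. It fails for [m = 4],
    whence the separate treatment of degree 5. *)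
Lemma trunc_log2_half m : 5 < m -> trunc_log 2 m <= m./2.-1.
Proof.
move=> m_gt5; have lt : m < 2 ^ m./2.
  have [k ek] : exists k, m./2 = k.+3 by exists (m./2 - 3); move: m_gt5; nlia.
  rewrite ek; suff : k.+3.*2.+1 < 2 ^ k.+3.
    by move: ek; nlia.
  elim: {ek} k => // k IHk; rewrite expnS; move: IHk; nlia.
have := @trunc_log_ltn 2 m isT.
have : 2 ^ trunc_log 2 m < 2 ^ m./2.
  by apply: leq_ltn_trans lt; apply: trunc_logP => //; move: m_gt5; nlia.
rewrite ltn_exp2l //; nlia.
Qed.

(** * Auxiliary facts on primitive groups, and degree 5 *)

Section Primitive.
Variables (gT : finGroupType) (T : finType) (to : {action gT &-> T}).
Implicit Types (G : {group gT}) (S : {set T}).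

Lemma jordan_pair_trans G S : [acts G, on S | to] -> 3 < #|S| ->
  (forall x y, x \in S -> y \in S -> x != y -> jordan to G S (S :\: [set x; y])) ->
  forall x, x \in S -> [transitive 'C_G[x | to], on S :\ x | to].
Proof.
move=> aG S_gt3 jG x Sx.
have [a Sa] : exists a, a \in S :\ x.
  by apply/card_gt0P; move: S_gt3; rewrite (cardsD1 x S) Sx; nlia.
apply: (atransI Sa); first exact: acts_stab1.
move=> b Sb; have [y] : exists y, y \in S :\: [set x; a; b].
  apply/card_gt0P; have : #|[set x; a; b]| <= 3.
    by rewrite (leq_trans (leq_card_setU _ _)) // cards1 addn1 ltnS cards2; case: eqP.
  have := subset_leq_card (subsetIr S [set x; a; b]).
  by have := cardsID [set x; a; b] S; move: S_gt3; nlia.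
rewrite !inE !negb_or => /andP[/andP[/andP[neyx neya] neyb] Sy].
have /jordanP/(_ a b) := jG x y Sx Sy ltac:(by rewrite eq_sym).
move: Sa Sb; rewrite !inE ![_ == y]eq_sym (negPf neya) (negPf neyb) !orbF.
case/andP=> -> -> /andP[-> ->] /= [] // g /setIP[Gg /astabP Cg] gab.
exists g => //; apply/setIP; split=> //; apply/astab1P; apply: Cg.
by rewrite !inE eqxx.
Qed.

(** The stabilizers of [x] and [y] coincide, so an element taking [x] to [y] normalizes them; by
    maximality the stabilizer is normal in [G] and fixes all points. *)
Lemma fixed_stab_trivial G S x y : [transitive G, on S | to] -> x \in S -> y \in S -> y != x ->
  maximal 'C_G[x | to] G -> 'C_G[x | to] \subset 'C[y | to] ->
  'C_G[x | to] \subset 'C_G(S | to).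
Proof.
move=> tG Sx Sy neyx maxH fy; have [g Gg gx] := atransE tG Sx Sy.
have eH : 'C_G[x | to] :^ g = 'C_G[x | to].
  apply/esym/eqP; rewrite eqEcard cardJg leqnn andbT -stab1_act // gx.
  by rewrite subsetI subsetIl.
have Ng : g \in 'N_G('C_G[x | to]) by apply/setIP; split=> //; apply/normP.
have sGN : G \subset 'N_G('C_G[x | to]).
  apply: (maximal_full (H := 'C_G[x | to]%G) maxH); rewrite ?subsetIl //=.
    by rewrite subsetI subsetIl normG.
  apply/subsetPn; exists g => //; apply: contra neyx => /setIP[_ /astab1P e].
  by rewrite -gx e.
rewrite subsetI subsetIl /=; apply/subsetP => h Hh; apply/astabP => w Sw.
have [k Gk <-] := atransE tG Sx Sw.
have /normP eK : k \in 'N('C_G[x | to]) by case/setIP: (subsetP sGN k Gk).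
suff : h \in 'C_G[to x k | to] by case/setIP=> _ /astab1P.
by rewrite stab1_act // eK.
Qed.

(** In this sharply doubly transitive case the stabilizer has order 4 modulo the kernel; the point
    is that it is cyclic and not a four-group. *)
Lemma dgen_deg5_regular G S x y : [transitive G, on S | to] -> #|S| = 5 ->
  (forall z, z \in S -> [transitive 'C_G[z | to], on S :\ z | to]) ->
  (forall z, z \in S -> maximal 'C_G[z | to] G) -> x \in S -> y \in S -> x != y ->
  pair_stab to G x y \subset 'C_G(S | to) -> dgen 1 'C_G[x | to] 'C_G(S | to).
Proof.
move=> tG S5 t2G maxG Sx Sy nexy sPC; have aG := atrans_acts tG.
have S_gt2 : 2 < #|S| by rewrite S5.
have triv a b u : a \in S -> b \in S -> a != b -> u \in G -> to a u = a -> to b u = b ->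
    u \in 'C_G(S | to).
  move=> Sa Sb neab Gu ua ub.
  have [g Gg [ga gb]] := two_trans2 tG t2G Sx Sy nexy Sa Sb neab.
  have : u ^ g^-1 \in 'C_G(S | to).
    apply: (subsetP sPC); apply/pair_stabP; rewrite groupJ ?groupV // -ga in ua *.
    by rewrite -gb in ub; rewrite -{1}[x](actK to g) -actCJ ua actK -{1}[y](actK to g) -actCJ ub actK.
  by rewrite memJ_norm // groupV (subsetP (normal_norm (stab_normal aG))).
have nC := stab_normal aG.
(* If all squares were trivial, there would be elements exchanging [x] and [y], one fixing [w] and
   one fixing [w']. They agree modulo the kernel, so the first fixes both [w] and [w'] and is
   trivial, a contradiction. *)
have [h Hh nCh] : exists2 h, h \in 'C_G[x | to] & h ^+ 2 \notin 'C_G(S | to).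
  apply/exists_inP; apply: contraT; rewrite negb_exists_in => /forall_inP sq.
  have sq' w g : w \in S -> g \in G -> to w g = w -> g ^+ 2 \in 'C(S | to).
    move=> Sw Gg gw; have [k Gk kx] := atransE tG Sx Sw.
    have /sq : g ^ k^-1 \in 'C_G[x | to].
      apply/setIP; rewrite groupJ ?groupV //; split=> //; apply/astab1P.
      by rewrite -{1}[x](actK to k) -actCJ kx gw -kx actK.
    rewrite negbK -conjXg memJ_norm ?groupV; first by case/setIP.
    exact: (subsetP (normal_norm nC)).
  have W2 : 2 < #|S :\: [set x; y]|.
    have := cardsID [set x; y] S; have := subset_leq_card (subsetIr S [set x; y]).
    by rewrite cards2 nexy S5; nlia.
  have [w Ww] : exists w, w \in S :\: [set x; y] by apply/card_gt0P; move: W2; nlia.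
  have [w' Ww' neww'] := card_gt1_other w (ltnW W2).
  have swap v : v \in S :\: [set x; y] ->
      exists g, [/\ g \in G, to v g = v, to x g = y & to y g = x].
    rewrite !inE negb_or => /andP[/andP[nevx nevy] Sv].
    have Vx : x \in S :\ v by rewrite in_setD1 eq_sym nevx.
    have Vy : y \in S :\ v by rewrite in_setD1 eq_sym nevy.
    have [g] := atransE (t2G v Sv) Vx Vy.
    move=> /setIP[Gg /astab1P gv] gx; exists g; split=> //.
    by have /astabP/(_ x Sx) := sq' v g Sv Gg gv; rewrite expgS expg1 actM gx.
  have [g [Gg gw gx gy]] := swap w Ww; have [g' [Gg' gw' gx' gy']] := swap w' Ww'.
  have : g * g'^-1 \in 'C_G(S | to).
    apply: (@triv x y); rewrite ?groupM ?groupV // actM; first by rewrite gx -gx' actK.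
    by rewrite gy -gy' actK.
  have [[Sw _] [Sw' _]] := (setDP Ww, setDP Ww').
  case/setIP=> _ /astabP/(_ w' Sw'); rewrite actM => e.
  have gw2 : to w' g = w' by have := congr1 (to^~ g') e; rewrite /= actKV gw'.
  have /setIP[_ /astabP/(_ x Sx)] := triv w w' g Sw Sw' ltac:(by rewrite eq_sym) Gg gw gw2.
  by rewrite gx => exy; rewrite exy eqxx in nexy.
set C := 'C_G(S | to)%G; set H := 'C_G[x | to]%G.
have sCH : C \subset H by rewrite setIS // astabS // sub1set.
have nCH : H \subset 'N(C) by apply: subset_trans (normal_norm nC); apply: subsetIl.
have cardHC : #|H / C| = 4.
  rewrite card_quotient //.
  have -> : #|H : C| = #|H : 'C_H[y | to]|.
    have sCHy : 'C_H[y | to] \subset C.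
      by apply: subset_trans sPC; apply/subsetP => u /setIP[/setIP[Gu /astab1P ux] /astab1P uy]; apply/pair_stabP.
    have -> : C :=: 'C_H[y | to]; last by [].
    by apply/eqP; rewrite eqEsubset sCHy subsetI sCH /C /= subIset // astabS ?orbT // sub1set.
  rewrite -card_orbit (atransP (t2G x Sx)); last by rewrite in_setD1 eq_sym nexy.
  by have := cardsD1 x S; rewrite Sx S5; nlia.
have NCh : h \in 'N(C) by apply: (subsetP nCH).
have ord4 : #[coset C h] = 4.
  have : #[coset C h] %| 4 by rewrite -cardHC order_dvdG // mem_quotient.
  have : ~~ (#[coset C h] %| 2).
    rewrite order_dvdn -morphX //; apply: contra nCh => /eqP/coset_idr.
    by apply; rewrite groupX.
  have := order_gt0 (coset C h).
  by case: #[_] => [|[|[|[|[|]]]]] // k _ _ /dvdn_leq => /(_ isT).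
apply: (dgen1I (x := h)) => //.
have sHC : H / C \subset <[h]> / C.
  rewrite quotient_cycle // subEproper eq_sym; apply/orP; left.
  by rewrite eqEcard cycle_subG mem_quotient // cardHC -ord4 leqnn.
rewrite quotientSK // in sHC; apply: subset_trans sHC _.
by rewrite mul_subG //= ?cycle_subG ?mem_gen ?setU11 // sub_gen ?subsetUr.
Qed.

(** A Sylow subgroup for the prime [#|S|] does not fit into the stabilizer of [x], which has this
    prime as index. An element of it moving [x] has an orbit of prime power length, which leaves
    only [S]. *)
Lemma prime_cycle G S x : [transitive G, on S | to] -> x \in S -> prime #|S| ->
  exists2 s, s \in G & orbit to <[s]> x = S.
Proof.
move=> tG Sx pS; have aG := atrans_acts tG; set p := #|S|; have [Q sylQ] := Sylow_exists p G.
have [sQ|/subsetPn[s Qs nHs]] := boolP (Q \subset 'C_G[x | to]).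
  have : p %| #|G : Q|.
    rewrite -(Lagrange_index (subsetIl G 'C[x | to]) sQ) -card_orbit (atransP tG) //.
    exact: dvdn_mulr.
  by case/and3P: sylQ => _ _; rewrite p'natE // => /negPf->.
have Gs : s \in G by apply: (subsetP (pHall_sub sylQ)).
exists s => //; apply/eqP; rewrite eqEcard acts_sub_orbit ?cycle_subG ?(subsetP aG) // Sx /=.
have : p.-nat #|orbit to <[s]> x|.
  apply: pnat_dvd (dvdn_orbit _ _ _) _.
  exact: mem_p_elt (pHall_pgroup sylQ) Qs.
case/p_natP=> // -[|k] ek; last by rewrite ek expnS leq_pmulr ?expn_gt0 ?prime_gt0.
move: ek; rewrite expn0 => /card_orbit1 o1; case/negP: nHs; apply/setIP; split=> //.
by apply/astab1P; apply/set1P; rewrite -o1 mem_orbit ?cycle_id.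
Qed.

(** Either the two-point stabilizer has index at most 3 over the kernel, or [G] contains a
    transposition [t]. In the latter case [t] and an element [s] transitive on the five points
    induce the full symmetric group. *)
Lemma dgen_deg5_pair G S x y : [transitive G, on S | to] -> #|S| = 5 ->
  (forall z, z \in S -> [transitive 'C_G[z | to], on S :\ z | to]) ->
  x \in S -> y \in S -> x != y ->
  dgen 1 (pair_stab to G x y) 'C_G(S | to) \/ dgen 2 G 'C_G(S | to).
Proof.
move=> tG S5 t2G Sx Sy nexy; have aG := atrans_acts tG.
set C := 'C_G(S | to)%G; pose P := 'C_G([set x; y] | to)%G.
have sCP : C \subset P.
  by rewrite setIS // astabS // subUset !sub1set Sx.
have cW : #|S :\: [set x; y]| = 3.
  by rewrite cardsDS ?cards2 ?nexy ?S5 // subUset !sub1set Sx.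
have [z Wz] : exists z, z \in S :\: [set x; y] by apply/card_gt0P; rewrite cW.
have aP : [acts P, on S :\: [set x; y] | to].
  apply: actsD; first exact: subset_trans (subsetIl _ _) aG.
  exact: subset_trans (subsetIr _ _) (astab_sub _ _).
have [sPzC|/subsetPn[t Pzt nCt]] := boolP ('C_P[z | to] \subset C).
  left; apply: dgenW (dgen_log sCP).
  have leP : #|P : C| <= 3.
    have eC : C :=: 'C_P[z | to].
      apply/eqP; rewrite eqEsubset sPzC subsetI sCP /C /= subIset // astabS ?orbT // sub1set.
      by case/setDP: Wz.
    rewrite eC -card_orbit -cW subset_leq_card //.
    by rewrite acts_sub_orbit.
  move: leP (indexg_gt0 P C); case: #|P : C| => [|[|[|[|]]]] //.
right; have /setIP[/setIP[Gt /astabP Ct] /astab1P tz] := Pzt.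
have [Sz nxyz] := setDP Wz.
pose D := S :\: [set x; y; z].
have eD : D = (S :\: [set x; y]) :\ z by rewrite /D setDDl.
have cD : #|D| = 2 by have := cardsD1 z (S :\: [set x; y]); rewrite Wz cW eD; nlia.
have sDS : D \subset S by apply: subsetDl.
have Ptriv p u : p \in G -> to x p = x -> to y p = y -> to z p = z -> u \in D -> to u p = u ->
    p \in C.
  move=> Gp px py pz Du pu; apply/setIP; split=> //; apply/astabP => w Sw.
  have [->//|newu] := eqVneq w u.
  have [|nDw] := boolP (w \in D); last first.
    move: nDw; rewrite !inE Sw andbT negbK => /orP[/orP[/eqP->|/eqP->]|/eqP->] //.
  move=> Dw; have Dwp : to w p \in D.
    rewrite !inE (mem_act _ aG) // Sw andbT -{1}px -{1}py -{1}pz !(inj_eq (act_inj _ _)).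
    by move: Dw; rewrite !inE => /andP[].
  have : to w p \in D :\ u by rewrite in_setD1 Dwp andbT -{1}pu (inj_eq (act_inj _ _)).
  have : w \in D :\ u by rewrite in_setD1 newu.
  move=> W1 W2; apply: card_le1_eq W2 W1.
  by have := cardsD1 u D; rewrite Du cD; nlia.
have tx : to x t = x by apply: Ct; rewrite !inE eqxx.
have ty : to y t = y by apply: Ct; rewrite !inE eqxx orbT.
have moved u : u \in D -> to u t != u.
  by move=> Du; apply: contra nCt => /eqP; apply: Ptriv.
have Dt u : u \in D -> to u t \in D.
  rewrite !inE (mem_act _ aG) // -{2}tx -{2}ty -{2}tz !(inj_eq (act_inj _ _)).
  by [].
have [s Gs oS] := prime_cycle tG Sx ltac:(by rewrite S5).
set A := [set t; s]; pose L := <<A>>%G.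
have sAG : A \subset G by rewrite subUset !sub1set Gt.
have sLG : L \subset G by rewrite gen_subG.
have [Lt Ls] : t \in L /\ s \in L by rewrite !mem_gen // !inE eqxx ?orbT.
have aL : [acts L, on S | to] by apply: acts_subset aG.
have tL : [transitive L, on S | to].
  apply: (atransI Sx aL) => w; rewrite -oS => /orbitP[g sg <-]; exists g => //.
  by apply: subsetP sg; rewrite cycle_subG.
have maxL : maximal 'C_L[x | to] L.
  by apply: p_index_maximal; rewrite ?subsetIl // -card_orbit (atransP tL) ?S5.
have jD : jordan to L S D.
  apply/jordanP => a b Da Db; have [<-|neab] := eqVneq a b.
    by exists 1; rewrite ?group1 ?act1.
  exists t; last first.
    apply: (card_le1_eq (A := D :\ a)); rewrite ?in_setD1 ?Dt ?moved ?Db ?[b == a]eq_sym ?neab //.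
    by have := cardsD1 a D; rewrite Da cD; nlia.
  apply/setIP; split=> //; apply/astabP => w /setDP[Sw].
  by rewrite !inE Sw andbT negbK => /orP[/orP[/eqP->|/eqP->]|/eqP->].
have jL : forall a b, a \in S -> b \in S -> a != b -> jordan to L S (S :\: [set a; b]).
  by apply: (jordan_primitive aL tL Sx maxL _ sDS jD); rewrite ?S5 ?cD.
have t2L := jordan_pair_trans aL ltac:(by rewrite S5) jL.
have gt2 : 2 < #|S| by rewrite S5.
have e2 : #|A| <= 2 by rewrite cards2; case: (_ != _).
apply: (dgenW e2); apply: (dgenI sAG); apply/subsetP => g Gg.
have sL' : L \subset <<A :|: C>> by rewrite genS ?subsetUl.
have sC' : C \subset <<A :|: C>> by rewrite sub_gen ?subsetUr.
(* By triple transitivity of [L], [g] is corrected until it fixes [x], [y] and [z]. The two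
   remaining points are then fixed or exchanged, and [t] undoes an exchange. *)
have [l1 Ll1 [l1x l1y]] : exists2 l, l \in L & to x l = to x g /\ to y l = to y g.
  by apply: (two_trans2 tL t2L); rewrite ?(mem_act _ aG) ?(inj_eq (act_inj _ _)).
have := groupMr g (subsetP sL' _ (groupVr Ll1)) => <-.
set p := g * _; have Gp : p \in G by rewrite groupM ?groupV // (subsetP sLG).
have px : to x p = x by rewrite actM -l1x actK.
have py : to y p = y by rewrite actM -l1y actK.
have Wzp : to z p \in S :\: [set x; y].
  move: nxyz; rewrite !inE (mem_act _ aG) // Sz andbT -{2}px -{2}py !(inj_eq (act_inj _ _)).
  by [].
have /jordanP/(_ z _ Wz Wzp)[l2 /setIP[Ll2 /astabP Cl2] l2z] := jL x y Sx Sy nexy.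
have := groupMr p (subsetP sL' _ (groupVr Ll2)) => <-.
have Sxy v : v \in [set x; y] -> v \in S :\: (S :\: [set x; y]).
  by case/set2P=> ->; rewrite !inE eqxx ?orbT ?Sx ?Sy.
set q := p * _; have Gq : q \in G by rewrite groupM ?groupV // (subsetP sLG).
have qx : to x q = x by rewrite actM px -{1}(Cl2 x) ?actK // Sxy ?set21.
have qy : to y q = y by rewrite actM py -{1}(Cl2 y) ?actK // Sxy ?set22.
have qz : to z q = z by rewrite actM -l2z actK.
have [u Du] : exists u, u \in D by apply/card_gt0P; rewrite cD.
have [qu|nequ] := eqVneq (to u q) u.
  by apply: (subsetP sC'); apply: Ptriv Du qu.
have := groupMr q (subsetP sL' _ Lt) => <-.
apply: (subsetP sC'); apply: (Ptriv _ u (groupM Gq Gt)); rewrite ?[to _ (q * t)]actM ?qx ?qy ?qz //.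
have Duq : to u q \in D.
  move: Du; rewrite !inE (mem_act _ aG) // -{2}qx -{2}qy -{2}qz !(inj_eq (act_inj _ _)).
  by [].
have tuq : to (to u q) t \in D :\ to u q by rewrite in_setD1 moved // Dt.
have Du' : u \in D :\ to u q by rewrite in_setD1 eq_sym nequ.
apply: card_le1_eq tuq Du'.
by have := cardsD1 (to u q) D; rewrite Duq cD; nlia.
Qed.

End Primitive.

(** * Primitive groups *)

Section PrimitiveBound.
Variables (gT : finGroupType) (T : finType) (to : {action gT &-> T}).
Implicit Types (G : {group gT}) (S : {set T}).

Lemma jordan_two_trans G S (D : {set T}) x : [transitive G, on S | to] -> x \in S ->
  maximal 'C_G[x | to] G -> odd #|S| -> 3 < #|S| -> D \subset S -> jordan to G S D ->
  1 < #|D| -> #|D|.*2 < #|S| -> [transitive 'C_G[x | to], on S :\ x | to].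
Proof.
move=> tG Sx maxG oddS S_gt3 sDS jD D_gt1 ltD; have aG := atrans_acts tG.
exact: jordan_pair_trans aG S_gt3 (jordan_primitive aG tG Sx maxG oddS sDS jD D_gt1 ltD) x Sx.
Qed.

(** A Jordan subset of the shortest orbit of the stabilizer would contain fewer than half of the
    points, and in odd degree would make [G] doubly transitive. A fixed point of the stabilizer
    makes it trivial, and in degree 4 nothing else can happen. *)
Lemma dgen_stab_intransitive n G S x : MN_lt gT n -> #|S| <= n ->
  [transitive G, on S | to] -> x \in S -> maximal 'C_G[x | to] G -> 3 < #|S| ->
  ~~ [transitive 'C_G[x | to], on S :\ x | to] ->
  (odd #|S| -> dgen #|S|.-2./2 'C_G[x | to] 'C_G(S | to)) /\
  (#|S| = 4 -> dgen 0 'C_G[x | to] 'C_G(S | to)).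
Proof.
move=> IH leSn tG Sx maxG S_gt3 ntH; have aG := atrans_acts tG; set H := 'C_G[x | to]%G.
have cS : #|S| = #|S :\ x|.+1 by rewrite (cardsD1 x S) Sx.
have aH : [acts H, on S :\ x | to] by apply: acts_stab1.
have [|noF] := boolP [exists y in S :\ x, H \subset 'C[y | to]].
  case/exists_inP=> y; rewrite in_setD1 => /andP[neyx Sy] fy.
  suff d0 : dgen 0 H 'C_G(S | to) by split=> // _; apply: dgenW d0.
  apply: dgen0; apply: subset_trans (subset_gen _).
  exact: fixed_stab_trivial tG Sx Sy neyx maxG fy.
rewrite negb_exists_in in noF; have {}noF := forall_inP noF.
have [x0 Sx0] : exists y, y \in S :\ x by apply/card_gt0P; move: S_gt3 cS; nlia.
case: (@arg_minnP _ x0 (mem (S :\ x)) (fun y => #|orbit to H y|) Sx0) => y /= Sy miny.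
set O := orbit to H y; have Oy : y \in O by apply: orbit_refl.
have sOS : O \subset S :\ x by rewrite acts_sub_orbit.
have tO : [transitive H, on O | to] by apply: atrans_orbit.
have O_gt1 : 1 < #|O|.
  rewrite ltn_neqAle eq_sym -/O; apply/andP; split; last by apply/card_gt0P; exists y.
  apply: contra (noF y Sy) => /eqP/card_orbit1 o1.
  by apply/subsetP => h Hh; apply/astab1P/set1P; rewrite -o1 mem_orbit.
have nsO : O != S :\ x by apply: contraNneq ntH => <-; apply: atrans_orbit.
have [z Sz nOz] : exists2 z, z \in S :\ x & z \notin O.
  by apply/subsetPn; apply: contra nsO => sO; rewrite eqEsubset sOS.
have leO : #|O| <= #|(S :\ x) :\: O|.
  apply: leq_trans (miny z Sz) _; apply: subset_leq_card; apply/subsetP => w zw.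
  have sub : orbit to H z \subset S :\ x by rewrite acts_sub_orbit.
  rewrite in_setD (subsetP sub w zw) andbT; apply: contra nOz => Ow.
  by apply: orbit_trans Ow; rewrite orbit_sym.
have eDO := cardsDS sOS; have leOS := subset_leq_card sOS.
split=> [oddS|S4]; last by move: leO O_gt1 eDO leOS cS S4; nlia.
have sOS' : O \subset S by apply: subset_trans sOS (subsetDl _ _).
have noJ (L : {set T}) : L \subset O -> 1 < #|L| -> ~~ jordan to G S L.
  move=> sLO L_gt1; apply: contra ntH => jL; have leL := subset_leq_card sLO.
  apply: (jordan_two_trans (D := L) tG Sx maxG oddS S_gt3 _ jL L_gt1).
    exact: subset_trans sLO sOS'.
  by move: leL leO eDO leOS cS; nlia.
have eHS : 'C_H(S :\ x | to) = 'C_G(S | to) by apply: astab_eq1.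
have eV : 'C_H((S :\ x) :\: O | to) = 'C_G(S :\: O | to).
  rewrite subcent_astabU; congr (_ :&: 'C(_ | to)).
  apply/setP => w; rewrite !inE; have [->|_] //= := eqVneq w x.
  by rewrite Sx andbT; apply/esym; apply: contraTN Sx => /(subsetP sOS); rewrite !inE eqxx.
have -> : #|S|.-2 = #|S :\ x|.-1 by rewrite cS.
by apply: (dgen_orbit_no_jordan IH aG aH Oy sOS' sOS) => //; move: leSn cS; nlia.
Qed.

(** The [Q]-orbit [O] of [y] is a proper block of the stabilizer, so it has at most half of the
    points other than [x]. A Jordan subset of [O] would make the two-point stabilizer transitive on
    the remaining points; but this stabilizer lies in [Q] and preserves [O]. *)
Lemma dgen_two_transitive n G S x : MN_lt gT n -> #|S| <= n -> [transitive G, on S | to] ->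
  x \in S -> maximal 'C_G[x | to] G -> [transitive 'C_G[x | to], on S :\ x | to] ->
  3 < #|S| -> odd #|S| || (#|S| == 4) -> dgen #|S|./2 G 'C_G(S | to).
Proof.
move=> IH leSn tG Sx maxH tH S_gt3 oddS4; have aG := atrans_acts tG.
have maxG z : z \in S -> maximal 'C_G[z | to] G by move=> Sz; apply: (maximal_stab tG Sx Sz).
have t2G z : z \in S -> [transitive 'C_G[z | to], on S :\ z | to].
  move=> Sz; have [g Gg <-] := atransE tG Sx Sz.
  have [y Sy] : exists y, y \in S :\ x.
    by apply/card_gt0P; move: S_gt3; rewrite (cardsD1 x S) Sx; nlia.
  have eS : S :\ to x g = to^* (S :\ x) g.
    by rewrite (setact_setD aG) //; congr (S :\: _); apply/esym/imset_set1.
  apply: (atransI (x := to y g)); rewrite ?eS ?mem_setact //.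
    by rewrite -eS; apply: acts_stab1.
  move=> _ /setactP[w Sw ->]; have [h Hh <-] := atransE tH Sy Sw.
  exists (h ^ g); last by rewrite -actCJ.
  by rewrite /= stab1_act // memJ_conjg.
have cS : #|S| = #|S :\ x|.+1 by rewrite (cardsD1 x S) Sx.
have [y Sxy] : exists y, y \in S :\ x by apply/card_gt0P; move: S_gt3 cS; nlia.
have [Sy neyx] : y \in S /\ y != x by move: Sxy; rewrite !inE => /andP[].
have nexy : x != y by rewrite eq_sym.
set C := 'C_G(S | to)%G; set H := 'C_G[x | to]%G.
have eHy : 'C_H[y | to] = pair_stab to G x y by rewrite subcent_astabU.
have sCP : C \subset pair_stab to G x y by rewrite /pair_stab setIS // astabS // subUset !sub1set Sx.
have sCH : C \subset H by rewrite setIS // astabS // sub1set.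
have [sPC|[Q [sPQ ltQ [g Gg gG]]]] :=
  two_transitive_generation tG ltac:(exact: ltnW) t2G maxG Sx Sy nexy.
  (* In degree 5 the logarithmic bound for the stabilizer is too large by one. *)
  have [S5|neS5] := eqVneq #|S| 5.
    rewrite S5; apply: (dgen_maximal (H := H) maxH).
    exact: dgen_deg5_regular tG S5 t2G maxG Sx Sy nexy sPC.
  have iHC : #|H : C| = #|S :\ x|.
    have -> : C :=: 'C_H[y | to] by apply/eqP; rewrite eqEsubset eHy sCP.
    by rewrite -card_orbit (atransP tH).
  have dH := dgen_log sCH; rewrite iHC in dH.
  have S_gt1 : 1 < #|S| by apply: leq_trans S_gt3.
  have := dgen_maximal (H := H) maxH dH; apply: dgenW.
  case/orP: oddS4 => [oddS|/eqP S4]; last first.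
    by have -> : #|S :\ x| = 3 by [move: cS S4; nlia]; rewrite S4.
  have := @trunc_log2_half #|S :\ x|; move: cS neS5 S_gt3 oddS; nlia.
have sQH := proper_sub ltQ; have sQG := subset_trans sQH (subsetIl _ _).
have dQ k : dgen k Q C -> k.+1 <= #|S|./2 -> dgen #|S|./2 G C.
  move=> dQ lek; apply: dgenW lek _; rewrite -add1n; apply: dgen_trans sQG _ dQ.
  exact: dgen1I Gg gG.
have aQ : [acts Q, on S :\ x | to] by apply: acts_subset sQH (acts_stab1 x aG).
set O := orbit to Q y; have Oy : y \in O by apply: orbit_refl.
have sOS : O \subset S :\ x by rewrite acts_sub_orbit.
have sOS' : O \subset S by apply: subset_trans sOS (subsetDl _ _).
have bO : block to H (S :\ x) O.
  by apply: block_supgroup => //; [apply: acts_stab1 | rewrite eHy].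
have cO := block_card tH bO; set k := #|orbit _ _ _| in cO.
have sUQ h : h \in H -> to y h \in O -> h \in Q.
  move=> Hh /orbitP[q Qq e].
  suff : h * q^-1 \in Q by rewrite groupMr ?groupV.
  apply: (subsetP sPQ); rewrite -eHy; apply/setIP; split.
    by rewrite groupM // groupV (subsetP sQH).
  by apply/astab1P; rewrite actM -e actK.
have [w Sw nOw] : exists2 w, w \in S :\ x & w \notin O.
  apply/subsetPn; apply/negP => sSO; have /properP[_ [h Hh]] := ltQ; case/negP.
  apply: sUQ => //; apply: (subsetP sSO).
  by rewrite (mem_act _ (acts_stab1 x aG)).
have ltO : #|O| < #|S :\ x|.
  by apply: proper_card; rewrite properE sOS; apply/subsetPn; exists w.
have leO : #|O|.*2 <= #|S :\ x|.
  case: k cO => [|[|k]] cO; [move: ltO cO; nlia|move: ltO cO; nlia|].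
  by rewrite cO; nlia.
have eDO := cardsDS sOS.
have [O1|neO1] := eqVneq #|O| 1%N.
  have sQP : Q \subset pair_stab to G x y.
    apply/subsetP => q Qq; have /setIP[Gq /astab1P qx] := subsetP sQH q Qq.
    apply/pair_stabP; split=> //; apply/set1P.
    by rewrite -(card_orbit1 O1) mem_orbit.
  (* In degree 5 the group [Q] acts on 3 remaining points, where [mn] exceeds the half. *)
  have [S5|neS5] := eqVneq #|S| 5.
    have [dP|] := dgen_deg5_pair tG S5 t2G Sx Sy nexy; last by rewrite S5.
    apply: (dQ 1%N); last by rewrite S5.
    have -> : Q :=: pair_stab to G x y by apply/eqP; rewrite eqEsubset sQP.
    exact: dP.
  have aQ2 : [acts Q, on S :\: [set x; y] | to].
    apply: actsD; first exact: subset_trans sQG aG.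
    apply: subset_trans sQP _; exact: subset_trans (subsetIr _ _) (astab_sub _ _).
  have cS2 : #|S :\: [set x; y]| = #|S| - 2.
    by rewrite cardsDS ?cards2 ?nexy // subUset !sub1set Sx.
  have eC : 'C_Q(S :\: [set x; y] | to) = C.
    have -> : Q :=: 'C_G([set x; y] | to) by apply/eqP; rewrite eqEsubset sQP.
    by rewrite subcent_astabU setUC setDU_sub // subUset !sub1set Sx.
  have := IH _ _ _ _ aQ2; rewrite eC cS2 => d.
  apply: (dQ _ (d _)); first by move: leSn S_gt3; nlia.
  case/orP: oddS4 => [oddS|/eqP->//].
  by rewrite mn_neq3; move: neS5 S_gt3 oddS; nlia.
have O_gt1 : 1 < #|O|.
  by rewrite ltn_neqAle eq_sym neO1; apply/card_gt0P; exists y.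
have oddS : odd #|S|.
  case/orP: oddS4 => // /eqP S4.
  by move: leO O_gt1 cS S4; nlia.
have noJ (L : {set T}) : L \subset O -> 1 < #|L| -> ~~ jordan to G S L.
  move=> sLO L_gt1; apply/negP => jL; have leL := subset_leq_card sLO.
  have ltL : #|L|.*2 < #|S| by move: leL leO cS; nlia.
  have sLS := subset_trans sLO sOS'.
  have /jordanP jxy := jordan_primitive aG tG Sx maxH oddS sLS jL L_gt1 ltL Sx Sy nexy.
  have [y' Oy' ney'y] := card_gt1_other y O_gt1.
  have [||h /setIP[Gh /astabP Ch] hy] := jxy y' w.
  - have := subsetP sOS y' Oy'; rewrite !inE negb_or => /andP[-> ->].
    by rewrite ney'y.
  - move: Sw; rewrite !inE negb_or => /andP[-> ->].
    by rewrite andbT; apply: contraNneq nOw => ->.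
  have inQ : h \in Q.
    apply: (subsetP sPQ); apply/pair_stabP; split=> //; apply: Ch.
      by rewrite !inE eqxx Sx.
    by rewrite !inE eqxx orbT Sy.
  by case/negP: nOw; rewrite -hy -(mem_act _ (acts_orbit to y (subsetT Q)) inQ) in Oy' *.
have eV : 'C_Q((S :\ x) :\: O | to) = 'C_G(S :\: O | to).
  have nOx : x \notin O by apply: contraTN isT => /(subsetP sOS); rewrite !inE eqxx.
  apply/eqP; rewrite eqEsubset; apply/andP; split.
    apply/subsetP => h /setIP[Qh /astabP Ch]; have /setIP[Gh /astab1P hx] := subsetP sQH h Qh.
    apply/setIP; split=> //; apply/astabP => v /setDP[Sv nOv].
    have [->//|nevx] := eqVneq v x; apply: Ch; by rewrite !inE nOv nevx.
  have := acts_astab_out aG sOS' => aU.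
  apply/subsetP => h Uh; have /setIP[Gh /astabP Ch] := Uh; apply/setIP; split.
    apply: sUQ; last by rewrite (mem_act _ aU).
    apply/setIP; split=> //; apply/astab1P; apply: Ch.
    by rewrite inE nOx.
  apply/astabP => v; rewrite !inE => /and3P[nOv nevx Sv]; apply: Ch.
  by rewrite inE nOv.
have eC : 'C_Q(S :\ x | to) = C.
  have -> : C :=: 'C_Q(S | to).
    apply/eqP; rewrite eqEsubset; apply/andP; split; last exact: setSI.
    by rewrite subsetI (subset_trans sCP sPQ) subsetIr.
  rewrite -{2}(setD1K Sx) astabU [in RHS]setIA; congr (_ :&: _).
  by apply/esym/setIidPl; apply: subset_trans sQH (subsetIr _ _).
have tO : [transitive Q, on O | to] by apply: atrans_orbit.
apply: dQ (dgen_orbit_no_jordan IH aG aQ Oy sOS' sOS tO O_gt1 _ _ eV eC noJ) _.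
- by move: leO eDO O_gt1; nlia.
- by move: leSn cS; nlia.
by move: cS oddS S_gt3; nlia.
Qed.

(** One element over the stabilizer is affordable in degree at most 3 and in even degree other than
    4. Degree 4 joins the odd degrees because its stabilizer acts on 3 points. *)
Lemma dgen_primitive G S x : MN_lt gT #|S| -> [transitive G, on S | to] -> x \in S ->
  maximal 'C_G[x | to] G -> dgen (mn #|S|) G 'C_G(S | to).
Proof.
move=> IH tG Sx maxH; have aG := atrans_acts tG.
have cS : #|S| = #|S :\ x|.+1 by rewrite (cardsD1 x S) Sx.
have S_gt1 : 1 < #|S|.
  rewrite -(atransP tG x Sx) card_orbit indexg_gt1.
  by have /properP[_ [g Gg nHg]] := maxgroupp maxH; apply/subsetPn; exists g.
have dH : dgen (mn #|S :\ x|) 'C_G[x | to] 'C_G(S | to).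
  rewrite -(astab_eq1 to G Sx); apply: IH; first exact: acts_stab1.
  by rewrite cS.
have [oddS4|] := boolP ((odd #|S| || (#|S| == 4)) && (3 < #|S|)); last first.
  move=> small; apply: dgenW (dgen_maximal (H := 'C_G[x | to]%G) maxH dH).
  rewrite /mn; case: ifP => [/eqP S3|nS3]; last first.
    case: ifP => [/eqP S4|nS4]; first by move: small S4 cS; nlia.
    by move: small S_gt1 cS nS3 nS4; nlia.
  by case: ifP => [/eqP S3'|nS4]; move: small S3 S_gt1 cS; rewrite ?S3'; nlia.
have [oS S_gt3] := andP oddS4.
rewrite mn_neq3; last by case: eqP S_gt3 => // ->.
have [tH|ntH] := boolP [transitive 'C_G[x | to], on S :\ x | to].
  exact: dgen_two_transitive IH (leqnn _) tG Sx maxH tH S_gt3 oS.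
have [dodd d4] := dgen_stab_intransitive IH (leqnn _) tG Sx maxH S_gt3 ntH.
case/orP: oS => [/dodd d|/eqP S4].
  by apply: dgenW (dgen_maximal (H := 'C_G[x | to]%G) maxH d); move: S_gt3; nlia.
by apply: dgenW (dgen_maximal (H := 'C_G[x | to]%G) maxH (d4 S4)); rewrite S4.
Qed.

End PrimitiveBound.

(** * Imprimitive groups *)

Section ThreePoints.
Variables (gT : finGroupType) (T : finType) (to : {action gT &-> T}).
Implicit Types (Y W : {group gT}) (X : {set T}).

Lemma fix_two_of_three Y X p z u : [acts Y, on X | to] -> #|X| = 3 -> p \in Y -> z \in X ->
  u \in X -> u != z -> to z p = z -> to u p = u -> p \in 'C_Y(X | to).
Proof.
move=> aY cX Yp Xz Xu neuz pz pu; apply/setIP; split=> //; apply/astabP => w Xw.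
have [->//|newz] := eqVneq w z; have [->//|newu] := eqVneq w u.
have W1 : w \in X :\: [set z; u] by rewrite !inE negb_or newz newu.
have W2 : to w p \in X :\: [set z; u].
  rewrite !inE negb_or (mem_act _ aY) // Xw -{1}pz -{1}pu !(inj_eq (act_inj _ _)) newz.
  by rewrite newu.
apply: card_le1_eq W2 W1; rewrite cardsDS ?cX ?cards2 1?eq_sym ?neuz //.
by rewrite subUset !sub1set Xz.
Qed.

Lemma index_stab_le Y X z : [acts Y, on X | to] -> z \in X ->
  'C_Y[z | to] \subset 'C(X | to) -> #|Y : 'C_Y(X | to)| <= #|X|.
Proof.
move=> aY Xz sC; have -> : 'C_Y(X | to) = 'C_Y[z | to].
  apply/eqP; rewrite eqEsubset; apply/andP; split; first by rewrite setIS // astabS // sub1set.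
  by rewrite subsetI subsetIl.
by rewrite -card_orbit subset_leq_card // acts_sub_orbit.
Qed.

Lemma dgen1_stab Y X z : [acts Y, on X | to] -> #|X| <= 3 -> z \in X ->
  'C_Y[z | to] \subset 'C(X | to) -> dgen 1 Y 'C_Y(X | to).
Proof.
move=> aY cX Xz sC; apply: dgenW (dgen_log (H := 'C_Y(X | to)%G) (subsetIl _ _)).
have := leq_trans (index_stab_le aY Xz sC) cX.
by case: #|Y : _| => [|[|[|[|]]]].
Qed.

Lemma index_three Y X : [acts Y, on X | to] -> #|X| = 3 -> #|Y : 'C_Y(X | to)| <= 6.
Proof.
move=> aY cX; have [z Xz] : exists z, z \in X by apply/card_gt0P; rewrite cX.
have cXz : #|X :\ z| = 2 by have := cardsD1 z X; rewrite Xz cX; nlia.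
have [u Xu] : exists u, u \in X :\ z by apply/card_gt0P; rewrite cXz.
have [neuz Xu'] : u != z /\ u \in X by move: Xu; rewrite !inE => /andP[].
pose Yz := 'C_Y[z | to]%G; have aYz : [acts Yz, on X :\ z | to] by apply: acts_stab1.
have := index_stab_le aYz Xu; rewrite /= (astab_eq1 to Y Xz) cXz => le2.
have sC : 'C_Y(X | to) \subset Yz by rewrite setIS // astabS // sub1set.
rewrite -(Lagrange_index (subsetIl Y 'C[z | to]) sC).
apply: (@leq_trans (3 * 2)) => //; apply: leq_mul.
  by rewrite -card_orbit -cX subset_leq_card // acts_sub_orbit.
apply: le2; apply/subsetP => p /setIP[/setIP[Yp /astab1P pz] /astab1P pu].
have /setIP[_ Cp] := fix_two_of_three aY cX Yp Xz Xu' neuz pz pu.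
by apply: subsetP Cp; rewrite astabS ?subsetDl.
Qed.

(** [v] need not lie in [Y]. If a point stabilizer is trivial, one element suffices by index.
    Otherwise one transposition [t] of [Y] and its conjugates under [v] undo every element of [Y] up
    to the kernel. *)
Lemma dgen_three Y X v x : [acts Y, on X | to] -> #|X| = 3 -> x \in X -> v \in 'N(Y) ->
  orbit to <[v]> x = X -> dgen 1 Y (v |: 'C_Y(X | to)).
Proof.
move=> aY cX Xx Nv oX; have sD : 'C_Y(X | to) \subset <<v |: 'C_Y(X | to)>>.
  by rewrite sub_gen ?subsetUr.
have [/exists_inP[z Xz sC]|] := boolP [exists z in X, 'C_Y[z | to] \subset 'C(X | to)].
  by apply: dgenS sD _; apply: dgen1_stab Xz sC; rewrite ?cX.
rewrite negb_exists_in => /forall_inP/(_ x Xx)/subsetPn[t /setIP[Yt /astab1P tx] nCt].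
apply: (dgen1I Yt); set L := <<_>>.
have Lt : t \in L by rewrite mem_gen ?setU11.
have Lv : v \in L by rewrite mem_gen // !inE eqxx orbT.
have sDL : 'C_Y(X | to) \subset L by rewrite sub_gen // setUA subsetUr.
have moved u : u \in X -> u != x -> to u t != u.
  move=> Xu neux; apply: contra nCt => /eqP tu.
  by have /setIP[] := fix_two_of_three aY cX Yt Xx Xu neux tx tu.
have key p : p \in Y -> to x p = x -> p \in L.
  move=> Yp px; have [u Xu neux] : exists2 u, u \in X & u != x.
    by apply: card_gt1_other; rewrite cX.
  have [pu|nepu] := eqVneq (to u p) u.
    by apply: (subsetP sDL); apply: fix_two_of_three aY cX Yp Xx Xu neux px pu.
  suff : p * t \in L by rewrite groupMr.
  apply: (subsetP sDL); apply: (fix_two_of_three aY cX (groupM Yp Yt) Xx Xu neux).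
    by rewrite actM px.
  have upx : to u p != x by rewrite -{1}px (inj_eq (act_inj _ _)).
  have W1 : to (to u p) t \in X :\: [set x; to u p].
    rewrite !inE negb_or moved ?(mem_act _ aY) // andbT Xu andbT.
    by rewrite -{1}tx (inj_eq (act_inj _ _)).
  have W2 : u \in X :\: [set x; to u p] by rewrite !inE negb_or neux eq_sym nepu.
  rewrite actM; apply: card_le1_eq W1 W2; rewrite cardsDS ?cX ?cards2 1?eq_sym ?upx //.
  by rewrite subUset !sub1set Xx (mem_act _ aY).
apply/subsetP => y Yy; have [yx|neyx] := eqVneq (to x y) x; first exact: key.
have Xxy : to x y \in X by rewrite (mem_act _ aY).
have [u Xu] : exists u, u \in X :\: [set x; to x y].
  apply/card_gt0P; rewrite cardsDS ?cX ?cards2; first by case: (_ != _).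
  by rewrite subUset !sub1set Xx.
move: Xu; rewrite !inE negb_or => /andP[/andP[neux neuxy] Xu].
have /orbitP[w vw wx] : u \in orbit to <[v]> x by rewrite oX.
have Lw : w \in L by apply: subsetP vw; rewrite cycle_subG.
have Nw : w \in 'N(Y) by apply: subsetP vw; rewrite cycle_subG.
have Ytw : t ^ w \in Y by rewrite memJ_norm.
have Ltw : t ^ w \in L by rewrite groupJ.
have twu : to u (t ^ w) = u by rewrite -wx -actCJ tx.
have moved_w q : q \in X -> q != u -> to q (t ^ w) != q.
  move=> Xq nequ; apply: contra nCt => /eqP tq.
  have /setIP[_ Cw] := fix_two_of_three aY cX Ytw Xu Xq nequ twu tq.
  apply/astabP => r Xr; have Xrw : to r w \in X.
    rewrite -oX in Xr *; by rewrite (mem_act _ (acts_orbit to x (subsetT <[v]>%G))).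
  by have := astab_act Cw Xrw; rewrite -actCJ => /act_inj.
suff : y * t ^ w \in L by rewrite groupMr.
apply: key; first exact: groupM.
have nexyu : to x y != u by rewrite eq_sym.
have W1 : to (to x y) (t ^ w) \in X :\: [set u; to x y].
  rewrite !inE negb_or moved_w // (mem_act _ aY) // Xxy !andbT.
  by rewrite -{1}twu (inj_eq (act_inj _ _)).
have W2 : x \in X :\: [set u; to x y] by rewrite !inE negb_or eq_sym neux eq_sym neyx.
rewrite actM; apply: card_le1_eq W1 W2; rewrite cardsDS ?cX ?cards2 ?neuxy //.
by rewrite subUset !sub1set Xu.
Qed.

(** If no point stabilizer is trivial on [X], there is a transposition fixing each point, and these
    already make [Y] transitive. *)
Lemma three_cycle_or Y X x : [acts Y, on X | to] -> #|X| = 3 -> x \in X ->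
  dgen 1 Y 'C_Y(X | to) \/ exists2 v, v \in Y & orbit to <[v]> x = X.
Proof.
move=> aY cX Xx; have [tY|ntY] := boolP [transitive Y, on X | to].
  by right; apply: prime_cycle; rewrite ?cX.
left; have [/exists_inP[z Xz sC]|] := boolP [exists z in X, 'C_Y[z | to] \subset 'C(X | to)].
  by apply: dgen1_stab Xz sC; rewrite ?cX.
rewrite negb_exists_in => /forall_inP nC; case/negP: ntY; apply: (atransI Xx aY) => y Xy.
have [->|neyx] := eqVneq y x; first by exists 1; rewrite ?act1.
have [z Xz] : exists z, z \in X :\: [set x; y].
  apply/card_gt0P; rewrite cardsDS ?cX ?cards2; first by case: (_ != _).
  by rewrite subUset !sub1set Xx.
move: Xz; rewrite !inE negb_or => /andP[/andP[nezx nezy] Xz].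
have /subsetPn[t /setIP[Yt /astab1P tz] nCt] := nC z Xz.
exists t => //; have nexz : x != z by rewrite eq_sym.
have ntx : to x t != x.
  apply: contra nCt => /eqP tx.
  by have /setIP[] := fix_two_of_three aY cX Yt Xz Xx nexz tz tx.
have W1 : to x t \in X :\: [set z; x].
  rewrite !inE negb_or ntx (mem_act _ aY) // Xx -{1}tz (inj_eq (act_inj _ _)) nexz.
  by [].
have W2 : y \in X :\: [set z; x] by rewrite !inE negb_or neyx eq_sym nezy.
apply: card_le1_eq W1 W2; rewrite cardsDS ?cX ?cards2 ?nezx //.
by rewrite subUset !sub1set Xz.
Qed.

End ThreePoints.

(** * Generating the kernel of the action on blocks *)

Section Imprimitive.
Variables (gT : finGroupType) (T : finType) (to : {action gT &-> T}).
Variables (G : {group gT}) (S B : {set T}).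
Hypotheses (tG : [transitive G, on S | to]) (bB : block to G S B).
Hypotheses (IH : MN_lt gT #|S|) (B_gt1 : 1 < #|B|) (ltBS : #|B| < #|S|).
Implicit Types (X Y : {set T}) (N V A : {set gT}).

Local Notation P := (orbit to^* G B).
Local Notation C := 'C_G(S | to).
Local Notation U X := 'C_G(S :\: X | to).

Definition block_kernel := 'C_G(P | to^*)%G.
Local Notation K := block_kernel.

Let aG := atrans_acts tG.
Let partP := block_partition tG bB.

Lemma blocks_card : #|S| = (#|P| * #|B|)%N. Proof. exact: block_card. Qed.

Lemma blocks_gt1 : 1 < #|P|.
Proof. by move: ltBS; rewrite blocks_card; case: #|P| => [|[|k]] //; rewrite mul1n ltnn. Qed.

Lemma blocks_ltS : #|P| < #|S|.
Proof. by rewrite blocks_card -{1}[#|P|]muln1 ltn_pmul2l // ltnW // blocks_gt1. Qed.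

Lemma mem_blocks : B \in P. Proof. exact: (orbit_refl (to^*)%act). Qed.

Lemma blocks_sub X : X \in P -> X \subset S.
Proof. by case/orbitP=> g Gg <-; rewrite (setact_sub _ aG) // (block_sub bB). Qed.

Lemma blocks_cardX X : X \in P -> #|X| = #|B|.
Proof. by case/orbitP=> g _ <-; apply: card_setact. Qed.

Lemma blocks_trivI X Y : X \in P -> Y \in P -> X != Y -> [disjoint X & Y].
Proof. by case/and3P: partP => _ /trivIsetP tP _; apply: tP. Qed.

Lemma acts_blocks : [acts G, on P | to^*].
Proof. by apply: acts_orbit; apply: subsetT. Qed.

Lemma kernel_sub : K \subset G. Proof. exact: subsetIl. Qed.

Lemma kernel_normal : K <| G. Proof. exact: stab_normal acts_blocks. Qed.

Lemma kernel_acts X : X \in P -> [acts K, on X | to].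
Proof.
move=> PX; apply/subsetP => g /setIP[Gg /astabP Cg]; apply: astabs_setactI.
exact: Cg.
Qed.

Lemma kernelI g : g \in G -> (forall X, X \in P -> to^* X g = X) -> g \in K.
Proof. by move=> Gg Cg; apply/setIP; split=> //; apply/astabP. Qed.

Lemma fix_setact X g : g \in 'C(X | to) -> to^* X g = X.
Proof. by move=> Cg; apply: astabs_setact; apply: (subsetP (astab_sub _ _)). Qed.

Lemma out_kernel X : X \in P -> U X \subset K.
Proof.
move=> PX; apply/subsetP => g Ug; have /setIP[Gg Cg] := Ug; apply: kernelI => // Y PY.
have [->|neYX] := eqVneq Y X.
  apply: astabs_setact; apply: subsetP Ug; apply: acts_astab_out aG (blocks_sub PX).
apply: fix_setact; apply: subsetP Cg; apply: astabS.
by rewrite subsetD blocks_sub // blocks_trivI.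
Qed.

Lemma stab_kernel : C \subset K.
Proof.
apply/subsetP => g /setIP[Gg Cg]; apply: kernelI => // X PX; apply: fix_setact.
by apply: subsetP Cg; rewrite astabS // blocks_sub.
Qed.

Lemma kernel_stab : 'C_K(S | to) = C.
Proof.
apply/eqP; rewrite eqEsubset; apply/andP; split; first by rewrite setSI ?kernel_sub.
by rewrite subsetI stab_kernel subsetIr.
Qed.

Lemma kernel_out X : X \in P -> 'C_K(S :\: X | to) = U X.
Proof.
move=> PX; apply/eqP; rewrite eqEsubset; apply/andP; split; first by rewrite setSI ?kernel_sub.
by rewrite subsetI out_kernel // subsetIr.
Qed.

Lemma out_conj X g : g \in G -> U (to^* X g) = U X :^ g.
Proof. by move=> Gg; rewrite -(setact_setD aG) // stab_setact. Qed.

Lemma block_lifts : exists A, [/\ A \subset G, #|A| <= mn #|P| & G \subset <<A :|: K>>].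
Proof. by apply/dgenP; apply: IH acts_blocks blocks_ltS. Qed.

Lemma lifts_trans A X Y : A \subset G -> G \subset <<A :|: K>> -> X \in P -> Y \in P ->
  exists2 g, g \in <<A>> & to^* X g = Y.
Proof.
move=> sAG gA /orbitP[g Gg <-] /orbitP[h Gh <-].
have sMN : <<A>> \subset 'N(K).
  by apply: subset_trans (normal_norm kernel_normal); rewrite gen_subG.
have : g^-1 * h \in <<A>> * K.
  rewrite -(norm_joinEl sMN) joing_idl; apply: (subsetP gA).
  by rewrite groupM ?groupV.
case/mulsgP=> m k Mm /setIP[Gk /astabP Ck] e; exists m => //.
have Gm : m \in G by apply: subsetP Mm; rewrite gen_subG.
have Pgm : to^* (to^* B g) m \in P.
  by rewrite -[to^* _ m](actM (to^*)%act) (mem_orbit (to^*)%act) // groupM.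
have -> : h = g * m * k by rewrite -mulgA -e mulKVg.
rewrite -[LHS](Ck _ Pgm); apply/esym/(etrans (actM (to^*)%act _ _ _)).
by congr (to^* _ k); apply: (actM (to^*)%act).
Qed.

Lemma assemble A V c : A \subset G -> V \subset G -> G \subset <<A :|: K>> ->
  dgen c K (A :|: V :|: C) -> dgen (#|A| + #|V| + c) G C.
Proof.
move=> sAG sVG gA dK; apply: (dgenW (k := #|A :|: V| + c)).
  by rewrite leq_add2r leq_card_setU.
apply: dgen_add; first by rewrite subUset sAG.
rewrite -[c]add0n; apply: (dgen_transN kernel_sub _ dK).
by apply: dgen0; apply: subset_trans gA _; rewrite genS // setSU // subsetUl.
Qed.

(** The price of one more block: [Y] collects the points already fixed, and passing to elements that
    also fix [X] costs [c] beyond the free set [N]. *)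
Definition step_cost c N := forall X Y, X \in P -> Y \subset S -> [disjoint Y & X] ->
  [acts K, on Y | to] -> dgen c 'C_K(Y | to) (N :|: 'C_K(Y :|: X | to)).

Lemma cost_seq c N (Xs : seq {set T}) Y : step_cost c N -> uniq Xs -> {subset Xs <= P} ->
  Y \subset S -> [acts K, on Y | to] -> (forall X, X \in Xs -> [disjoint Y & X]) ->
  dgen (size Xs * c) 'C_K(Y | to) (N :|: 'C_K(Y :|: \bigcup_(X <- Xs) X | to)).
Proof.
move=> cN; elim: Xs Y => [|X Xs IHX] Y /=.
  move=> _ _ _ _ _; rewrite mul0n big_nil setU0; apply: dgen0.
  by rewrite sub_gen ?subsetUr.
case/andP=> nXX uXs sXs sYS aY dY; have PX : X \in P by rewrite sXs ?mem_head.
rewrite mulSn big_cons setUA.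
apply: dgen_transN (cN X Y PX sYS (dY X (mem_head _ _)) aY) _.
  by rewrite setIS // astabS ?subsetUl.
apply: IHX => //.
- by move=> Z Zs; apply: sXs; rewrite inE Zs orbT.
- by rewrite subUset sYS blocks_sub.
- by apply: actsU aY (kernel_acts PX).
move=> Z Zs; rewrite disjoints_subset subUset -!disjoints_subset dY ?inE ?Zs ?orbT //=.
apply: blocks_trivI => //.
  by apply: sXs; rewrite inE Zs orbT.
by apply: contraNneq nXX => ->.
Qed.

Lemma astab_set0 : 'C_K(set0 | to) = K.
Proof. by apply/setIidPl/subsetP => g _; apply/astabP => x; rewrite inE. Qed.

Lemma big_blocks : \bigcup_(X <- enum P) X = S.
Proof.
case/and3P: partP => /eqP cP _ _; rewrite -[RHS]cP /cover big_enum_cond /=.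
by apply: eq_bigl => X; rewrite andbT.
Qed.

Lemma cost_all c N : step_cost c N -> dgen (#|P| * c) K (N :|: C).
Proof.
move=> cN; have := cost_seq (Xs := enum P) (Y := set0) cN.
rewrite set0U big_blocks kernel_stab astab_set0 -cardE; apply.
- exact: enum_uniq.
- by move=> X; rewrite mem_enum.
- exact: sub0set.
- by apply/subsetP => g _; apply/astabsP => x; rewrite !inE.
by move=> X _; rewrite disjoints_subset sub0set.
Qed.

(** [B] is left to the end: once all other blocks are fixed, what remains is [U B], which is
    free. *)
Lemma cost_but_one c N : step_cost c N -> U B \subset <<N :|: C>> ->
  dgen (#|P|.-1 * c) K (N :|: C).
Proof.
move=> cN sUN; pose Xs := [seq X <- enum P | X != B].
have mXs X : X \in Xs -> X \in P /\ X != B.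
  by rewrite mem_filter mem_enum => /andP[].
have eXs : \bigcup_(X <- Xs) X = S :\: B.
  apply/setP => x; rewrite bigcup_seq; apply/bigcupP/setDP => [[X /mXs[PX neX] Xx]|[Sx nBx]].
    rewrite (subsetP (blocks_sub PX)) //; split=> //.
    by have /pred0P/(_ x) := blocks_trivI PX mem_blocks neX; rewrite /= Xx => /= ->.
  move: Sx; case/and3P: partP => /eqP cP _ _; rewrite -{1}cP => /bigcupP[X PX Xx].
  exists X => //; rewrite mem_filter mem_enum PX andbT.
  by apply: contraNneq nBx => <-.
have sXs : size Xs = #|P|.-1.
  have := size_filter (pred1 B) (enum P); have := size_filter (predC (pred1 B)) (enum P).
  have := count_predC (pred1 B) (enum P); rewrite -cardE.
  rewrite (count_uniq_mem B (enum_uniq _)) mem_enum mem_blocks /Xs.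
  have -> : [seq X <- enum P | X != B] = filter (predC (pred1 B)) (enum P) by [].
  by move=> <- -> _.
have := cost_seq (Xs := Xs) (Y := set0) cN.
rewrite set0U eXs (kernel_out mem_blocks) astab_set0 sXs => d.
apply: (dgenS _ (d _ _ _ _ _)).
- rewrite subUset sUN andbT; apply: subset_trans (subset_gen _); exact: subsetUl.
- exact/filter_uniq/enum_uniq.
- by move=> X /mXs[].
- exact: sub0set.
- by apply/subsetP => g _; apply/astabsP => x; rewrite !inE.
by move=> X _; rewrite disjoints_subset sub0set.
Qed.

Lemma sub_out_all A N X : A \subset G -> G \subset <<A :|: K>> -> A \subset N ->
  U B \subset <<N>> -> X \in P -> U X \subset <<N>>.
Proof.
move=> sAG gA sAN sUN PX; have [g Ag <-] := lifts_trans sAG gA mem_blocks PX.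
rewrite out_conj; last by apply: subsetP Ag; rewrite gen_subG.
have Ng : g \in <<N>> by apply: subsetP Ag; apply: genS.
by rewrite -(conjGid Ng) conjSg.
Qed.

Lemma step_plain : step_cost (mn #|B|) set0.
Proof.
move=> X Y PX sYS dYX aY; rewrite set0U -(blocks_cardX PX).
have aX : [acts 'C_K(Y | to), on X | to].
  exact: subset_trans (subsetIl _ _) (kernel_acts PX).
rewrite -subcent_astabU; apply: (IH (G := 'C_K(Y | to)%G)) => //.
by rewrite (blocks_cardX PX).
Qed.

(** [U X] is free, fixes [Y] and is transitive on [X], so only the stabilizer of one point of [X]
    has to be generated. The choice of [h] allows that point to be carried from [B] by a convenient
    element. *)
Lemma step_out c N x : x \in B -> (forall X, X \in P -> U X \subset <<N>>) ->
  [transitive U B, on B | to] ->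
  (forall g Y, g \in G -> Y \subset S -> [disjoint Y & to^* B g] -> [acts K, on Y | to] ->
    exists2 h, h \in G & to^* B h = to^* B g /\
    dgen c 'C_('C_K(Y | to))[to x h | to] (N :|: 'C_K(Y :|: to^* B g | to))) ->
  step_cost c N.
Proof.
move=> Bx sUN tU cN X0 Y /orbitP[g Gg /= e]; rewrite -{X0}e => sYS dYX aY.
have [h Gh [eX dh]] := cN g Y Gg sYS dYX aY; rewrite -{}eX in dYX dh *.
set X := to^* B h in dYX dh *; set z := to x h in dh.
have PX : X \in P by apply: (mem_orbit (to^*)%act).
have Xz : z \in X by apply: mem_setact.
have sUK : U X \subset 'C_K(Y | to).
  rewrite subsetI out_kernel //=; apply: subset_trans (subsetIr _ _) _; apply: astabS.
  by rewrite subsetD sYS.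
apply: (dgen_transN (K := 'C_('C_K(Y | to))[z | to]) (k := 0) (subsetIl _ _) _ dh).
apply: dgen0; apply/subsetP => k Kk; have /setIP[KKk _] := Kk.
have Xzk : to z k \in X by rewrite (mem_act _ (kernel_acts PX)).
have tX : [transitive U X, on X | to].
  apply: (atransI Xz) => [|w]; first exact: acts_astab_out (blocks_sub PX).
  case/setactP=> y By ->; have [u Uu <-] := atransE tU Bx By.
  exists (u ^ h); last by rewrite -actCJ.
  by rewrite /= out_conj // memJ_conjg.
have [u Uu uz] := atransE tX Xz Xzk.
have Nu : u \in <<N :|: 'C_('C_K(Y | to))[z | to]>>.
  by apply: subsetP Uu; apply: subset_trans (sUN X PX) _; rewrite genS ?subsetUl.
have -> : k = k * u^-1 * u by rewrite mulgKV.
rewrite groupM // mem_gen //; apply/setUP; right; apply/setIP; split.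
  by rewrite groupM // groupV (subsetP sUK).
by apply/astab1P; rewrite actM -uz actK.
Qed.

Lemma out_gens k : dgen k (U B) C -> exists V, [/\ V \subset G, #|V| <= k & U B \subset <<V :|: C>>].
Proof.
case/dgenP=> V [sV lV gV]; exists V; split=> //; exact: subset_trans sV (subsetIl _ _).
Qed.

Lemma dgen_blocks_out V c x : V \subset G -> x \in B -> U B \subset <<V :|: C>> ->
  [transitive U B, on B | to] ->
  (forall A g Y, A \subset G -> G \subset <<A :|: K>> -> g \in G -> Y \subset S ->
    [disjoint Y & to^* B g] -> [acts K, on Y | to] ->
    (forall X, X \in P -> U X \subset <<A :|: V :|: C>>) ->
    exists2 h, h \in G & to^* B h = to^* B g /\
    dgen c 'C_('C_K(Y | to))[to x h | to] (A :|: V :|: C :|: 'C_K(Y :|: to^* B g | to))) ->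
  dgen (mn #|P| + #|V| + #|P|.-1 * c) G C.
Proof.
move=> sVG Bx sUV tU cN; have [A [sAG lA gA]] := block_lifts.
have sUN : U B \subset <<A :|: V :|: C>>.
  by apply: subset_trans sUV _; rewrite genS // setSU // subsetUr.
have sUX X : X \in P -> U X \subset <<A :|: V :|: C>>.
  by apply: (sub_out_all sAG gA) => //; rewrite -setUA subsetUl.
apply: dgenW (assemble sAG sVG gA (c := #|P|.-1 * c) _); first by rewrite !leq_add2r.
rewrite -[C]setUid setUA; apply: cost_but_one; last by rewrite -setUA setUid.
by apply: (step_out Bx sUX tU) => g Y Gg sYS dY aY; apply: cN.
Qed.

End Imprimitive.

(** A known element outside [D] halves the index before the doubling chain starts. *)
Lemma dgen_index_half (gT : finGroupType) (Y W D : {group gT}) m :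
  D \subset W -> W \subset Y -> ~~ (W \subset D) -> #|Y : D| <= m ->
  dgen (trunc_log 2 m./2) Y W.
Proof.
move=> sDW sWY nWD le; apply: dgenW (dgen_log sWY); apply: leq_trunc_log.
have := Lagrange_index sWY sDW; have : 1 < #|W : D| by rewrite indexg_gt1.
by case: #|W : D| => [|[|k]] // _; move: le; nia.
Qed.

(** * Costs for the various kinds of blocks *)

Section BlockBounds.
Variables (gT : finGroupType) (T : finType) (to : {action gT &-> T}).
Variables (G : {group gT}) (S B : {set T}).
Hypotheses (tG : [transitive G, on S | to]) (bB : block to G S B).
Hypotheses (IH : MN_lt gT #|S|) (B_gt1 : 1 < #|B|) (ltBS : #|B| < #|S|).
Implicit Types (X Y : {set T}) (N V A : {set gT}).

Local Notation P := (orbit to^* G B).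
Local Notation C := 'C_G(S | to).
Local Notation U X := 'C_G(S :\: X | to).
Local Notation K := (block_kernel to G B).

Let aG := atrans_acts tG.
Let sBS := block_sub bB.

Lemma dgen_blocks_plain : dgen (mn #|P| + #|P| * mn #|B|) G C.
Proof.
have [A [sAG lA gA]] := block_lifts tG bB IH B_gt1 ltBS.
have := cost_all tG bB (step_plain IH ltBS); rewrite set0U => dK.
apply: dgenW (assemble sAG (sub0set _) gA (dgenS _ dK)).
  by rewrite cards0 addn0 leq_add2r.
by rewrite sub_gen ?subsetUr.
Qed.

Lemma out_stab : 'C_(U B)(B | to) = C.
Proof. by rewrite subcent_astabU setDU_sub. Qed.

Lemma out_acts : [acts U B, on B | to].
Proof. exact: acts_astab_out. Qed.

Lemma out_dgen : dgen (mn #|B|) (U B) C.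
Proof. by rewrite -out_stab; apply: (IH (G := 'C_G(S :\: B | to)%G)) => //; apply: out_acts. Qed.

Lemma block_point_stab Y g x : g \in G -> x \in B ->
  [acts 'C_('C_K(Y | to))[to x g | to], on to^* B g :\ to x g | to] /\
  'C_('C_('C_K(Y | to))[to x g | to])(to^* B g :\ to x g | to) = 'C_K(Y :|: to^* B g | to).
Proof.
move=> Gg Bx; have PX : to^* B g \in P by apply: (mem_orbit (to^*)%act).
split; last by rewrite (astab_eq1 to 'C_K(Y | to)%G) ?mem_setact // subcent_astabU.
apply: (acts_stab1 (G := 'C_K(Y | to)%G)).
exact: subset_trans (subsetIl _ _) (kernel_acts PX).
Qed.

Lemma card_block_point g x : x \in B -> #|to^* B g :\ to x g| = #|B|.-1.
Proof.
by move=> Bx; have := cardsD1 (to x g) (to^* B g); rewrite mem_setact // card_setact => ->.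
Qed.

Lemma dgen_blocks_out_gen k : dgen k (U B) C -> [transitive U B, on B | to] ->
  dgen (mn #|P| + k + #|P|.-1 * mn #|B|.-1) G C.
Proof.
move=> dU tU; have [V [sVG lV sUV]] := out_gens dU.
have [x Bx _] := block_mem bB.
apply: dgenW (dgen_blocks_out (c := mn #|B|.-1) tG bB IH B_gt1 ltBS sVG Bx sUV tU _).
  by rewrite leq_add2r leq_add2l.
move=> A g Y sAG gA Gg sYS dYX aY sUN; exists g => //; split=> //.
have [aY1 eY1] := block_point_stab Y Gg Bx.
rewrite -eY1 -(card_block_point g Bx); apply: dgenS (IH (G := 'C_('C_K(Y | to))[to x g | to]%G) aY1 _).
  by rewrite sub_gen // subsetUr.
by rewrite card_block_point //; move: B_gt1 ltBS; nlia.
Qed.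

(** The conjugate [t ^ g] is a free element of the point stabilizer in the block at hand, nontrivial
    there, and halves the index that is left. *)
Lemma step_nonregular m x t N Y g : g \in G -> x \in B -> t \in U B -> to x t = x ->
  t \notin 'C(B | to) -> U (to^* B g) \subset <<N>> -> Y \subset S -> [disjoint Y & to^* B g] ->
  (forall (Y1 : {group gT}) X, [acts Y1, on X | to] -> #|X| = #|B|.-1 -> #|Y1 : 'C_Y1(X | to)| <= m) ->
  dgen (trunc_log 2 m./2) 'C_('C_K(Y | to))[to x g | to] (N :|: 'C_K(Y :|: to^* B g | to)).
Proof.
move=> Gg Bx Ut tx nCt sUN sYS dYX le_m; set X := to^* B g in sUN dYX *; set z := to x g.
have PX : X \in P by apply: (mem_orbit (to^*)%act).
have [aY1 eY1] := block_point_stab Y Gg Bx.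
set Y1 := 'C_('C_K(Y | to))[z | to]%G in aY1 eY1; set D := 'C_Y1(X :\ z | to)%G.
have sUK : U X \subset 'C_K(Y | to).
  rewrite subsetI (out_kernel tG bB) //=; apply: subset_trans (subsetIr _ _) _; apply: astabS.
  by rewrite subsetD sYS.
have Utg : t ^ g \in U X by rewrite (out_conj tG) // memJ_conjg.
have tgz : to z (t ^ g) = z by rewrite -actCJ tx.
have Y1t : t ^ g \in Y1 by apply/setIP; split; [apply: (subsetP sUK) | apply/astab1P].
have nDt : t ^ g \notin D.
  apply: contra nCt => /setIP[_ /astabP Cg]; apply/astabP => w Bw.
  have [->//|newx] := eqVneq w x; apply: (@act_inj _ _ _ to g).
  rewrite actCJ Cg // in_setD1 mem_setact // andbT.
  by rewrite (inj_eq (act_inj _ _)).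
pose W := <<t ^ g |: D>>%G.
have d : dgen (trunc_log 2 m./2) Y1 W.
  apply: (@dgen_index_half _ _ _ D).
  - by rewrite sub_gen ?subsetUr.
  - by rewrite gen_subG subUset sub1set Y1t subsetIl.
  - by apply/subsetPn; exists (t ^ g) => //; rewrite mem_gen ?setU11.
  by apply: le_m aY1 _; rewrite card_block_point.
rewrite -eY1; apply: dgenS d; rewrite /W /= gen_subG subUset sub1set.
rewrite [in X in _ && X]sub_gen ?subsetUr // andbT.
by apply: subsetP Utg; apply: subset_trans sUN _; rewrite genS ?subsetUl.
Qed.

Lemma dgen_blocks_nonregular m x t : x \in B -> t \in U B -> to x t = x -> t \notin 'C(B | to) ->
  [transitive U B, on B | to] ->
  (forall (Y1 : {group gT}) X, [acts Y1, on X | to] -> #|X| = #|B|.-1 -> #|Y1 : 'C_Y1(X | to)| <= m) ->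
  dgen (mn #|P| + mn #|B| + #|P|.-1 * trunc_log 2 m./2) G C.
Proof.
move=> Bx Ut tx nCt tU le_m; have [V [sVG lV sUV]] := out_gens out_dgen.
apply: dgenW (dgen_blocks_out (c := trunc_log 2 m./2) tG bB IH B_gt1 ltBS sVG Bx sUV tU _).
  by rewrite leq_add2r leq_add2l.
move=> A g Y sAG gA Gg sYS dYX aY sUN; exists g => //; split=> //.
by apply: step_nonregular Ut tx nCt _ _ _ _ => //; apply: sUN; apply: (mem_orbit (to^*)%act).
Qed.

Lemma kernel_cycle_conj (v : gT) X g w : g \in G -> v \in K -> orbit to <[v]> w = X ->
  v ^ g \in K /\ orbit to <[v ^ g]> (to w g) = to^* X g.
Proof.
move=> Gg Kv <-; split; last by rewrite setact_orbit cycleJ.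
by rewrite memJ_norm // (subsetP (normal_norm (kernel_normal to G B))).
Qed.

Lemma out_normal : U B <| 'N_G(B | to).
Proof.
have aN : [acts 'N_G(B | to), on S :\: B | to].
  by apply: actsD; [exact: subset_trans (subsetIl _ _) aG | exact: subsetIr].
have -> : U B = 'C_('N_G(B | to))(S :\: B | to).
  apply/eqP; rewrite eqEsubset; apply/andP; split; last by rewrite setSI ?subsetIl.
  by rewrite subsetI subsetIr andbT subsetI subsetIl; exact: out_acts.
exact: (stab_normal (G := 'N_G(B | to)%G) aN).
Qed.

Lemma out_trans_prime : prime #|B| -> ~~ (U B \subset 'C(B | to)) ->
  [transitive U B, on B | to].
Proof. exact: normal_trans_prime (block_stab_trans tG bB) out_normal. Qed.

(** The exceptional cost 2 of a block of 3 points has to come down to an average of one per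
    block. *)
Lemma dgen_blocks3 : #|B| = 3 -> dgen (mn #|P| + #|P|) G C.
Proof.
move=> B3; have [x Bx Sx] := block_mem bB.
have P_gt1 := blocks_gt1 tG bB ltBS.
have [A [sAG lA gA]] := block_lifts tG bB IH B_gt1 ltBS.
have sAN g : g \in <<A>> -> g \in G by apply: subsetP; rewrite gen_subG.
have nK := kernel_normal to G B.
have tN := block_stab_trans tG bB.
have sKN : K \subset 'N_G(B | to).
  by rewrite subsetI kernel_sub kernel_acts // mem_blocks.
have [sKC|nKC] := boolP (K \subset 'C(B | to)).
  have sK : K \subset C.
    rewrite subsetI kernel_sub; apply/subsetP => k Kk; apply/astabP => w Sw.
    have [g Gg <-] := atransE tG Sx Sw.
    have /(subsetP sKC)/astabP/(_ x Bx) e : k ^ g^-1 \in K.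
      by rewrite memJ_norm // groupV (subsetP (normal_norm nK)).
    by rewrite actCJV e.
  apply: (dgenW (k := mn #|P| + 0)); first by rewrite leq_add2l.
  apply: (dgen_trans (kernel_sub to G B)).
    by apply/dgenP; exists A.
  by apply: dgen0; apply: subset_trans sK (subset_gen _).
have tK : [transitive K, on B | to].
  apply: (normal_trans_prime tN) nKC; rewrite ?B3 //.
  by apply: normalS nK => //; apply: subsetIl.
have [v Kv oB] := prime_cycle tK Bx ltac:(by rewrite B3).
(* If [U B] is trivial, the 3-cycle [v] is added; its conjugates under [<<A>>] are cycles on the
   other blocks and lower the cost of each to one, while [B] costs nothing. *)
have [sUC|nUC] := boolP (U B \subset 'C(B | to)).
  have sUC' : U B \subset C by rewrite -out_stab subsetI subxx.
  have sV : [set v] \subset G by rewrite sub1set (subsetP (kernel_sub to G B)).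
  apply: (dgenW (k := #|A| + #|[set v]| + #|P|.-1 * 1)).
    by rewrite cards1; move: lA P_gt1; nlia.
  apply: (assemble sAG sV gA); set N := A :|: [set v].
  apply: (cost_but_one tG bB); last by apply: subset_trans sUC' _; rewrite sub_gen ?subsetUr.
  move=> X Y PX sYS dYX aY.
  have [g Ag eX] := lifts_trans sAG gA (mem_blocks to G B) PX.
  have [Kvg oX] := kernel_cycle_conj (sAN g Ag) Kv oB; rewrite eX in oX.
  have aX : [acts 'C_K(Y | to), on X | to].
    exact: subset_trans (subsetIl _ _) (kernel_acts PX).
  have Nvg : v ^ g \in 'N('C_K(Y | to)).
    by apply: subsetP Kvg; apply: normal_norm; apply: stab_normal.
  have := dgen_three (Y := 'C_K(Y | to)%G) aX ltac:(by rewrite (blocks_cardX PX)) _ Nvg oX.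
  rewrite /= subcent_astabU => d; apply: dgenS (d _); last by rewrite -eX mem_setact.
  rewrite subUset sub1set [in X in _ && X]sub_gen ?subsetUr // andbT.
  have sNN : <<N>> \subset <<N :|: 'C_K(Y :|: X | to)>> by rewrite genS ?subsetUl.
  apply: (subsetP sNN); apply: groupJ; first by rewrite mem_gen // !inE eqxx orbT.
  by apply: subsetP Ag; rewrite genS ?subsetUl.
have tU := out_trans_prime ltac:(by rewrite B3) nUC.
(* If [U B] is regular on [B], it costs one element and every other block one more; if not, it costs
   two and the other blocks nothing. *)
have [sUC|/subsetPn[t /setIP[Ut /astab1P tx] nCt]] := boolP ('C_(U B)[x | to] \subset 'C(B | to)).
  have := dgen1_stab (Y := 'C_G(S :\: B | to)%G) out_acts ltac:(by rewrite B3) Bx sUC.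
  rewrite /= out_stab => /dgen_blocks_out_gen/(_ tU); apply: dgenW.
  by rewrite B3 -[mn 3.-1]/1%N muln1 -addnA leq_add2l add1n prednK // ltnW.
apply: dgenW (dgen_blocks_nonregular (m := 2) Bx Ut tx nCt tU _).
  by rewrite B3 -[mn 3]/2 -[trunc_log _ _]/0 muln0 addn0 leq_add2l.
move=> Y1 X aX; rewrite B3 /= => cX.
have [z Xz] : exists z, z \in X by apply/card_gt0P; rewrite cX.
rewrite -cX; apply: (index_stab_le aX Xz); apply/subsetP => p /setIP[Yp /astab1P pz].
apply/astabP => w Xw; have [->//|newz] := eqVneq w z.
have W1 : w \in X :\ z by rewrite in_setD1 newz.
have W2 : to w p \in X :\ z.
  by rewrite in_setD1 (mem_act _ aX) // Xw -{1}pz (inj_eq (act_inj _ _)) newz.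
by apply: card_le1_eq W2 W1; have := cardsD1 z X; rewrite Xz cX; nlia.
Qed.

(** [dgen_blocks_out_gen] would charge [mn 3 = 2] for every block but one; here the charge is
    one. *)
Lemma dgen_blocks4 : #|B| = 4 -> [transitive U B, on B | to] ->
  dgen (mn #|P| + 2 + #|P|.-1) G C.
Proof.
move=> B4 tU; have [x Bx Sx] := block_mem bB.
have [sUC|/subsetPn[t /setIP[Ut /astab1P tx] nCt]] := boolP ('C_(U B)[x | to] \subset 'C(B | to));
    last first.
  apply: dgenW (dgen_blocks_nonregular (m := 6) Bx Ut tx nCt tU _); first by rewrite B4 muln1.
  by move=> Y1 X aX; rewrite B4 => cX; apply: index_three.
have cBx : #|B :\ x| = 3 by have := cardsD1 x B; rewrite Bx B4; nlia.
(* [U B] is now regular on [B]. Without a 3-cycle in the stabilizers, one element per block suffices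
   by [three_cycle_or]. Given such a [v], the conjugates of one [u] in [U B] by powers of [v] take
   [x] to each of the three other points, so [v] and [u] generate [U B] modulo [C]; conjugates of
   [v] then serve the other blocks through [dgen_three]. *)
have [/exists_inP[v Kv /exists_inP[w Bw /eqP ow]]|] :=
  boolP [exists v in 'C_K[x | to], exists w in B :\ x, orbit to <[v]> w == B :\ x]; last first.
  rewrite negb_exists_in => /forall_inP no3; have [V [sVG lV sUV]] := out_gens out_dgen.
  apply: dgenW (dgen_blocks_out (c := 1) tG bB IH B_gt1 ltBS sVG Bx sUV tU _).
    by rewrite muln1 leq_add2r leq_add2l (leq_trans lV) // B4.
  move=> A g Y sAG gA Gg sYS dYX aY sUN; exists g => //; split=> //.
  have [aY1 eY1] := block_point_stab Y Gg Bx; have cX := card_block_point g Bx.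
  have [z Xz] : exists z, z \in to^* B g :\ to x g by apply/card_gt0P; rewrite cX B4.
  rewrite -eY1; have [|[v Y1v ov]] :=
    three_cycle_or (Y := 'C_('C_K(Y | to))[to x g | to]%G) aY1 ltac:(by rewrite cX B4) Xz.
    by apply: dgenS; rewrite sub_gen ?subsetUr.
  have /setIP[/setIP[Kv _] /astab1P vx] := Y1v; have Gg' : g^-1 \in G by rewrite groupV.
  have [Kv' ov'] := kernel_cycle_conj Gg' Kv ov.
  have /no3/negP[] : v ^ g^-1 \in 'C_K[x | to].
    by apply/setIP; split=> //; apply/astab1P; rewrite -{1}[x](actK to g) -actCJ vx actK.
  have eB : to^* (to^* B g :\ to x g) g^-1 = B :\ x.
    apply/setP => y; rewrite mem_setactV invgK !in_setD1 mem_setactV actK.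
    by rewrite (inj_eq (act_inj _ _)).
  apply/exists_inP; exists (to z g^-1); last by rewrite ov' eB.
  by rewrite -eB mem_setact.
have /setIP[Kv' /astab1P vx] := Kv; have /setD1P[newx Bw'] := Bw.
have [u Uu ux] := atransE tU Bx Bw'; have /setIP[Gu _] := Uu.
have Gv := subsetP (kernel_sub to G B) v Kv'.
pose V := [set v; u].
have sVG : V \subset G by rewrite subUset !sub1set Gv.
have NUv : v \in 'N(U B).
  have aK : [acts K, on S :\: B | to].
    apply: actsD; last exact/kernel_acts/mem_blocks.
    exact: subset_trans (kernel_sub to G B) aG.
  have := stab_normal aK; rewrite (kernel_out tG bB) ?mem_blocks // => /normal_norm/subsetP.
  exact.
have sUV : U B \subset <<V :|: C>>.
  have [Lv Lu] : v \in <<V :|: C>> /\ u \in <<V :|: C>> by rewrite !mem_gen // !inE eqxx ?orbT.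
  have sCL : C \subset <<V :|: C>> by rewrite sub_gen ?subsetUr.
  have fix_C p : p \in U B -> to x p = x -> p \in <<V :|: C>>.
    move=> Up px; apply: (subsetP sCL); rewrite -out_stab; apply/setIP; split=> //.
    by apply: (subsetP sUC); apply/setIP; split=> //; apply/astab1P.
  apply/subsetP => p Up; have Bxp : to x p \in B by rewrite (mem_act _ out_acts).
  have [px|nepx] := eqVneq (to x p) x; first exact: fix_C.
  have /orbitP[y vy yw] : to x p \in orbit to <[v]> w by rewrite ow in_setD1 nepx.
  have Ly : y \in <<V :|: C>> by apply: subsetP vy; rewrite cycle_subG.
  have yx : to x y = x.
    by apply/astab1P; apply: subsetP vy; rewrite cycle_subG; apply/astab1P.
  have Uuy : u ^ y \in U B.
    by rewrite memJ_norm //; apply: subsetP vy; rewrite cycle_subG.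
  have -> : p = p * (u ^ y)^-1 * u ^ y by rewrite mulgKV.
  rewrite groupM //; last by rewrite groupJ.
  apply: fix_C; first by rewrite groupM ?groupV.
  by rewrite actM -yw -ux [to (to x u) y]actCJ yx actK.
apply: dgenW (dgen_blocks_out (c := 1) tG bB IH B_gt1 ltBS sVG Bx sUV tU _).
  by rewrite muln1 leq_add2r leq_add2l cards2; case: (_ != _).
move=> A g Y sAG gA Gg sYS dYX aY sUN.
have PX : to^* B g \in P by apply: (mem_orbit (to^*)%act).
have [h Ah eX] := lifts_trans sAG gA (mem_blocks to G B) PX.
have Gh : h \in G by apply: subsetP Ah; rewrite gen_subG.
exists h => //; split=> //; rewrite -eX in PX *.
have [aY1 eY1] := block_point_stab Y Gh Bx; have cX := card_block_point h Bx.
have [Kvh ovh] := kernel_cycle_conj Gh Kv' ow.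
have eBh : to^* (B :\ x) h = to^* B h :\ to x h.
  apply/setP => y; rewrite mem_setactV !in_setD1 mem_setactV; congr (~~ _ && _).
  by rewrite -(inj_eq (@act_inj _ _ _ to h)) actKV.
rewrite eBh in ovh.
have vxh : to (to x h) (v ^ h) = to x h by rewrite -actCJ vx.
have Nvh : v ^ h \in 'N('C_('C_K(Y | to))[to x h | to]).
  apply/normP; rewrite conjIg -astab1_act vxh; congr (_ :&: _).
  apply/normP; apply: subsetP Kvh; apply: normal_norm; exact: stab_normal.
have Xw : to w h \in to^* B h :\ to x h by rewrite -eBh mem_setact.
rewrite -eY1; apply: dgenS (dgen_three (Y := 'C_('C_K(Y | to))[to x h | to]%G) aY1 _ Xw Nvh ovh);
  last by rewrite cX B4.
rewrite subUset sub1set [in X in _ && X]sub_gen ?subsetUr // andbT.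
have sNN D : <<A :|: V :|: C>> \subset <<A :|: V :|: C :|: D>> by rewrite genS ?subsetUl.
apply: (subsetP (sNN _)); apply: groupJ; first by rewrite mem_gen // !inE eqxx ?orbT.
by apply: subsetP Ah; rewrite genS // -setUA subsetUl.
Qed.

End BlockBounds.

Lemma card_set3 (T : finType) (a b c : T) : a != b -> a != c -> b != c -> #|[set a; b; c]| = 3.
Proof. by move=> ab ac bc; rewrite setUC cardsU1 !inE negb_or eq_sym ac eq_sym bc cards2 ab. Qed.

Section Index.
Variable gT : finGroupType.
Implicit Types (H L W : {group gT}).

Lemma index_meet_le H L W : H \subset W -> #|H : H :&: L| <= #|W : L|.
Proof. by move=> sHW; rewrite indexgI subset_leq_card // imsetS. Qed.

Lemma indexJg H L (a : gT) : L \subset H -> #|H :^ a : L :^ a| = #|H : L|.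
Proof. by move=> sLH; rewrite -!divgS ?conjSg // !cardJg. Qed.

Lemma trunc_log2M3 a b c : 0 < a -> 0 < b -> 0 < c ->
  trunc_log 2 a + trunc_log 2 b + trunc_log 2 c <= trunc_log 2 (a * b * c).
Proof.
move=> a0 b0 c0; apply: trunc_log_max => //; rewrite !expnD.
by rewrite !leq_mul // trunc_logP.
Qed.

End Index.

(** * Systems of three blocks *)

Section ThreeBlocks.
Variables (gT : finGroupType) (T : finType) (to : {action gT &-> T}).
Variables (G : {group gT}) (S B : {set T}).
Hypotheses (tG : [transitive G, on S | to]) (bB : block to G S B).
Hypotheses (IH : MN_lt gT #|S|) (B_gt1 : 1 < #|B|) (ltBS : #|B| < #|S|).

Local Notation P := (orbit to^* G B).
Local Notation C := 'C_G(S | to).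
Local Notation U X := 'C_G(S :\: X | to).
Local Notation K := (block_kernel to G B).

Hypothesis (P3 : #|P| = 3).
Let aG := atrans_acts tG.

Lemma three_blocks_cycle (A : {set gT}) : A \subset G -> G \subset <<A :|: K>> ->
  exists2 a, a \in <<A>> & exists2 X, to^* B a = X & exists2 Y, to^* X a = Y &
  [/\ X \in P, Y \in P, to^* Y a = B, S :\: B = X :|: Y & S :\: X = Y :|: B].
Proof.
move=> sAG gA; have sMG : <<A>> \subset G by rewrite gen_subG.
have PB := mem_blocks to G B.
have aP : [acts <<A>>, on P | to^*] by apply: subset_trans sMG (acts_blocks to G B).
have tP : [transitive <<A>>, on P | to^*].
  apply: (@atransI _ _ (to^*)%act <<A>>%G P B PB aP) => Y PY; exact: (lifts_trans sAG gA PB PY).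
have [a Aa oP] := prime_cycle tP PB ltac:(by rewrite P3).
have Pa Z : Z \in P -> to^* Z a \in P.
  by move=> PZ; have := acts_act aP Aa Z; rewrite PZ.
have inj_a : injective (fun Z : {set T} => to^* Z a) by apply: (act_inj (to^*)%act).
pose X := to^* B a; pose Y := to^* X a.
have [PX PY] : X \in P /\ Y \in P by rewrite !Pa.
have cyc (Q : {set {set T}}) : B \in Q -> (forall Z, Z \in Q -> to^* Z a \in Q) -> P \subset Q.
  move=> QB Qa; rewrite -oP; apply/subsetP => _ /orbitP[_ /cycleP[i ->] <-].
  by elim: i => [|i IHi]; rewrite ?expg0 ?(act1 (to^*)%act) // expgSr (actM (to^*)%act) Qa.
have small (Q : {set {set T}}) : P \subset Q -> 3 <= #|Q| by rewrite -P3; apply: subset_leq_card.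
have neXB : X != B.
  apply/eqP => e; have /small : P \subset [set B]; last by rewrite cards1.
  by apply: cyc; rewrite ?set11 // => Z /set1P->; rewrite -[X in _ \in [set X]]e set11.
have neYX : Y != X by apply: contra neXB => /eqP/inj_a->.
have neYB : Y != B.
  apply/eqP => e; have /small : P \subset [set B; X]; last by rewrite cards2; case: (_ != _).
  by apply: cyc; rewrite ?set21 // => Z /set2P[->|->]; rewrite ?set22 // -/Y e set21.
have eP : P = [set B; X; Y].
  apply/esym/eqP; rewrite eqEcard P3 !subUset !sub1set PB PX PY /=.
  by rewrite card_set3 // eq_sym.
have Ya : to^* Y a = B.
  have := Pa Y PY; rewrite {1}eP !inE => /orP[/orP[/eqP//|/eqP e]|/eqP e].
    by move: neYB; rewrite -(inj_eq inj_a) e eqxx.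
  by move: neYX; rewrite -(inj_eq inj_a) e eqxx.
have partP := block_partition tG bB; have /and3P[/eqP cP _ _] := partP.
have eS : S = B :|: X :|: Y.
  by rewrite -{1}cP eP /cover !bigcup_setU !big_set1.
have D3 Z1 Z2 Z3 : Z1 \in P -> Z2 \in P -> Z3 \in P -> Z1 != Z2 -> Z1 != Z3 ->
    S = Z1 :|: (Z2 :|: Z3) -> S :\: Z1 = Z2 :|: Z3.
  move=> P1 P2 P3' n12 n13 ->; rewrite setDUl setDv set0U; apply/setDidPl.
  rewrite disjoints_subset subUset -!disjoints_subset.
  by rewrite !(blocks_trivI tG bB) // eq_sym.
exists a => //; exists X => //; exists Y => //; split=> //.
  by apply: D3; rewrite // 1?eq_sym // setUA.
by apply: D3; rewrite // 1?eq_sym // eS -setUA setUCA [B :|: Y]setUC.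
Qed.

(** [dgen_blocks3] would give 5. The kernels fixing two, one and no blocks form a chain, and
    conjugates under the cycle [a] of the blocks are free. What they generate absorbs so much of
    each index that the three logarithms together stay below that of one index, at most 6. *)
Lemma dgen_blocks33 : #|B| = 3 -> dgen 4 G C.
Proof.
move=> B3; have [A [sAG lA gA]] := block_lifts tG bB IH B_gt1 ltBS.
have [a Aa [X eX [Y eY [PX PY Ya eSB eSX]]]] := three_blocks_cycle sAG gA.
have PB := mem_blocks to G B.
have nK := kernel_normal to G B; have sMG : <<A>> \subset G by rewrite gen_subG.
have Ga := subsetP sMG a Aa.
have KJ Z : 'C_K(to^* Z a | to) = 'C_K(Z | to) :^ a.
  have /normsP nKa := normal_norm nK.
  by rewrite astab_setact -{1}(nKa a Ga) -conjIg.
pose L1 := 'C_K(X :|: Y | to)%G; pose L2 := 'C_K(Y | to)%G.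
have sL12 : L1 \subset L2 by rewrite setIS // astabS ?subsetUr.
have sL2K : L2 \subset K by apply: subsetIl.
have eL1a : L1 :^ a = 'C_K(Y :|: B | to).
  by rewrite -KJ; congr ('C_K(_ | to)); rewrite /setact imsetU -/(setact to X a) -/(setact to Y a) eY Ya.
have eL2a : L2 :^ a = 'C_K(B | to) by rewrite -KJ Ya.
have sL12a : L1 :^ a \subset L2 by rewrite eL1a setIS // astabS ?subsetUl.
have sL2aK : L2 :^ a \subset K by rewrite eL2a subsetIl.
have eS : S = B :|: (X :|: Y) by rewrite -eSB setUC setDU_sub ?(block_sub bB).
have eC1 : L1 :^ a :&: L1 = C.
  rewrite eL1a /L1 /= -setIIr -astabU -(kernel_stab tG bB); congr ('C_K(_ | to)).
  by apply/setP => z; rewrite eS !inE; case: (z \in B); case: (z \in X); case: (z \in Y).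
have eL12 : L2 :^ a :&: L2 = L1 :^ a.
  by rewrite eL2a eL1a /L2 /= -setIIr -astabU setUC.
have sCL1 : C \subset L1.
  by rewrite -(kernel_stab tG bB) setIS // astabS // eS subsetUr.
pose W2 := (L1 <*> (L1 :^ a))%G; pose W3 := (L2 <*> (L2 :^ a))%G.
have sW2 : W2 \subset L2 by rewrite join_subG sL12.
have sW3 : W3 \subset K by rewrite join_subG sL2K.
have sL1W : L1 \subset W2 by apply: joing_subl.
have sL2W : L2 \subset W3 by apply: joing_subl.
(* [L1 :^ a] meets [L1] in [C], so adjoining it enlarges [L1] at least by the factor [#|L1 : C|];
   [i3] is the same argument for [L2]. *)
have i2 : #|L1 : C| <= #|W2 : L1|.
  have <- : #|L1 :^ a : C| = #|L1 : C|.
    have nCa : C :^ a = C by have /normsP := normal_norm (stab_normal aG); apply.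
    by rewrite -{1}nCa (indexJg (L := 'C_G(S | to)%G)).
  by rewrite -eC1; apply: (index_meet_le (H := (L1 :^ a)%G)); apply: joing_subr.
have i3 : #|L2 : L1| <= #|W3 : L2|.
  rewrite -(indexJg a sL12) -eL12; apply: (index_meet_le (H := (L2 :^ a)%G)).
  exact: joing_subr.
have i6 : #|K : L2| <= 6 by apply: index_three; rewrite ?(blocks_cardX PY) // kernel_acts.
have := Lagrange_index sW3 sL2W; have := Lagrange_index sW2 sL1W => e2 e3.
have sNL L : <<A>> \subset <<A :|: L>> by rewrite genS ?subsetUl.
have conjN (L : {group gT}) : L :^ a \subset <<A :|: L>>.
  have NLa : a \in <<A :|: L>> by apply: (subsetP (sNL L)).
  by rewrite -(conjGid NLa) conjSg sub_gen ?subsetUr.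
have d1 : dgen (trunc_log 2 #|L1 : C|) L1 (A :|: C).
  apply: dgenS (dgen_log (H := 'C_G(S | to)%G) sCL1).
  by rewrite sub_gen ?subsetUr.
have d2 : dgen (trunc_log 2 #|L2 : W2|) L2 (A :|: L1).
  apply: dgenS (dgen_log sW2); rewrite /= join_subG conjN andbT.
  by rewrite sub_gen ?subsetUr.
have d3 : dgen (trunc_log 2 #|K : W3|) K (A :|: L2).
  apply: dgenS (dgen_log sW3); rewrite /= join_subG conjN andbT.
  by rewrite sub_gen ?subsetUr.
have dK := dgen_transN sL2K d3 (dgen_transN sL12 d2 d1).
have := assemble sAG (sub0set G) gA; rewrite setU0 => d; apply: dgenW (d _ _ dK).
rewrite cards0 addn0 -[4]/(2 + 2); apply: leq_add; first by rewrite P3 in lA.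
rewrite addnA; apply: leq_trans (trunc_log2M3 _ _ _) _; try exact: indexg_gt0.
rewrite -[2 in X in _ <= X]/(trunc_log 2 6); apply: leq_trunc_log; apply: leq_trans i6.
rewrite -e3 -mulnA leq_mul2l; apply/orP; right; apply: leq_trans i3; rewrite -e2 leq_mul2l i2.
by rewrite orbT.
Qed.

(** [dgen_blocks_plain] is too large by one, since [mn 3 = 2]. If the pointwise stabilizer [R] of
    [B] lies in the kernel, the action on blocks is paid by one element over [H]; otherwise some [r]
    in [R] exchanges the other two blocks, and this element is saved as well. *)
Lemma dgen_three_blocks : maximal 'N_G(B | to) G -> 4 < #|B| -> odd #|B| ->
  dgen (mn #|S|) G C.
Proof.
move=> maxH B_gt4 oddB; have cS := blocks_card tG bB; rewrite P3 in cS.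
have PB := mem_blocks to G B; have sBS := block_sub bB.
pose H := 'N_G(B | to)%G; pose R := 'C_G(B | to)%G.
have aH : [acts H, on B | to] by apply: subsetIr.
have eHR : 'C_H(B | to) = R.
  apply/eqP; rewrite eqEsubset; apply/andP; split; first by rewrite setSI ?subsetIl.
  rewrite subsetI subsetIr andbT subsetI subsetIl.
  exact: subset_trans (subsetIr _ _) (astab_sub _ _).
have sRH : R \subset H by rewrite -eHR subsetIl.
have dH : dgen (mn #|B|) H R by rewrite -eHR; apply: IH.
have eB : mn #|B| = #|B|./2 by apply: mn_neq3; case: eqP B_gt4 => // ->.
have eSm : mn #|S| = #|S|./2 by apply: mn_neq3; move: cS B_gt4; nlia.
have eCR : 'C_R(S :\: B | to) = C by rewrite subcent_astabU setUC setDU_sub.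
have [sRK|/subsetPn[r Rr nKr]] := boolP (R \subset K).
  have eR : R :=: 'C_K(B | to).
    apply/eqP; rewrite eqEsubset; apply/andP; split; last by rewrite setSI ?kernel_sub.
    by rewrite subsetI sRK subsetIr.
  pose Xs := [seq X <- enum P | X != B].
  have mXs X : X \in Xs = (X \in P) && (X != B) by rewrite mem_filter mem_enum andbC.
  have sXs : size Xs = 2.
    have -> : size Xs = #|P :\ B|.
      rewrite cardE; apply: perm_size; apply: uniq_perm => [||X].
      - exact/filter_uniq/enum_uniq.
      - exact: enum_uniq.
      by rewrite mem_enum mXs in_setD1 andbC.
    by have := cardsD1 B P; rewrite PB P3; nlia.
  have := cost_seq (Xs := Xs) (Y := B) tG bB (step_plain IH ltBS).
  rewrite set0U sXs => dR; have {}dR : dgen (2 * mn #|B|) R C.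
    rewrite eR; apply: dgenS (dR _ _ _ _ _).
    - rewrite -(kernel_stab tG bB) sub_gen // setIS // astabS //.
      apply/subsetP => y Sy; have [By|nBy] := boolP (y \in B); first by rewrite inE By.
      have /and3P[/eqP cP _ _] := block_partition tG bB; rewrite -cP in Sy.
      have /bigcupP[X PX Xy] := Sy; apply/setUP; right; rewrite bigcup_seq; apply/bigcupP.
      by exists X => //; rewrite mXs PX; apply: contraNneq nBy => <-.
    - exact/filter_uniq/enum_uniq.
    - by move=> X; rewrite mXs => /andP[].
    - exact: sBS.
    - exact: kernel_acts.
    move=> X; rewrite mXs => /andP[PX neX]; apply: (blocks_trivI tG bB) => //.
    by rewrite eq_sym.
  have := dgen_maximal (H := H) maxH (dgen_trans sRH dH dR); apply: dgenW.
  by rewrite eB eSm; move: cS oddB; nlia.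
have aR : [acts R, on S :\: B | to].
  apply: actsD; first exact: subset_trans (subsetIl _ _) aG.
  exact: subset_trans (subsetIr _ _) (astab_sub _ _).
have cSB := cardsDS sBS.
have ltSB : #|S :\: B| < #|S| by move: cSB B_gt1 ltBS; nlia.
have dR := IH aR ltSB; rewrite eCR in dR.
suff dG : dgen (mn #|B|) G R.
  apply: dgenW (dgen_trans (subsetIl _ _) dG dR); rewrite eB eSm mn_neq3; last first.
    by move: cSB cS B_gt4; nlia.
  by move: cSB cS oddB; nlia.
have /setIP[Gr Cr] := Rr.
have rB : to^* B r = B by apply: fix_setact.
have [X PX neX] : exists2 X, X \in P & to^* X r != X.
  apply/exists_inP; apply: contraR nKr; rewrite negb_exists_in => /forall_inP rX.
  by apply: kernelI => // X PX; have := rX X PX; rewrite negbK => /eqP.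
have XJ Z g : g \in G -> 'C_G(to^* Z g | to) = 'C_G(Z | to) :^ g by apply: stab_setact.
have PJ Z g : g \in G -> Z \in P -> to^* Z g \in P.
  by move=> Gg PZ; have := acts_act (acts_blocks to G B) Gg Z; rewrite PZ.
(* [G] is generated modulo [R] by as many elements as [H]: multiplying one generator of [H] modulo [R]
   by a conjugate [y] of [r] moving [B] brings all conjugates of [R], hence [y], into the group. *)
have [g Gg gX] : exists2 g, g \in G & to^* X g = B.
  case/orbitP: PX => h Gh eX; exists h^-1; first by rewrite groupV.
  by rewrite -eX; apply: (actK (to^*)%act).
pose Z := to^* B g; pose y := r ^ g; have Gy : y \in G by rewrite groupJ.
have PZ : Z \in P by apply: PJ.
have Zy : y \in 'C_G(Z | to) by rewrite XJ // memJ_conjg.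
have yB : to^* B y != B.
  rewrite -gX /y -[to^* _ (r ^ g)](actCJ (to^*)%act) /=.
  by rewrite (inj_eq (act_inj (to^*)%act g)).
have [W [sWH lW gW]] := dgenP _ _ _ dH.
(* If [W] is empty the default 1 is modified instead; the new set then has one element, within the
   bound because [B] has more than four points. *)
pose w1 := odflt 1 [pick w in W].
have Hw1 : w1 \in H.
  by rewrite /w1; case: pickP => [w /(subsetP sWH)|_] //=; apply: group1.
pose g1 := w1 * y; pose W' := g1 |: (W :\ w1); pose M := <<W' :|: R>>%G.
have Gw1 : w1 \in G by case/setIP: Hw1.
have Gg1 : g1 \in G by rewrite groupM.
have sWG : W \subset G by apply: subset_trans sWH (subsetIl _ _).
have sW'G : W' \subset G.
  by rewrite subUset sub1set Gg1 (subset_trans (subsetDl _ _) sWG).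
have lW' : #|W'| <= mn #|B|.
  rewrite /W' (leq_trans (leq_card_setU _ _)) // cards1 add1n.
  have [W0|/set0Pn[w Ww]] := eqVneq W set0.
    by rewrite W0 set0D cards0 eB; move: B_gt4; nlia.
  have Ww1 : w1 \in W by rewrite /w1; case: pickP => // /(_ w); rewrite Ww.
  by have := cardsD1 w1 W; rewrite Ww1 add1n => <-.
have sMG : M \subset G by rewrite gen_subG subUset sW'G subsetIl.
have Mg1 : g1 \in M by rewrite mem_gen // !inE eqxx.
have sRM : R \subset M by rewrite sub_gen ?subsetUr.
have Mr : r \in M by apply: (subsetP sRM).
pose X1 := to^* B g1; have eX1 : X1 = to^* B y.
  rewrite /X1 /g1 [LHS](actM (to^*)%act) /=; congr (to^* _ y).
  by apply: astabs_setact; case/setIP: Hw1.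
have PX1 : X1 \in P by apply: PJ.
have neX1 : X1 != B by rewrite eX1.
have sX1M : 'C_G(X1 | to) \subset M.
  by rewrite XJ // -(conjGid Mg1) conjSg.
have inj_r : injective (fun V : {set T} => to^* V r) by apply: (act_inj (to^*)%act).
(* [r] fixes [B] and moves some block, so it exchanges the two others; conjugation by [r] thus
   reaches the stabilizer of the third block. *)
have third V : V \in P -> V != B -> V != X1 -> to^* X1 r = V.
  move=> PV neV neVX1; have eP : P = [set B; X1; V].
    apply/esym/eqP; rewrite eqEcard P3 !subUset !sub1set PB PX1 PV /=.
    by rewrite card_set3 // eq_sym.
  have PX1r : to^* X1 r \in P by apply: PJ.
  have nB V' : V' != B -> to^* V' r != B.
    by move=> ne; rewrite -[X in _ != X]rB (inj_eq inj_r).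
  have neX' : X != B by apply: contraNneq neX => ->; apply/eqP.
  move: (PX1r); rewrite eP !inE (negPf (nB _ neX1)) /= => /orP[/eqP eX1r|/eqP //].
  have : X \in P by []; rewrite eP !inE (negPf neX') /= => /orP[/eqP e|/eqP e].
    by rewrite e eX1r eqxx in neX.
  have : to^* V r \in P by apply: PJ.
  rewrite eP !inE (negPf (nB _ neV)) -e (negPf neX) orbF /= => /eqP eXr.
  by move: neVX1; rewrite -e -(inj_eq inj_r) eXr eX1r eqxx.
have sVM V : V \in P -> 'C_G(V | to) \subset M.
  move=> PV; have [->//|neV] := eqVneq V B; have [->//|neV1] := eqVneq V X1.
  by rewrite -(third V PV neV neV1) XJ // -(conjGid Mr) conjSg.
have My : y \in M by apply: (subsetP (sVM Z PZ)).
have Mw1 : w1 \in M by rewrite -(groupMr w1 My).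
have sWM : W \subset M.
  apply/subsetP => w Ww; have [->//|ne] := eqVneq w w1.
  by rewrite mem_gen // !inE ne Ww orbT.
have sHM : H \subset M by apply: subset_trans gW _; rewrite gen_subG subUset sWM.
have sGM : G \subset M.
  apply: (maximal_full (H := H) maxH sHM sMG); apply/subsetPn; exists g1 => //.
  by apply: contra neX1 => /setIP[_ /astabs_setact e]; apply/eqP.
by apply/dgenP; exists W'.
Qed.

End ThreeBlocks.

Lemma mn_lt n : 1 < n -> mn n < n.
Proof. by rewrite /mn; case: eqP => [->|] //; nlia. Qed.

(** * Choice of the block system *)

Section Imprimitive.
Variables (gT : finGroupType) (T : finType) (to : {action gT &-> T}).
Variables (G : {group gT}) (S : {set T}).
Hypotheses (tG : [transitive G, on S | to]) (IH : MN_lt gT #|S|).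

Local Notation C := 'C_G(S | to).
Local Notation U X := 'C_G(S :\: X | to).
Let aG := atrans_acts tG.

(** For [k] blocks of odd size [b], the sum of [k./2] and [k] times [b./2] is exactly the half of
    [k * b]; excluding [k = 3] keeps [mn k] equal to [k./2]. *)
Lemma dgen_odd_block (B : {set T}) : block to G S B -> 1 < #|B| -> #|B| < #|S| -> odd #|B| ->
  #|orbit to^* G B| != 3 -> dgen (mn #|S|) G C.
Proof.
move=> bB B_gt1 ltBS oddB k3; have cS := blocks_card tG bB.
have k_gt1 := blocks_gt1 tG bB ltBS.
have nS : #|S| != 3 by rewrite cS; move: k_gt1 B_gt1 oddB; clear; case: #|B| => [|[|[|]]] //; nia.
rewrite (mn_neq3 nS) cS; have [b3|b3] := eqVneq #|B| 3.
  apply: dgenW (dgen_blocks3 tG bB IH B_gt1 ltBS b3); rewrite mn_neq3 // b3.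
  by move: k_gt1; nlia.
apply: dgenW (dgen_blocks_plain tG bB IH B_gt1 ltBS); rewrite !mn_neq3 //.
have := odd_double_half #|B|; rewrite oddB => <-.
move: #|orbit _ _ _| (#|B|./2) => k c; clear.
have -> : (true + c.*2)./2 = c by case: c => //= c; lia.
have -> : (k * (true + c.*2))%N = (k + (k * c).*2)%N by rewrite -!muln2 mulnDr muln1 mulnA.
by move: (k * c)%N => e; lia.
Qed.

Lemma maximal_block_stab (M : {group gT}) x : x \in S -> 'C_G[x | to] \subset M -> maximal M G ->
  M != 'C_G[x | to] :> {set gT} ->
  let B := orbit to M x in [/\ block to G S B, 1 < #|B|, #|B| < #|S| & M :=: 'N_G(B | to)].
Proof.
move=> Sx sxM maxM neM B; have /andP[sMG nGM] := maxgroupp maxM.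
have bB : block to G S B by apply: block_supgroup.
have aM : [acts M, on B | to] by apply: acts_orbit; apply: subsetT.
have Bx : x \in B by apply: orbit_refl.
have sNM : 'N_G(B | to) \subset M.
  apply/subsetP => g /setIP[Gg Ng].
  have : to x g \in B by rewrite (astabs_act _ Ng).
  case/orbitP => m Mm exm; rewrite -(groupMr g (groupVr Mm)); apply: (subsetP sxM).
  apply/setIP; split; first by rewrite groupM // groupV (subsetP sMG).
  by apply/astab1P; rewrite actM -exm actK.
split=> //.
- rewrite ltn_neqAle eq_sym card_gt0; apply/andP; split; last by apply/set0Pn; exists x.
  apply: contra neM => /cards1P[y eB]; rewrite eqEsubset sxM andbT.
  apply/subsetP => m Mm; apply/setIP; split; first exact: (subsetP sMG).
  apply/astab1P; have : to x m \in B by apply: mem_orbit.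
  by move: Bx; rewrite eB => /set1P-> /set1P.
- rewrite ltn_neqAle (subset_leq_card (block_sub bB)) andbT; apply/eqP => cB.
  have /eqP eB : B == S by rewrite eqEcard (block_sub bB) cB leqnn.
  case/negP: nGM; apply: subset_trans sNM; rewrite eB; apply/subsetP => g Gg; apply/setIP.
  by split=> //; apply: (subsetP aG).
apply/eqP; rewrite eqEsubset sNM andbT; apply/subsetP => m Mm; apply/setIP.
by split; [apply: (subsetP sMG) | apply: (subsetP aM)].
Qed.

Lemma dgen_even_blocks (B : {set T}) : ~~ odd #|S| -> block to G S B -> 1 < #|B| -> #|B| < #|S| ->
  maximal 'N_G(B | to) G -> dgen (mn #|S|) G C.
Proof.
move=> evS bB B_gt1 ltBS maxB.
pose proper_block D := [&& block to G S D, 1 < #|D| & #|D| < #|S|].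
have cS D : block to G S D -> #|S| = (#|orbit to^* G D| * #|D|)%N by apply: blocks_card.
have mS : mn #|S| = #|S|./2 by apply: mn_even.
have [/existsP[D /andP[/and3P[bD D1 DS] oddD]]|] :=
    boolP [exists D : {set T}, proper_block D && odd #|D|].
  apply: (dgen_odd_block bD D1 DS oddD); apply: contra evS => /eqP k3.
  by rewrite (cS D bD) k3 oddM oddD.
rewrite negb_exists => /forallP noD.
have ev D : proper_block D -> ~~ odd #|D| by move=> pD; have := noD D; rewrite pD.
(* All proper blocks are even from here on. A block is bad if the elements moving only its points do
   not satisfy the bound lowered by one. *)
pose bad D := proper_block D && ~~ dgen #|D|.-1./2 (U D) C.
have pB : proper_block B by apply/and3P.
have sCU (D : {set T}) : C \subset U D by rewrite setIS // astabS ?subsetDl.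
have [/existsP[D0 badD0]|noBad] := boolP [exists D : {set T}, bad D]; last first.
  (* The unit saved on [U B] pays for the element that completes the maximal subgroup [H] to [G]. *)
  have dU : dgen #|B|.-1./2 (U B) C.
    by apply: contraR noBad => nd; apply/existsP; exists B; rewrite /bad pB.
  pose H := 'N_G(B | to)%G; have sBS := block_sub bB.
  have sUH : U B \subset H by apply: normal_sub (out_normal tG bB).
  have aH : [acts H, on S :\: B | to].
    apply: actsD; first exact: subset_trans (subsetIl _ _) aG.
    exact: subsetIr.
  have eHU : 'C_H(S :\: B | to) = U B.
    apply/eqP; rewrite eqEsubset setSI ?subsetIl //=.
    by apply/subsetP => g Ug; apply/setIP; split; [apply: (subsetP sUH)|case/setIP: Ug].
  have cSB := cardsDS sBS; have evB := ev B pB.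
  have ltSB : #|S :\: B| < #|S| by move: cSB B_gt1 ltBS; nlia.
  have dH := IH aH ltSB; rewrite eHU in dH.
  apply: dgenW (dgen_maximal (H := H) maxB (dgen_trans sUH dH dU)).
  rewrite mS mn_even; last by rewrite cSB oddB 1?ltnW // (negPf evS) (negPf evB).
  by rewrite cSB; move: evS evB B_gt1 ltBS; nlia.
have [D badD minD] := arg_minnP (fun D : {set T} => #|D|) badD0.
have /andP[pD ndD] := badD; have /and3P[bD D1 DS] := pD; have evD := ev D pD.
have sDS := block_sub bD; have eUC := out_stab bD.
have [sUD|/subsetPn[u Uu nCu]] := boolP (U D \subset 'C(D | to)).
  case/negP: ndD; apply: dgenW (leq0n _) (dgen0 _); rewrite -eUC sub_gen //.
  by rewrite subsetI subxx.
have [x Dx ux] : exists2 x, x \in D & to x u != x.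
  apply/exists_inP; apply: contraR nCu; rewrite negb_exists_in => /forall_inP fx.
  by apply/astabP => x Dx; have := fx x Dx; rewrite negbK => /eqP.
have aU := out_acts tG bD; pose E := orbit to (U D) x.
have bE : block to G S E.
  apply: (block_trans bD); apply: (block_normal (G := 'N_G(D | to)%G) (V := 'C_G(S :\: D | to)%G)).
  - exact: subsetIr.
  - exact: Dx.
  exact: out_normal.
have sED : E \subset D by rewrite acts_sub_orbit.
have E1 : 1 < #|E|.
  rewrite (cardsD1 x) orbit_refl ltnS card_gt0; apply/set0Pn; exists (to x u).
  by rewrite in_setD1 ux mem_orbit.
have ES : #|E| < #|S| by apply: leq_ltn_trans DS; apply: subset_leq_card.
have pE : proper_block E by apply/and3P.
(* An orbit [E] smaller than [D] is a block that is not bad, by minimality; splitting the cost of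
   [U D] along [E] would then save the unit for [D] too. So [U D] is transitive on [D]. *)
have [eED|neED] := eqVneq E D; last first.
  have ltED : #|E| < #|D| by apply: proper_card; rewrite properEneq neED.
  have dE : dgen #|E|.-1./2 (U E) C.
    by apply: contraLR ltED => nd; rewrite -leqNgt; apply: minD; rewrite /bad pE.
  case/negP: ndD.
  have aUE : [acts U D, on D :\: E | to].
    by apply: actsD => //; apply: acts_orbit; apply: subsetT.
  have cDE := cardsDS sED; have evE := ev E pE.
  have ltDE : #|D :\: E| < #|S| by move: cDE DS; nlia.
  have := IH (G := 'C_G(S :\: D | to)%G) aUE ltDE.
  rewrite /= subcent_astabU setDD_sub //.
  move=> dD; have sUE : U E \subset U D by rewrite setIS // astabS // setDS.
  apply: dgenW (dgen_trans sUE dD dE); rewrite mn_even; last first.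
    by rewrite cDE oddB ?(negPf evD) ?(negPf evE) // ltnW.
  by rewrite cDE; move: evD evE ltED E1; nlia.
have tU : [transitive U D, on D | to] by rewrite -[X in [transitive _, on X | _]]eED; apply/imsetP; exists x; rewrite // orbit_refl.
have k1 := blocks_gt1 tG bD DS; have ltk := mn_lt k1.
rewrite mS (cS D bD).
(* Size 4 is set apart because a point stabilizer then acts on 3 points. *)
have [D4|D4] := eqVneq #|D| 4.
  apply: dgenW (dgen_blocks4 tG bD IH D1 DS D4 tU).
  by rewrite D4; move: ltk k1; nlia.
apply: dgenW (dgen_blocks_out_gen tG bD IH D1 DS (out_dgen tG bD IH DS) tU).
have [D2|D2] := eqVneq #|D| 2.
  by rewrite D2 /= muln0 addn0 (_ : mn 2 = 1%N) // muln2 doubleK addn1.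
rewrite (mn_even evD) (@mn_neq3 #|D|.-1); last by move: D4; nlia.
have := even_halfK evD; move: ltk k1 D1; move: #|orbit _ _ _| (mn _) (#|D|./2) => k m c ltk k1 D1 ec; rewrite -ec in D1 *.
have -> : c.*2.-1./2 = c.-1 by nlia.
have c0 : 0 < c by move: D1; nlia.
by move: c0 ltk k1; rewrite -muln2 mulnA muln2 doubleK; clear; nia.
Qed.

End Imprimitive.

(** * The McIver-Neumann theorem *)

Section McIverNeumann.
Variables (gT : finGroupType) (T : finType) (to : {action gT &-> T}).
Implicit Types (G : {group gT}) (S D : {set T}).

Lemma dgen_transitive G S : [transitive G, on S | to] -> MN_lt gT #|S| ->
  dgen (mn #|S|) G 'C_G(S | to).
Proof.
move=> tG IH; have aG := atrans_acts tG.
have [x Sx] : exists x, x \in S by case/imsetP: (tG) => x Sx _; exists x.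
have [exG|[M maxM sxM]] := @maximal_exists _ 'C_G[x | to] G (subsetIl _ _).
  apply: dgenW (leq0n _) (dgen0 _); rewrite sub_gen // subsetI subxx /=.
  apply/subsetP => g Gg; apply/astabP => y Sy; have [h Gh ->] := atransP2 tG Sx Sy.
  have fx k : k \in G -> to x k = x by rewrite -exG => /setIP[_ /astab1P].
  by rewrite fx // fx.
have [eM|neM] := eqVneq (M : {set gT}) 'C_G[x | to].
  by apply: dgen_primitive Sx _ => //; rewrite -eM.
have [bB B1 BS eM] := maximal_block_stab tG Sx sxM maxM neM.
set B := orbit to M x in bB B1 BS eM; rewrite eM in maxM.
have [oddS|evS] := boolP (odd #|S|); last exact: dgen_even_blocks bB B1 BS maxM.
have cS := blocks_card tG bB.
have oddB : odd #|B| by move: oddS; rewrite cS oddM => /andP[].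
have [k3|k3] := eqVneq #|orbit to^* G B| 3; last exact: dgen_odd_block bB B1 BS oddB k3.
have [b3|b3] := eqVneq #|B| 3.
  by have := dgen_blocks33 tG bB IH B1 BS k3 b3; rewrite cS k3 b3.
apply: (dgen_three_blocks tG bB IH B1 BS k3 maxM _ oddB).
by move: B1 oddB b3; nlia.
Qed.

Lemma mn_leD a b : a != 3 -> b != 3 -> mn a + mn b <= mn (a + b).
Proof.
by move=> a3 b3; rewrite (mn_neq3 a3) (mn_neq3 b3) /mn; case: ifP; move: a3 b3; nlia.
Qed.

Lemma mn_leS n : mn n <= mn n.+1.
Proof. by rewrite /mn; do 2!case: eqP; nlia. Qed.

Section Invariant.
Variables (G : {group gT}) (S D : {set T}).
Hypotheses (aG : [acts G, on S | to]) (aD : [acts G, on D | to]) (sDS : D \subset S).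
Hypothesis IH : MN_lt gT #|S|.
Local Notation C := 'C_G(S | to).
Local Notation U := 'C_G(S :\: D | to).

Let aSD : [acts G, on S :\: D | to]. Proof. exact: actsD. Qed.
Let aU : [acts U, on D | to]. Proof. exact: acts_astab_out. Qed.
Let eUC : 'C_U(D | to) = C. Proof. by rewrite subcent_astabU setDU_sub. Qed.

Lemma dgen_fixed : #|D| = 1%N -> dgen (mn #|S|) G C.
Proof.
move=> D1; have cSD := cardsDS sDS; rewrite D1 in cSD.
have S0 : 0 < #|S| by rewrite -D1 subset_leq_card.
have := IH aSD; rewrite cSD subn1 ltn_predL => /(_ S0).
have -> : U = C.
  rewrite -eUC; apply/esym/setIidPl; apply/subsetP => g Ug; apply/astabP => x Dx.
  have le1 : #|D| <= 1 by rewrite D1.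
  by apply: (card_le1_eq le1 _ Dx); rewrite (mem_act _ aU).
by apply: dgenW; rewrite -{2}(prednK S0) mn_leS.
Qed.

Lemma dgen_split : D != set0 -> D != S -> #|D| != 3 -> #|S :\: D| != 3 -> dgen (mn #|S|) G C.
Proof.
move=> D0 DS D3 E3; have cSD := cardsDS sDS.
have Dgt0 : 0 < #|D| by rewrite card_gt0.
have ltDS : #|D| < #|S| by apply: proper_card; rewrite properEneq DS.
have ltSD : #|S :\: D| < #|S| by move: cSD Dgt0 ltDS; nlia.
have dU := IH (G := 'C_G(S :\: D | to)%G) aU ltDS; rewrite eUC in dU.
apply: dgenW (dgen_trans (subsetIl _ _) (IH aSD ltSD) dU).
apply: leq_trans (mn_leD E3 D3) _; rewrite cSD subnK // ltnW //.
Qed.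

Lemma agree_orbit (a v : gT) x : a \in G -> a * v^-1 \in 'C(D | to) -> x \in D -> orbit to <[v]> x = D ->
  orbit to <[a]> x = D.
Proof.
move=> Ga Cav Dx oD; apply/eqP; rewrite eqEsubset; apply/andP; split.
  by rewrite acts_sub_orbit // cycle_subG (subsetP aD).
rewrite -{1}oD; apply/subsetP => _ /orbitP[_ /cycleP[i ->] <-].
have -> : to x (v ^+ i) = to x (a ^+ i); last by rewrite mem_orbit ?mem_cycle.
elim: i => [|i IHi]; rewrite ?expg0 // !expgSr !actM IHi.
have Dy : to x (a ^+ i) \in D by rewrite (mem_act _ aD) ?groupX.
by rewrite -{1}(astab_act Cav Dy) -[LHS]actM mulgKV.
Qed.

(** Only one nontrivial permutation of three points fixes [x], and it is an involution. *)
Lemma two_transpositions (w t : gT) x : #|D| = 3 -> x \in D -> w \in G -> t \in G ->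
  to x w = x -> to x t = x -> w \notin 'C(D | to) -> t \notin 'C(D | to) -> w * t \in 'C(D | to).
Proof.
move=> D3 Dx Gw Gt wx tx nCw nCt.
have moved p u : p \in G -> to x p = x -> p \notin 'C(D | to) -> u \in D -> u != x -> to u p != u.
  move=> Gp px nCp Du neux; apply: contra nCp => /eqP pu.
  by have /setIP[] := fix_two_of_three aD D3 Gp Dx Du neux px pu.
have [u Du neux] : exists2 u, u \in D & u != x by apply: card_gt1_other; rewrite D3.
have uwx : to u w != x by rewrite -{1}wx (inj_eq (act_inj _ _)).
have Duw : to u w \in D by rewrite (mem_act _ aD).
suff uwt : to u (w * t) = u.
  have wtx : to x (w * t) = x by rewrite actM wx.
  by have /setIP[] := fix_two_of_three aD D3 (groupM Gw Gt) Dx Du neux wtx uwt.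
have W1 : to (to u w) t \in D :\: [set x; to u w].
  by rewrite !inE negb_or moved // (mem_act _ aD) // Duw !andbT -{1}tx (inj_eq (act_inj _ _)).
have W2 : u \in D :\: [set x; to u w] by rewrite !inE negb_or neux eq_sym moved.
rewrite actM; apply: card_le1_eq W1 W2; rewrite cardsDS ?D3 ?cards2 1?eq_sym ?uwx //.
by rewrite subUset !sub1set Dx.
Qed.

(** Plain splitting would pay 2 for [D]. One suffices, since a generator used for the other points
    can be adjusted inside [U] to supply a 3-cycle on [D]. *)
Lemma dgen_three_invariant : #|D| = 3 -> 1 < #|S :\: D| -> dgen (mn #|S :\: D|).+1 G C.
Proof.
move=> D3 E1; have cSD := cardsDS sDS.
have ltSD : #|S :\: D| < #|S|.
  by move: cSD (subset_leq_card sDS); rewrite D3; nlia.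
have dGU := IH aSD ltSD; have nU : U <| G by apply: stab_normal.
have [x Dx] : exists x, x \in D by apply/card_gt0P; rewrite D3.
rewrite -addn1; have [dU|[v Uv ov]] := three_cycle_or (Y := 'C_G(S :\: D | to)%G) aU D3 Dx.
  by rewrite eUC in dU; apply: dgen_trans (subsetIl _ _) dGU dU.
have [sC|/subsetPn[t /setIP[Ut /astab1P tx] nCt]] := boolP ('C_U[x | to] \subset 'C(D | to)).
  apply: dgen_trans (subsetIl _ _) dGU _; rewrite -eUC.
  by apply: (dgen1_stab (Y := 'C_G(S :\: D | to)%G)) Dx sC => //; rewrite D3.
have sUG : U \subset G by apply: subsetIl.
have [A [sAG lA gA]] := dgenP _ _ _ dGU.
pose a := odflt 1 [pick a in A].
have Ga : a \in G.
  by rewrite /a; case: pickP => [w /(subsetP sAG)|_] //=; apply: group1.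
(* Correcting [a] by an element of [U] makes it act on [D] as the 3-cycle [v]. *)
have [u Uu Cu] : exists2 u, u \in U & a * u * v^-1 \in 'C(D | to).
  have [u1 Uu1 u1x] : exists2 u1, u1 \in U & to (to x a) u1 = to x v.
    have tU : [transitive U, on D | to].
      apply/imsetP; exists x => //; apply/eqP; rewrite eqEsubset; apply/andP; split.
        by rewrite -{1}ov imsetS // cycle_subG.
      by rewrite acts_sub_orbit.
    have [] := atransP2 tU (_ : to x a \in D) (_ : to x v \in D).
    - by rewrite (mem_act _ aD).
    - by rewrite (mem_act _ aU).
    by move=> u1 Uu1 e; exists u1.
  pose w := a * u1 * v^-1; have Gw : w \in G.
    by rewrite !groupM ?groupV // (subsetP sUG).
  have wx : to x w = x by rewrite /w !actM u1x actK.
  have [Cw|nCw] := boolP (w \in 'C(D | to)); first by exists u1.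
  exists (u1 * (v^-1 * t * v)); first by rewrite !groupM ?groupV.
  have -> : a * (u1 * (v^-1 * t * v)) * v^-1 = w * t by rewrite /w !mulgA mulgK.
  by apply: (two_transpositions D3 Dx Gw (subsetP sUG t Ut) wx tx nCw nCt).
pose a' := a * u; pose A' := a' |: (A :\ a).
have Ga' : a' \in G by rewrite groupM // (subsetP sUG).
have oa' : orbit to <[a']> x = D by apply: agree_orbit Cu Dx ov.
have sA'G : A' \subset G.
  by rewrite subUset sub1set Ga' (subset_trans (subsetDl _ _) sAG).
have lA' : #|A'| <= mn #|S :\: D|.
  rewrite /A' (leq_trans (leq_card_setU _ _)) // cards1 add1n.
  have [A0|/set0Pn[w Aw]] := eqVneq A set0.
    by rewrite A0 set0D cards0 /mn; case: ifP; move: E1; nlia.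
  have Aa : a \in A by rewrite /a; case: pickP => // /(_ w); rewrite Aw.
  by have := cardsD1 a A; rewrite Aa add1n => <-.
have dU : dgen 1 U (A' :|: C).
  have Na' : a' \in 'N(U) by apply: (subsetP (normal_norm nU)).
  have := dgen_three (Y := 'C_G(S :\: D | to)%G) aU D3 Dx Na' oa'; rewrite eUC.
  by apply: dgenS; rewrite sub_gen // setSU // sub1set setU11.
have dG : dgen 0 G (A' :|: U).
  apply: dgen0; apply: subset_trans gA _; rewrite gen_subG subUset.
  have sUM : U \subset <<A' :|: U>> by rewrite sub_gen ?subsetUr.
  rewrite sUM andbT; apply/subsetP => w Aw; have [->|ne] := eqVneq w a; last first.
    by rewrite mem_gen // !inE ne Aw orbT.
  rewrite -(groupMr a (subsetP sUM u Uu)); apply: mem_gen.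
  by rewrite !inE eqxx.
apply: dgenW (dgen_add sA'G (dgen_transN sUG dG dU)).
by rewrite leq_add2r.
Qed.

End Invariant.

End McIverNeumann.

Theorem McIver_Neumann (gT : finGroupType) (T : finType) (to : {action gT &-> T})
  (G : {group gT}) (S : {set T}) : [acts G, on S | to] -> dgen (mn #|S|) G 'C_G(S | to).
Proof.
move: {2}_.+1 (ltnSn #|S|) => m; elim: m => // m IHm in T to G S *; rewrite ltnS => leSm aG.
have IH : MN_lt gT #|S|.
  by move=> T' to' G' S' aG' ltS'; apply: IHm => //; apply: leq_trans leSm.
have [S0|[x Sx]] := set_0Vmem S.
  by apply: dgenW (leq0n _) (dgen0 _); rewrite sub_gen // S0 subsetI subxx; apply/subsetP => g _;
     apply/astabP => x; rewrite inE.
have [tG|ntG] := boolP [transitive G, on S | to]; first exact: dgen_transitive.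
pose D := orbit to G x; have aD : [acts G, on D | to] by apply: acts_orbit; apply: subsetT.
have sDS : D \subset S by rewrite acts_sub_orbit.
have Dx : x \in D by apply: orbit_refl.
have neDS : D != S.
  by apply: contraNneq ntG => eD; apply/imsetP; exists x.
pose E := S :\: D; have aE : [acts G, on E | to] by apply: actsD.
have sES : E \subset S by apply: subsetDl.
have eD : S :\: E = D by rewrite setDDr setDv set0U; apply/setIidPr.
have cD := cardsDS sDS.
have D0 : D != set0 by apply/set0Pn; exists x.
have D_gt0 : 0 < #|D| by rewrite card_gt0.
have ltDS : #|D| < #|S| by apply: proper_card; rewrite properEneq neDS.
(* Single points go first, because their complement may have 3 points, where neither splitting lemma
   applies. *)
have [D1|D1] := eqVneq #|D| 1%N; first exact: (dgen_fixed aG aD).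
have [E1|E1] := eqVneq #|E| 1%N; first exact: (dgen_fixed aG aE).
have three (n m' : nat) : 1 < m' -> n = (m' + 3)%N -> (mn m').+1 <= mn n.
  by move=> m1 ->; rewrite /mn; do 2!case: ifP; move: m1; nlia.
have E_gt1 : 1 < #|E| by move: cD E1 ltDS; rewrite -/E; nlia.
have [D3|D3] := eqVneq #|D| 3.
  apply: dgenW (dgen_three_invariant aG aD sDS IH D3 E_gt1); apply: three => //.
  by move: cD D3 ltDS; rewrite -/E; nlia.
have [E3|E3] := eqVneq #|E| 3.
  have D_gt1 : 1 < #|D| by move: D1 D_gt0; nlia.
  have := dgen_three_invariant aG aE sES IH E3; rewrite eD => /(_ D_gt1).
  apply: dgenW; apply: three => //.
  by move: cD E3 ltDS; rewrite -/E; nlia.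
exact: (dgen_split aG aD).
Qed.

(** * Semigroups of partial injections *)

Section Restriction.
Variable n : nat.
Implicit Types (p q : {perm 'I_n}) (D E R : {set 'I_n}) (f g : sym_inv n).

(** Presenting partial injections as permutations cut down to a domain lets arrows be composed and
    inverted as permutations; off the domain the permutation is arbitrary. *)
Definition restr_fun p D : {ffun 'I_n -> option 'I_n} :=
  [ffun x => if x \in D then Some (p x) else None].

Lemma restr_fun_inj p D : pinjective (restr_fun p D).
Proof.
apply/pinjectiveP => x y z; rewrite !ffunE; case: ifP => // _ [<-]; case: ifP => // _ [].
by move/perm_inj.
Qed.

Definition restr p D : sym_inv n := SymInv (restr_fun_inj p D).

Lemma restrE p D x : restr p D x = if x \in D then Some (p x) else None.
Proof. by rewrite /= ffunE. Qed.

Lemma sym_inv_eq f g : f =1 g -> f = g.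
Proof. by move=> fg; apply/val_inj/ffunP. Qed.

Lemma mul_symE f g x : (f * g) x = obind g (f x).
Proof. by rewrite /= ffunE. Qed.

Lemma eq_restr p q D : {in D, p =1 q} -> restr p D = restr q D.
Proof. by move=> pq; apply: sym_inv_eq => x; rewrite !restrE; case: ifP => // /pq->. Qed.

Lemma restrM p q D : restr p D * restr q (p @: D) = restr (p * q) D.
Proof.
apply: sym_inv_eq => x; rewrite mul_symE !restrE; case: ifP => //= Dx.
by rewrite ffunE imset_f // permM.
Qed.

Lemma map_rank_restr p D : map_rank (restr p D) = #|D|.
Proof.
rewrite /map_rank -(card_imset D (@perm_inj _ p)); apply: eq_card => y; rewrite inE.
apply/existsP/imsetP => [[x /eqP]|[x Dx ->]]; last by exists x; rewrite restrE Dx.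
by rewrite restrE; case: ifP => // Dx [<-]; exists x.
Qed.

Lemma imset_permM p q D : (p * q) @: D = q @: (p @: D).
Proof. by rewrite -imset_comp; apply: eq_imset => x; rewrite permM. Qed.

Lemma imset_perm1 D : (1 : {perm 'I_n}) @: D = D.
Proof. by rewrite -[RHS]imset_id; apply: eq_imset => x; rewrite perm1. Qed.

Lemma imset_permV p D E : p @: D = E -> p^-1 @: E = D.
Proof. by move=> <-; rewrite -imset_permM mulgV imset_perm1. Qed.

(** Domain and image have complements of equal size, which are matched along their enumerations. *)
Lemma restr_exists f : exists p D, f = restr p D.
Proof.
pose D := [set x | f x != None].
have fD x : x \in D -> exists y, f x = Some y by rewrite inE; case: (f x) => // y; exists y.
have /pinjectiveP f_inj := valP f.
pose h x := odflt x (f x).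
have fh x : x \in D -> f x = Some (h x) by move=> /fD[y fx]; rewrite /h fx.
have h_inj : {in D &, injective h}.
  by move=> x y Dx Dy e; apply: (f_inj x y (h x)); rewrite fh // e.
pose E := h @: D; have cE : #|~: E| = #|~: D|.
  by apply/eqP; rewrite -(eqn_add2l #|E|) cardsC {1}card_in_imset // cardsC.
pose g x := if x \in D then h x else nth x (enum (~: E)) (index x (enum (~: D))).
have ltg x : x \notin D -> index x (enum (~: D)) < size (enum (~: E)).
  by move=> nDx; rewrite -cardE cE cardE index_mem mem_enum inE.
have gE x : x \notin D -> nth x (enum (~: E)) (index x (enum (~: D))) \notin E.
  by move=> nDx; have := mem_nth x (ltg x nDx); rewrite mem_enum inE.
have g_inj : injective g.
  move=> x y; rewrite /g; case: ifPn => Dx; case: ifPn => Dy.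
  - exact: h_inj.
  - by move=> e; have := gE y Dy; rewrite -e imset_f.
  - by move=> e; have := gE x Dx; rewrite e imset_f.
  move/eqP; rewrite (set_nth_default x y (ltg y Dy)) nth_uniq ?ltg ?enum_uniq // => /eqP e.
  have : nth x (enum (~: D)) (index x (enum (~: D))) = nth x (enum (~: D)) (index y (enum (~: D))).
    by rewrite e.
  by rewrite !nth_index // mem_enum inE.
exists (perm g_inj), D; apply: sym_inv_eq => x; rewrite restrE permE /g.
case Dx: (x \in D); first exact: fh.
by move: Dx; rewrite inE => /negbFE/eqP.
Qed.

(** The first equation forces [f] to undo [p] on the image of [D], the second leaves [f] undefined
    elsewhere. *)
Lemma restr_inverse p D f : restr p D * f * restr p D = restr p D -> f * restr p D * f = f ->
  f = restr p^-1 (p @: D).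
Proof.
move=> e1 e2; have /pinjectiveP f_inj := valP f.
have fp x : x \in D -> f (p x) = Some x.
  move=> Dx; have := congr1 (fun h : sym_inv n => h x) e1.
  rewrite !mul_symE !restrE Dx /=; case: (f (p x)) => //= z.
  by rewrite ffunE; case: ifP => // Dz [/perm_inj->].
apply: sym_inv_eq => y; rewrite restrE; case: ifPn => [/imsetP[x Dx ->]|nDy].
  by rewrite permK fp.
case fy: (f y) => [x|] //; have := congr1 (fun h : sym_inv n => h y) e2.
rewrite !mul_symE fy /= ffunE; case: ifP => //= Dx _.
by case/negP: nDy; rewrite (f_inj _ _ _ fy (fp x Dx)) imset_f.
Qed.

End Restriction.

(** * The groupoid of restrictions and its generators *)

Section Loops.
Variables (n : nat) (S : {set sym_inv n}).
Hypotheses (cS : subsemigroup S)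
  (iS : forall (p : {perm 'I_n}) (D : {set 'I_n}), restr p D \in S -> restr p^-1 (p @: D) \in S).
Implicit Types (p q : {perm 'I_n}) (D E R : {set 'I_n}).

Let SM (x y : sym_inv n) : x \in S -> y \in S -> x * y \in S.
Proof. by move: x y; apply/subsemigroupP. Qed.

Lemma restr_dom p D : restr p D \in S -> restr 1 D \in S.
Proof. by move=> Sp; have := SM Sp (iS Sp); rewrite restrM mulgV. Qed.

Lemma restr_im p D : restr p D \in S -> restr 1 (p @: D) \in S.
Proof. by move=> Sp; apply: restr_dom (iS Sp). Qed.

Lemma restr_mul p q D E : p @: D = E -> restr p D \in S -> restr q E \in S -> restr (p * q) D \in S.
Proof. by move=> <- Sp Sq; rewrite -restrM SM. Qed.

Definition loops D := [set p : {perm 'I_n} | (restr p D \in S) && (p @: D == D)].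

Lemma loopsP D p : reflect (restr p D \in S /\ p @: D = D) (p \in loops D).
Proof. by rewrite inE; apply: (iffP andP) => -[? /eqP]. Qed.

Lemma loops_group_set D : restr 1 D \in S -> group_set (loops D).
Proof.
move=> S1; apply/group_setP; split; first by apply/loopsP; rewrite imset_perm1.
move=> p q /loopsP[Sp pD] /loopsP[Sq qD]; apply/loopsP; rewrite imset_permM pD qD.
by split=> //; apply: restr_mul pD Sp Sq.
Qed.

(* Permutations fixing [D] pointwise all restrict to the idempotent on [D], which is a power of any
   loop: nonemptiness of the generating set is what makes them free. *)
Lemma loops_generators D : restr 1 D \in S -> 1 < #|D| ->
  exists2 A0 : {set {perm 'I_n}}, A0 \subset loops D /\ 0 < #|A0| <= mn #|D| &
  forall Y : {set sym_inv n}, subsemigroup Y -> (forall p, p \in A0 -> restr p D \in Y) ->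
    forall p, p \in loops D -> restr p D \in Y.
Proof.
move=> S1 D1; pose H := Group (loops_group_set S1).
have aH : [acts H, on D | 'P].
  by apply/subsetP => p /loopsP[_ pD]; apply: astabs_setactI; rewrite -[RHS]pD.
have [A1 [sA1 lA1 gA1]] := dgenP _ _ _ (McIver_Neumann aH).
pose A0 := if A1 == set0 then [set 1] else A1.
exists A0.
  rewrite /A0; case: eqVneq => [_|nA1]; last by rewrite sA1 card_gt0 nA1.
  split; first by rewrite sub1set (group1 H).
  by rewrite cards1 /mn; case: ifP; move: D1; nlia.
move=> Y cY YA0 p Hp.
have YM (x y : sym_inv n) : x \in Y -> y \in Y -> x * y \in Y.
  by move: x y; apply/subsemigroupP.
have sA0 : A0 \subset H by rewrite /A0; case: ifP; rewrite // sub1set (group1 H).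
have [a A0a] : exists a, a \in A0.
  by rewrite /A0; case: eqVneq => [_|/set0Pn//]; exists 1; rewrite set11.
pose Z := [set q in H | restr q D \in Y].
have ZP q : reflect (q \in H /\ restr q D \in Y) (q \in Z) by apply: setIdP.
have ZM q1 q2 : q1 \in Z -> q2 \in Z -> q1 * q2 \in Z.
  move=> /ZP[H1 Y1] /ZP[H2 Y2]; apply/ZP; rewrite groupM //; split=> //.
  by have /loopsP[_ e] := H1; rewrite -restrM e YM.
have ZA0 q : q \in A0 -> q \in Z by move=> Aq; apply/ZP; rewrite YA0 // (subsetP sA0).
have Z1 : 1 \in Z.
  have ZX k : a ^+ k.+1 \in Z by elim: k => [|k IHk]; [apply: ZA0 | rewrite expgS; apply: ZM (ZA0 a A0a) IHk].
  by rewrite -(expg_order a) -(prednK (order_gt0 a)).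
(* In a finite group closure under products is enough, so [Y] is not asked to contain inverses. *)
have gZ : group_set Z by apply/group_setP.
have: p \in Group gZ.
  apply: (subsetP _ p Hp); apply: subset_trans gA1 _; rewrite gen_subG subUset.
  apply/andP; split; apply/subsetP => q.
    by move=> A1q; apply: ZA0; rewrite /A0; case: eqP A1q => // ->; rewrite inE.
  case/setIP=> Hq /astabP fq; apply/ZP; split=> //; case/ZP: Z1 => _ Y1.
  by rewrite (eq_restr (q := 1)) // => x Dx; rewrite perm1; apply: fq.
by case/ZP.
Qed.

Definition conn D E := [exists p : {perm 'I_n}, (restr p D \in S) && (p @: D == E)].

Lemma connP D E : reflect (exists2 p : {perm 'I_n}, restr p D \in S & p @: D = E) (conn D E).
Proof. by apply: (iffP existsP) => [[p /andP[Sp /eqP]]|[p Sp <-]]; exists p; rewrite ?Sp /=. Qed.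

Lemma conn_sym D E : conn D E -> conn E D.
Proof.
case/connP=> p Sp pD; apply/connP; exists p^-1; last exact: imset_permV.
by rewrite -pD iS.
Qed.

Lemma conn_trans D E R : conn D E -> conn E R -> conn D R.
Proof.
move=> /connP[p Sp pD] /connP[q Sq qE]; apply/connP; exists (p * q).
  exact: restr_mul pD Sp Sq.
by rewrite imset_permM pD.
Qed.

(** Connected objects have the same predicate [conn], hence the same picked element: the choice
    depends on the component only. *)
Definition base D := odflt D [pick E | conn D E].

Lemma conn_base D : restr 1 D \in S -> conn D (base D).
Proof.
move=> S1; rewrite /base; case: pickP => //= _.
by apply/connP; exists 1; rewrite // imset_perm1.
Qed.

Lemma base_conn D E : conn D E -> base D = base E.
Proof.
move=> cDE; rewrite /base; have -> : [pick R | conn D R] = [pick R | conn E R].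
  apply: eq_pick => R; apply/idP/idP; apply: conn_trans => //; exact: conn_sym.
by case: pickP => // /(_ D); rewrite conn_sym.
Qed.

(* One generating set per object: a generating set of the loop group at the base point of each
   component, and a pair of mutually inverse arrows joining every other object to its base point. *)
Lemma groupoid_generators D : restr 1 D \in S -> 1 < #|D| ->
  exists2 F : {set sym_inv n}, F \subset S /\ #|F| <= maxn 2 (mn #|D|) &
  forall Y : {set sym_inv n}, subsemigroup Y -> F \subset Y ->
    if base D == D then {in loops D, forall p, restr p D \in Y}
    else exists p, [/\ p @: base D = D, restr p (base D) \in Y & restr p^-1 D \in Y].
Proof.
move=> S1 D1; case: eqP => [_|_].
  have [A0 [sA0 /andP[_ lA0]] gA0] := loops_generators S1 D1.
  exists [set restr p D | p in A0].
    split; last by rewrite (leq_trans (leq_imset_card _ _)) // leq_max lA0 orbT.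
    by apply/subsetP => _ /imsetP[p /(subsetP sA0)/loopsP[Sp _] ->].
  by move=> Y cY sFY p; apply: gA0 => // q Aq; apply: (subsetP sFY); apply: imset_f.
have /connP[p Sp pD] := conn_sym (conn_base S1).
exists [set restr p (base D); restr p^-1 D].
  split; last by rewrite cards2 leq_max; case: (_ != _).
  by rewrite subUset !sub1set Sp -[X in restr _ X]pD iS.
by move=> Y cY; rewrite subUset !sub1set => /andP[Y1 Y2]; exists p.
Qed.

(** With [u] and [w] joining the common base object to the domain and to the image of an arrow [p],
    the product [u * p * w^-1] is a loop at the base, and [p] is recovered from it by arrows already
    generated. *)
Lemma restr_generators r : 1 < r ->
  exists2 X : {set sym_inv n}, X \subset S /\ #|X| <= 'C(n, r) * maxn 2 (mn r) &
  forall p D, #|D| = r -> restr p D \in S -> restr p D \in sg_gen X.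
Proof.
move=> r1; pose Ob := [set D : {set 'I_n} | (#|D| == r) && (restr 1 D \in S)].
have ObP D : D \in Ob -> #|D| = r /\ restr 1 D \in S by rewrite inE => /andP[/eqP].
have : forall D, exists F : {set sym_inv n}, D \in Ob ->
    (F \subset S /\ #|F| <= maxn 2 (mn r)) /\
    forall Y : {set sym_inv n}, subsemigroup Y -> F \subset Y ->
    if base D == D then {in loops D, forall p, restr p D \in Y}
    else exists p, [/\ p @: base D = D, restr p (base D) \in Y & restr p^-1 D \in Y].
  move=> D; have [/ObP[cD S1]|_] := boolP (D \in Ob); last by exists set0.
  have [|F hF gF] := groupoid_generators S1; first by rewrite cD.
  by exists F => _; rewrite cD in hF.
case/fin_all_exists=> F hF; pose X := \bigcup_(D in Ob) F D.
have sXS : X \subset S by apply/bigcupsP => D /hF[[]].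
exists X.
  split=> //; apply: (@leq_trans (\sum_(D in Ob) maxn 2 (mn r))).
    rewrite /X; elim/big_rec2: _ => [|D m Z /hF[[_ lF] _] leZ]; first by rewrite cards0.
    by rewrite (leq_trans (leq_card_setU _ _)) ?leq_add.
  rewrite sum_nat_const leq_mul2r; apply/orP; right.
  have := card_draws 'I_n r; rewrite card_ord => <-; apply: subset_leq_card.
  by apply/subsetP => D /ObP[cD _]; rewrite inE cD.
set Y := sg_gen X; have cY : subsemigroup Y by apply: sg_gen_subsemigroup.
have sYS : Y \subset S by apply: sg_gen_min.
have sFY D : D \in Ob -> F D \subset Y.
  by move=> OD; apply: subset_trans (sub_sg_gen X); apply: bigcup_sup.
have YM (x y : sym_inv n) : x \in Y -> y \in Y -> x * y \in Y.
  by move: x y; apply/subsemigroupP.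
have baseOb D : D \in Ob -> base D \in Ob /\ base (base D) = base D.
  move=> /ObP[cD S1]; have cDb := conn_base S1; split; last exact/esym/base_conn.
  case/connP: cDb => p Sp <-; rewrite inE card_imset ?cD ?eqxx ?restr_im //.
  exact: perm_inj.
have loopY D : D \in Ob -> {in loops (base D), forall p, restr p (base D) \in Y}.
  case/baseOb=> /[dup] /hF[_ /(_ Y cY)] + Ob' e; rewrite e eqxx; apply.
  exact: sFY.
have toBase D : D \in Ob ->
    exists p, [/\ p @: base D = D, restr p (base D) \in Y & restr p^-1 D \in Y].
  move=> OD; have [_ /(_ Y cY (sFY D OD))] := hF D OD.
  case: eqP => // e _; exists 1; rewrite invg1 imset_perm1.
  suff Y1 : restr 1 D \in Y by rewrite !e.
  have := loopY D OD 1; rewrite e; apply; apply/loopsP; rewrite imset_perm1.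
  by case/ObP: OD.
move=> p D cD Sp; pose E := p @: D.
have OD : D \in Ob by rewrite inE cD eqxx (restr_dom Sp).
have OE : E \in Ob by rewrite inE card_imset ?cD ?eqxx ?(restr_im Sp) //; apply: perm_inj.
have eb : base D = base E by apply: base_conn; apply/connP; exists p.
have [u [uD Yu Yui]] := toBase D OD; have [w [wE Yw Ywi]] := toBase E OE.
pose q := u * p * w^-1; have wiE := imset_permV wE.
have Lq : q \in loops (base D).
  apply/loopsP; rewrite !imset_permM uD -/E wiE; split=> //.
  apply: (restr_mul (E := E)); first by rewrite imset_permM uD.
    by apply: (restr_mul uD) => //; apply: (subsetP sYS).
  exact: (subsetP sYS).
have -> : p = u^-1 * (q * w) by rewrite /q !mulgA mulVg mul1g mulgKV.
have uiD := imset_permV uD; rewrite -restrM uiD; apply: (YM) => //.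
rewrite -restrM; apply: (YM); first exact: loopY.
by have /loopsP[_ ->] := Lq; rewrite eb.
Qed.

End Loops.

Theorem theorem19 (n r : nat) (S A : {set sym_inv n}) :
  1 < r <= n ->
  (forall f, f \in A -> map_rank f = r) ->
  S = sg_gen A ->
  inverse_semigroup S ->
  sg_rank S <= 'C(n, r) * maxn 2 (r %/ 2).
Proof.
case/andP=> r1 _ rA eS [cS invS].
have iS (p : {perm 'I_n}) (D : {set 'I_n}) : restr p D \in S -> restr p^-1 (p @: D) \in S.
  by case/invS=> f [[Sf e1 e2] _]; rewrite -(restr_inverse e1 e2).
have [X [sXS lX] gX] := restr_generators cS iS r1.
have [_ minS] := sg_rankP cS.
have eX : sg_gen X = S.
  apply/eqP; rewrite eqEsubset sg_gen_min //= {1}eS sg_gen_min ?sg_gen_subsemigroup //.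
  apply/subsetP => f Af; have [p [D ef]] := restr_exists f; rewrite ef; apply: gX.
    by rewrite -(map_rank_restr p) -ef rA.
  by rewrite -ef eS (subsetP (sub_sg_gen A)).
apply: leq_trans (minS X eX) (leq_trans lX _); rewrite leq_mul2l; apply/orP; right.
by rewrite geq_max leq_maxl /mn divn2; case: eqP => [->|_]; rewrite ?leq_maxl ?leq_maxr.
Qed.
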